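(* Let $w\ge1$ be an integer. (i) On the strip $V_{4w}=\{s\in\mathbb C:4w<\mathrm{Re}(s)<4w+4\}$ the function $f$ is analytic and $$(-1)^wf(s)=\int_{\mathbb R}e^{sy}P_{4w}(\pi e^{-2y})\,dy,$$ with $P_{4w}(z)$ an entire function of $z$. (ii) $P_{4w}(\pi e^{-2y})>0$ for all real $y$.
   Context: $\zeta$ is the Riemann zeta-function, $\xi(s)=\tfrac12\pi^{-s/2}s(s-1)\Gamma(s/2)\zeta(s)$, $n(s)=\sin(\pi s/4)\cdot 2\xi(\tfrac12+s)$ and $f(s)=1/n(s)$. For integers $k\ge0$, $\tilde c(4k)=\dfrac{1}{\pi^{3/4}\,\Gamma(5/4+2k)\,(2k-\tfrac14)\,\zeta(\tfrac12+4k)}$. For $w\ge1$, $P_{4w}(z)=(-1)^{w+1}\sum_{k\ge w+1}\tilde c(4k)(-z^2)^k$. *)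

(* Defs.v *)
From HB Require Import structures.
From mathcomp Require Import all_boot all_order all_algebra.
From mathcomp Require Import all_classical all_reals all_analysis.
From mathcomp Require Export complex.

Set Implicit Arguments.
Unset Strict Implicit.
Unset Printing Implicit Defensive.

Import Order.TTheory GRing.Theory Num.Theory.
Import numFieldNormedType.Exports.

Local Open Scope classical_set_scope.
Local Open Scope ring_scope.
Local Open Scope complex_scope.

(* The field R[i] carries its topology and normed structure through the alias
   R[i]^o; limits and derivatives below are taken there. *)

Section ComplexAnalysis.
Context {R : realType}.
Local Notation Re := (@complex.Re R).
Local Notation Im := (@complex.Im R).
Local Notation C := R[i].

Definition Cexp (z : C) : C :=
  (expR (Re z))%:C * (cos (Im z) +i* sin (Im z)).

Definition Csin (z : C) : C := (Cexp ('i * z) - Cexp (- ('i * z))) / (2 * 'i).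

(* x ^ s with the principal logarithm, for real x > 0 only. *)
Definition Cpowr (x : R) (s : C) : C := Cexp (s * (ln x)%:C).

(* [derivable] quantifies over increments in the scalar field, which is R[i]
   here: this is complex differentiability at every point of A, and is used for
   open A only. *)
Definition analytic_on (A : set C) (g : C -> C) : Prop :=
  forall s, A s -> derivable (g : C^o -> C^o) s 1.

Definition Cpsum (m : nat) (u : nat -> C) : nat -> C^o :=
  fun n => \sum_(m <= k < n) u k.

(* The sum over all k >= m, meaningful when [Cpsum m u] converges. *)
Definition Cseries (m : nat) (u : nat -> C) : C := limn (Cpsum m u).

Definition Cintegrable d (T : measurableType d)
    (mu : {measure set T -> \bar R}) (D : set T) (g : T -> C) : Prop :=
  mu.-integrable D (EFin \o (fun x => Re (g x))) /\
  mu.-integrable D (EFin \o (fun x => Im (g x))).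

Definition Cintegral d (T : measurableType d)
    (mu : {measure set T -> \bar R}) (D : set T) (g : T -> C) : C :=
  (\int[mu]_(x in D) Re (g x)) +i* (\int[mu]_(x in D) Im (g x)).

End ComplexAnalysis.

Section SpecialFunctions.
Context {R : realType}.
Local Notation Re := (@complex.Re R).
Local Notation Im := (@complex.Im R).
Local Notation C := R[i].

Definition Euler_integral (s : C) : C :=
  Cintegral (@lebesgue_measure R) `]0, +oo[
    (fun t : R => Cpowr t (s - 1) * (expR (- t))%:C).

(* Euler's integral when 0 < Re s; elsewhere the functional equation
   Gamma (s + n) = s (s + 1) ... (s + n - 1) Gamma s with Re s + n > 0.
   At the poles 0, -1, -2, ... the value is 0, since 1 / 0 = 0. *)
Definition Gamma (s : C) : C :=
  let n := if 0 < Re s then 0%N else (Num.truncn (- Re s)).+1 in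
  Euler_integral (s + n%:R) / \prod_(k < n) (s + k%:R).

Definition Dirichlet_zeta (s : C) : C :=
  Cseries 1 (fun n => Cpowr n%:R (- s)).

Definition zeta_continuation (Z : C -> C) : Prop :=
  analytic_on [set s | s != 1] Z /\
  (forall s, 1 < Re s -> Z s = Dirichlet_zeta s).

(* The case split makes the Dirichlet series the value on 1 < Re s without a
   prior existence proof for the continuation; on the rest of s != 1 the value
   is that of the (unique) analytic continuation. *)
Definition zeta (s : C) : C :=
  if 1 < Re s then Dirichlet_zeta s
  else xget (fun=> 0) zeta_continuation s.

(* At s = 0, s = 1 and at the poles of Gamma (s / 2) this product does not take
   the value of the entire function it extends to. *)
Definition xi (s : C) : C :=
  2^-1 * Cpowr pi (- (s / 2)) * s * (s - 1) * Gamma (s / 2) * zeta s.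

Definition n_fun (s : C) : C := Csin (pi%:C * s / 4) * (2 * xi (2^-1 + s)).

Definition f_fun (s : C) : C := (n_fun s)^-1.

(* The index k stands for 4k: [ctilde4 k] is \tilde c(4k). *)
Definition ctilde4 (k : nat) : C :=
  ((pi `^ (3 / 4))%:C * Gamma (5 / 4 + (2 * k)%:R) * ((2 * k)%:R - 4^-1)
   * zeta (2^-1 + (4 * k)%:R))^-1.

Definition P_term (z : C) (k : nat) : C := ctilde4 k * (- z ^+ 2) ^+ k.

(* [P4 w] is P_{4w}. *)
Definition P4 (w : nat) (z : C) : C :=
  (-1) ^+ w.+1 * Cseries w.+1 (P_term z).

Definition strip (w : nat) : set C :=
  [set s | (4 * w)%:R < Re s < (4 * w)%:R + 4].

End SpecialFunctions.

(* Main.v *)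
(** Write w = m + 1, u = s / 2, and L_F(s) for the integral of e^(sy) F(pi e^(-2y)) dy.
    Dropping the zeta factor from the coefficients of P_{4w} leaves, up to the factors
    2k - 1/4, an alternating series K with coefficients 1 / Gamma(2k + 5/4).  Expanding
    c(x) = x^2/2 - 1 + cos x under a Beta integral shows that K(z) is z^(2m) times a
    positive average of c(zv), so K > 0 and K(x) / x^(2w) is increasing up to a factor 2.
    Restoring zeta gives phat with K(z) = sum_n n^(-1/2) phat(z / n^2); the terms n >= 2
    have relative size at most zeta(4w + 1/2) - 1 <= 1/4, and bootstrapping this yields
    |phat - K| <= (2/3) K, so phat > 0.  The factors 2k - 1/4 come from averaging phat
    against e^(v/4) dv, which gives P_{4w} > 0.

    Each of these steps is a multiplicative convolution, hence a product of transforms: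
    Gamma(u + 5/4) L_K = L_theta with theta(x) = x^(2w+2) / (1 + x^2),
    zeta(1/2 + s) L_phat = L_K, and (u - 1/4) L_P = pi^(-3/4) L_phat.  Finally L_theta is
    a power of pi times int e^(aY) / (1 + e^Y) dY = pi / sin(pi a) at a = w + 1 - s/4, and
    the factors assemble to n(s) L_P(s) = (-1)^w.  Only nonnegative kernels occur, so
    Tonelli's theorem is enough throughout.  Both analyticity claims follow from
    remainder bounds that are quadratic in the increment. *)

Require Import Defs.
From HB Require Import structures.
From mathcomp Require Import all_boot all_order all_algebra.
From mathcomp Require Import all_classical all_reals all_analysis.
From mathcomp Require Import measurable_realfun ring lra.

Import Order.TTheory GRing.Theory Num.Theory.
Import numFieldNormedType.Exports.

Local Open Scope classical_set_scope.
Local Open Scope ring_scope.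
Local Open Scope complex_scope.

Local Notation Re := (@complex.Re _).
Local Notation Im := (@complex.Im _).

(** The strip lies in Re s > 4, so [zeta] is met only as a Dirichlet series and [Gamma] only as
    Euler's integral; neither is continued or differentiated, and f is analytic because it turns out
    to be a Laplace transform. Nonvanishing is a by-product as well: the reflection formula keeps
    L_theta away from 0, hence also L_K and L_phat, and the final product formula makes n(s)
    invertible on the strip.

    Two terms of the cosine are removed in c although 1 - cos x is already nonnegative. The reason
    is the bootstrap, which compares values at z / n^2 with values at z: 1 - cos x returns to 0 at 2
    pi and admits no pointwise monotonicity up to a constant, whereas c(x) / x^2 does, and this
    passes to every average. The bootstrap itself starts from a bound whose constant is useless;
    what matters is that each round divides that constant by 4 and leaves a multiple of K behind.

    Integrability travels against the convolutions: L_theta is computed outright, K inherits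
    finiteness because its kernel has positive mass, and phat because it lies below (5/3) K. *)

Section AffineInvariance.
Context {R : realType}.
Local Notation mu := (@lebesgue_measure R).
Local Open Scope ereal_scope.

(** Lebesgue measure is the only measure giving half-open intervals their length, and the rescaled
    image measure does so too. For a < 0 the preimage of such an interval is closed on the other
    side, hence the two cases. *)
Lemma lebesgue_measure_affine (a b : R) (A : set R) : a != 0%R ->
  measurable A ->
  mu A = `|a|%:E * pushforward mu ((fun x => a * x + b)%R : R -> measurableTypeR R) A.
Proof.
move=> a0 mA.
have mphi : measurable_fun setT ((fun x => a * x + b)%R : R -> measurableTypeR R).
  by apply: measurable_funD => //; exact: measurable_funM.
pose m := mscale (NngNum (normr_ge0 a)) (pushforward mu ((fun x => a * x + b)%R : R -> measurableTypeR R)).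
have -> : `|a|%:E * pushforward mu ((fun x => a * x + b)%R : R -> measurableTypeR R) A = m mphi A by [].
apply: lebesgue_measure_unique => // _ [[x y]] /= _ <-.
rewrite /m /mscale /pushforward /=.
rewrite -[X in _ = _ * mu X]/[set z | (a * z + b)%R \in `]x, y]].
have [a_gt0|a_lt0|aE] := ltgtP a 0%R; last by rewrite aE eqxx in a0.
  have -> : [set z | (a * z + b)%R \in `]x, y]] = [set` `[(y - b) / a, (x - b) / a[%R].
    apply/seteqP; split => z /=; rewrite !in_itv/= => /andP[h1 h2]; apply/andP; split.
    - by rewrite ler_ndivrMr// mulrC lerBrDr.
    - by rewrite ltr_ndivlMr// mulrC ltrBlDr.
    - by rewrite ltr_ndivlMr// mulrC ltrBlDr in h2.
    - by rewrite ler_ndivrMr// mulrC lerBrDr in h1.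
  rewrite !lebesgue_measure_itv/= !lte_fin ltr_nM2r ?invr_lt0// ltrD2r.
  case: ifPn => _; last by rewrite mule0.
  rewrite -!EFinD -EFinM ltr0_norm//; congr EFin.
  by field.
have -> : [set z | (a * z + b)%R \in `]x, y]] = [set` `](x - b) / a, (y - b) / a]%R].
  apply/seteqP; split => z /=; rewrite !in_itv/= => /andP[h1 h2]; apply/andP; split.
  - by rewrite ltr_pdivrMr// mulrC ltrBlDr.
  - by rewrite ler_pdivlMr// mulrC lerBrDr.
  - by rewrite ltr_pdivrMr// mulrC ltrBlDr in h1.
  - by rewrite ler_pdivlMr// mulrC lerBrDr in h2.
rewrite !lebesgue_measure_itv/= !lte_fin ltr_pM2r ?invr_gt0// ltrD2r.
case: ifPn => _; last by rewrite mule0.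
rewrite -!EFinD -EFinM gtr0_norm//; congr EFin.
by field.
Qed.

Lemma ge0_integral_affine (a b : R) (h : R -> \bar R) : a != 0%R ->
  measurable_fun setT h -> (forall x, 0 <= h x) ->
  \int[mu]_x h x = `|a|%:E * \int[mu]_x h (a * x + b)%R.
Proof.
move=> a0 mh h0.
have mphi : measurable_fun (setT : set (measurableTypeR R))
    ((fun x => a * x + b)%R : measurableTypeR R -> measurableTypeR R).
  by apply: measurable_funD => //; exact: measurable_funM.
have <- := @ge0_integral_pushforward _ _ (measurableTypeR R) (measurableTypeR R)
  R _ mphi mu setT h measurableT mh (fun x _ => h0 x).
rewrite -(@ge0_integral_mscale _ (measurableTypeR R) R _ setT measurableT
  (NngNum (normr_ge0 a)) h mh)//.
apply: eq_measure_integral => A mA _.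
exact: lebesgue_measure_affine.
Qed.

Lemma ge0_integral_shift (b : R) (h : R -> \bar R) :
  measurable_fun setT h -> (forall x, 0 <= h x) ->
  \int[mu]_x h (x + b)%R = \int[mu]_x h x.
Proof.
move=> mh h0; rewrite [RHS](@ge0_integral_affine 1 b)// normr1 mul1e.
by under [RHS]eq_integral do rewrite mul1r.
Qed.

End AffineInvariance.

(** * Complex exponential: coordinates and norms *)

Section ComplexExponential.
Context {R : realType}.
Local Notation C := R[i].
Implicit Types x y z : C.

Lemma complex_ext x y : Re x = Re y -> Im x = Im y -> x = y.
Proof. by case: x => a b; case: y => c d /= -> ->. Qed.

Lemma ReM x y : Re (x * y) = Re x * Re y - Im x * Im y.
Proof. by case: x; case: y. Qed.

Lemma ImM x y : Im (x * y) = Re x * Im y + Im x * Re y.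
Proof. by case: x; case: y. Qed.

Lemma ReD x y : Re (x + y) = Re x + Re y.
Proof. by case: x; case: y. Qed.

Lemma ImD x y : Im (x + y) = Im x + Im y.
Proof. by case: x; case: y. Qed.

Lemma ReN x : Re (- x) = - Re x.
Proof. by case: x. Qed.

Lemma ImN x : Im (- x) = - Im x.
Proof. by case: x. Qed.

Lemma ReMr x (r : R) : Re (x * r%:C) = Re x * r.
Proof. by rewrite ReM /= mulr0 subr0. Qed.

Lemma ImMr x (r : R) : Im (x * r%:C) = Im x * r.
Proof. by rewrite ImM /= mulr0 add0r. Qed.

Lemma ReCexp z : Re (Cexp z) = expR (Re z) * cos (Im z).
Proof. by rewrite /Cexp ReM /= mul0r subr0. Qed.

Lemma ImCexp z : Im (Cexp z) = expR (Re z) * sin (Im z).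
Proof. by rewrite /Cexp ImM /= mul0r addr0. Qed.

Lemma CexpD x y : Cexp (x + y) = Cexp x * Cexp y.
Proof.
apply: complex_ext.
  by rewrite ReCexp ReM !ReCexp !ImCexp ReD ImD expRD cosD; ring.
by rewrite ImCexp ImM !ReCexp !ImCexp ReD ImD expRD sinD; ring.
Qed.

Lemma Cexp_real (r : R) : Cexp r%:C = (expR r)%:C.
Proof. by apply: complex_ext; rewrite ?ReCexp ?ImCexp /= ?cos0 ?sin0 ?mulr1 ?mulr0. Qed.

Lemma Cexp0 : Cexp (0 : C) = 1.
Proof. by rewrite -[0]/(0%:C) Cexp_real expR0. Qed.

Lemma CexpN_mul z : Cexp (- z) * Cexp z = 1.
Proof. by rewrite -CexpD addNr Cexp0. Qed.

Lemma normCexp z : `|Cexp z| = (expR (Re z))%:C.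
Proof.
rewrite normc_def ReCexp ImCexp !exprMn -mulrDr cos2Dsin2 mulr1 sqrtr_sqr.
by rewrite ger0_norm ?expR_ge0.
Qed.

Lemma norm_real (r : R) : `|r%:C| = `|r|%:C.
Proof. by rewrite normc_def /= expr0n addr0 sqrtr_sqr. Qed.

Lemma normc_le_ReIm z (a b : R) : `|Re z| <= a -> `|Im z| <= b ->
  `|z| <= (a + b)%:C.
Proof.
move=> ha hb; have -> : z = (Re z)%:C + 'i * (Im z)%:C by apply: complex_ext; rewrite ?ReD ?ImD ?ReM ?ImM /=; ring.
apply: (le_trans (ler_normD _ _)); rewrite rmorphD /= lerD//.
  by rewrite norm_real lecR.
by rewrite normrM normc_def /= expr0n expr1n add0r sqrtr1 mul1r norm_real lecR.
Qed.

Lemma normRe_le z (a : R) : `|z| <= a%:C -> `|Re z| <= a.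
Proof. by move=> h; rewrite -lecR (le_trans (normc_ge_Re z)). Qed.

Lemma normIm_le z (a : R) : `|z| <= a%:C -> `|Im z| <= a.
Proof.
move=> h; have -> : Im z = Re (- ('i * z)) by rewrite ReN ReM /=; ring.
by apply: normRe_le; rewrite normrN normrM normc_def /= expr0n expr1n add0r sqrtr1 mul1r.
Qed.

End ComplexExponential.

Section IntegrableCombinations.
Context {R : realType} d (T : measurableType d) (mu : {measure set T -> \bar R}).
Variables (D : set T) (mD : measurable D).

Lemma integrable_addR (f g : T -> R) : mu.-integrable D (EFin \o f) ->
  mu.-integrable D (EFin \o g) ->
  mu.-integrable D (EFin \o (fun x => f x + g x)).
Proof.
move=> fi gi; have := @integrableD _ _ _ mu D mD _ _ fi gi.
by apply: eq_integrable.
Qed.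

Lemma integrable_subR (f g : T -> R) : mu.-integrable D (EFin \o f) ->
  mu.-integrable D (EFin \o g) ->
  mu.-integrable D (EFin \o (fun x => f x - g x)).
Proof.
move=> fi gi; have := @integrableB _ _ _ mu D mD _ _ fi gi.
by apply: eq_integrable.
Qed.

Lemma integrable_scaleR (k : R) (f : T -> R) : mu.-integrable D (EFin \o f) ->
  mu.-integrable D (EFin \o (fun x => k * f x)).
Proof.
move=> fi; have := @integrableZl _ _ _ mu D mD k _ fi.
by apply: eq_integrable.
Qed.

End IntegrableCombinations.

(** * Laplace transforms of nonnegative weights *)

Section LaplaceTransform.
Context {R : realType}.
Local Notation C := R[i].
Local Notation mu := (@lebesgue_measure R).

(** This is the transform of the image under [tau] of the measure with density [w]. Keeping position
    and density apart makes Euler's integral ([tau] = ln) and one-sided exponentials instances of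
    one notion, without a change of variables. *)
Definition Laplace (tau w : R -> R) (s : C) : C :=
  Cintegral mu setT (fun x => Cexp (s * (tau x)%:C) * (w x)%:C).

Definition Laplace_dom (tau w : R -> R) (a : R) : Prop :=
  [/\ measurable_fun setT tau, measurable_fun setT w, forall x, 0 <= w x &
    mu.-integrable setT (EFin \o (fun x => expR (a * tau x) * w x))].

Lemma integrable_dominated (f g : R -> R) : measurable_fun setT f ->
  (forall x, `|f x| <= g x) -> mu.-integrable setT (EFin \o g) ->
  mu.-integrable setT (EFin \o f).
Proof.
move=> mf fg ig; apply: le_integrable ig => //; first exact/measurable_EFinP.
move=> x _ /=; rewrite lee_fin (le_trans (fg x))// ler_norm//.
Qed.

Lemma integral_EFin_Rintegral (f : R -> R) : mu.-integrable setT (EFin \o f) ->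
  (\int[mu]_x (f x)%:E)%E = (\int[mu]_x f x)%:E.
Proof. by move=> fi; rewrite fineK//; exact: integrable_fin_num. Qed.

Lemma measurable_cosR (f : R -> R) : measurable_fun setT f ->
  measurable_fun setT (cos \o f).
Proof.
by move=> mf; apply: measurableT_comp => //; apply: continuous_measurable_fun;
  exact: continuous_cos.
Qed.

Lemma measurable_sinR (f : R -> R) : measurable_fun setT f ->
  measurable_fun setT (sin \o f).
Proof.
by move=> mf; apply: measurableT_comp => //; apply: continuous_measurable_fun;
  exact: continuous_sin.
Qed.

Lemma measurable_expRR (f : R -> R) : measurable_fun setT f ->
  measurable_fun setT (expR \o f).
Proof. by move=> mf; apply: measurableT_comp => //; exact: measurable_expR. Qed.

Lemma continuous_expR_scale (a : R) : continuous (fun x : R => expR (a * x)).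
Proof.
move=> x; apply: continuous_comp; last exact: continuous_expR.
by apply: cvgM; [exact: cvg_cst|exact: cvg_id].
Qed.

Lemma continuous_cos_scale (a : R) : continuous (fun x : R => cos (a * x)).
Proof.
move=> x; apply: continuous_comp; last exact: continuous_cos.
by apply: cvgM; [exact: cvg_cst|exact: cvg_id].
Qed.

Lemma continuous_sin_scale (a : R) : continuous (fun x : R => sin (a * x)).
Proof.
move=> x; apply: continuous_comp; last exact: continuous_sin.
by apply: cvgM; [exact: cvg_cst|exact: cvg_id].
Qed.

Lemma Laplace_cos_integrable (tau w : R -> R) a t : Laplace_dom tau w a ->
  mu.-integrable setT (EFin \o (fun x => expR (a * tau x) * cos (t * tau x) * w x)).
Proof.
case=> mt mw w0; apply: integrable_dominated.
  apply: measurable_funM => //; apply: measurable_funM.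
    by apply: measurable_expRR; exact: measurable_funM.
  by apply: measurable_cosR; exact: measurable_funM.
move=> x; rewrite !normrM (ger0_norm (w0 x)) ger0_norm ?expR_ge0//.
by rewrite ler_wpM2r// ler_piMr ?expR_ge0// cos_max.
Qed.

Lemma Laplace_sin_integrable (tau w : R -> R) a t : Laplace_dom tau w a ->
  mu.-integrable setT (EFin \o (fun x => expR (a * tau x) * sin (t * tau x) * w x)).
Proof.
case=> mt mw w0; apply: integrable_dominated.
  apply: measurable_funM => //; apply: measurable_funM.
    by apply: measurable_expRR; exact: measurable_funM.
  by apply: measurable_sinR; exact: measurable_funM.
move=> x; rewrite !normrM (ger0_norm (w0 x)) ger0_norm ?expR_ge0//.
by rewrite ler_wpM2r// ler_piMr ?expR_ge0// sin_max.
Qed.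

Lemma Re_Laplace (tau w : R -> R) s : Re (Laplace tau w s) =
  \int[mu]_x (expR (Re s * tau x) * cos (Im s * tau x) * w x).
Proof.
by apply: eq_Rintegral => x _; rewrite ReMr ReCexp ReMr ImMr.
Qed.

Lemma Im_Laplace (tau w : R -> R) s : Im (Laplace tau w s) =
  \int[mu]_x (expR (Re s * tau x) * sin (Im s * tau x) * w x).
Proof.
by apply: eq_Rintegral => x _; rewrite ImMr ImCexp ReMr ImMr.
Qed.

Lemma Laplace_integrable (tau w : R -> R) s : Laplace_dom tau w (Re s) ->
  Cintegrable mu setT (fun x => Cexp (s * (tau x)%:C) * (w x)%:C).
Proof.
move=> dom; split.
  rewrite (_ : _ \o _ = EFin \o (fun x => expR (Re s * tau x) * cos (Im s * tau x) * w x)); first exact: Laplace_cos_integrable.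
  by apply/funext => x; rewrite /comp ReMr ReCexp ReMr ImMr.
rewrite (_ : _ \o _ = EFin \o (fun x => expR (Re s * tau x) * sin (Im s * tau x) * w x)); first exact: Laplace_sin_integrable.
by apply/funext => x; rewrite /comp ImMr ImCexp ReMr ImMr.
Qed.

(* The test functions [e^(ax)], [e^(ax) (1 + cos (tx))] and [e^(ax) (1 + sin (tx))]
   are nonnegative and have explicit inner integrals, so that no integrability on
   the product space is needed. *)
Lemma Laplace_mul (tau1 w1 tau2 w2 tau w : R -> R) (s : C) :
  Laplace_dom tau1 w1 (Re s) -> Laplace_dom tau2 w2 (Re s) ->
  measurable_fun setT tau -> measurable_fun setT w -> (forall x, 0 <= w x) ->
  (forall h : R -> R, continuous h -> (forall x, (0 <= h x)%R) ->
    \int[mu]_x (h (tau x) * w x)%:E =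
    \int[mu]_x \int[mu]_y (h (tau1 x + tau2 y) * (w1 x * w2 y))%:E)%E ->
  Laplace_dom tau w (Re s) /\
  Laplace tau w s = Laplace tau1 w1 s * Laplace tau2 w2 s.
Proof.
move: s => [a t] /= dom1 dom2 mtau mw w0 law.
have [mt1 mw1 w10 i1] := dom1; have [mt2 mw2 w20 i2] := dom2.
have C1 := Laplace_cos_integrable _ _ _ t dom1.
have S1 := Laplace_sin_integrable _ _ _ t dom1.
have C2 := Laplace_cos_integrable _ _ _ t dom2.
have S2 := Laplace_sin_integrable _ _ _ t dom2.
pose e x := expR (a * x).
have ce : continuous e by exact: continuous_expR_scale.
have me : measurable_fun setT e by exact: continuous_measurable_fun.
pose M1 := \int[mu]_x (expR (a * tau1 x) * w1 x).
pose M2 := \int[mu]_x (expR (a * tau2 x) * w2 x).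
pose A1 := \int[mu]_x (expR (a * tau1 x) * cos (t * tau1 x) * w1 x).
pose A2 := \int[mu]_x (expR (a * tau2 x) * cos (t * tau2 x) * w2 x).
pose B1 := \int[mu]_x (expR (a * tau1 x) * sin (t * tau1 x) * w1 x).
pose B2 := \int[mu]_x (expR (a * tau2 x) * sin (t * tau2 x) * w2 x).
have cR := @integrable_scaleR _ _ _ mu setT measurableT.
have cD := @integrable_addR _ _ _ mu setT measurableT.
(* By the addition formulas every test function splits as a constant plus a bilinear form in the
   cosines and sines of the two positions. The five coefficients cover the exponential alone, its
   product with 1 + cos and its product with 1 + sin. *)
have comb (p q r v p0 : R) (f : R -> R) :
    (forall x y, f (tau1 x + tau2 y) * (w1 x * w2 y) =
      expR (a * tau1 x) * w1 x * (p0 * (expR (a * tau2 y) * w2 y)) +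
      (expR (a * tau1 x) * w1 x * (p * cos (t * tau1 x) + q * sin (t * tau1 x))) *
         (expR (a * tau2 y) * cos (t * tau2 y) * w2 y) +
      (expR (a * tau1 x) * w1 x * (r * cos (t * tau1 x) + v * sin (t * tau1 x))) *
         (expR (a * tau2 y) * sin (t * tau2 y) * w2 y)) ->
    (\int[mu]_x \int[mu]_y (f (tau1 x + tau2 y) * (w1 x * w2 y))%:E)%E =
    (p0 * M1 * M2 + (p * A1 + q * B1) * A2 + (r * A1 + v * B1) * B2)%:E.
  move=> fE.
  transitivity (\int[mu]_x ((p0 * M2) * (expR (a * tau1 x) * w1 x) +
     ((p * A2 + r * B2) * (expR (a * tau1 x) * cos (t * tau1 x) * w1 x) +
     (q * A2 + v * B2) * (expR (a * tau1 x) * sin (t * tau1 x) * w1 x)))%:E)%E.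
    apply: eq_integral => x _.
    under eq_integral do rewrite fE.
    rewrite integral_EFin_Rintegral; last first.
      apply: (cD); last exact: cR.
      apply: (cD); last exact: cR.
      by apply: (cR); exact: cR.
    rewrite RintegralD//; last 2 first.
      by apply: (cD); [apply: (cR); exact: cR|exact: cR].
      exact: cR.
    rewrite RintegralD//; last 2 first.
      by apply: (cR); exact: cR.
      exact: cR.
    rewrite !RintegralZl//; last exact: cR.
    by rewrite -/M2 -/A2 -/B2; congr EFin; ring.
  rewrite integral_EFin_Rintegral; last by apply: (cD); [exact: cR|apply: (cD); exact: cR].
  rewrite RintegralD//; [|exact: cR|by apply: (cD); exact: cR].
  rewrite RintegralD//; [|exact: cR|exact: cR].
  rewrite !RintegralZl//.
  by rewrite -/M1 -/A1 -/B1; congr EFin; ring.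
have dom : Laplace_dom tau w a.
  split => //; apply/integrableP; split.
    apply/measurable_EFinP; apply: measurable_funM => //.
    exact: (measurableT_comp me mtau).
  under eq_integral do rewrite gee0_abs ?lee_fin ?mulr_ge0 ?expR_ge0//.
  rewrite (law e) => [|//|x]; last exact: expR_ge0.
  rewrite (comb 0 0 0 0 1 e) ?ltry// => x y.
  by rewrite /e mulrDr expRD; ring.
split => //.
have iM : mu.-integrable setT (EFin \o (fun x => expR (a * tau x) * w x)) by case: dom.
have C := Laplace_cos_integrable _ _ _ t dom.
have S := Laplace_sin_integrable _ _ _ t dom.
have EM : \int[mu]_x (expR (a * tau x) * w x) = M1 * M2.
  apply: EFin_inj; rewrite -integral_EFin_Rintegral// (law e) => [|//|x]; last exact: expR_ge0.
  rewrite (comb 0 0 0 0 1 e); first by congr EFin; ring.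
  by move=> x y; rewrite /e mulrDr expRD; ring.
apply: complex_ext.
- rewrite ReM !Re_Laplace !Im_Laplace /= -/A1 -/A2 -/B1 -/B2.
  (* The law is only available for the nonnegative function 1 + cos, so the contribution [M1 * M2]
     of the constant 1 is added on both sides and cancelled. *)
  apply: (addrI (M1 * M2)); rewrite -{1}EM -RintegralD//.
  apply: EFin_inj; rewrite -integral_EFin_Rintegral; last exact: cD.
  have := law (fun x => e x * (1 + cos (t * x))).
  rewrite (comb 1 0 0 (-1) 1 (fun x => e x * (1 + cos (t * x)))); last first.
    by move=> x y; rewrite /e !mulrDr expRD cosD; ring.
  move=> lawc; rewrite [RHS](_ : _ = (1 * M1 * M2 + (1 * A1 + 0 * B1) * A2 +
      (0 * A1 + -1 * B1) * B2)%:E); last by congr EFin; ring.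
  rewrite -lawc => [||x].
  + by apply: eq_integral => x _; rewrite /e; congr EFin; ring.
  + by move=> y; apply: cvgM; [exact: ce|apply: cvgD; [exact: cvg_cst|exact: continuous_cos_scale]].
  + by rewrite mulr_ge0 ?expR_ge0// -lerBlDl sub0r cos_geN1.
- rewrite ImM !Re_Laplace !Im_Laplace /= -/A1 -/A2 -/B1 -/B2.
  apply: (addrI (M1 * M2)); rewrite -{1}EM -RintegralD//.
  apply: EFin_inj; rewrite -integral_EFin_Rintegral; last exact: cD.
  have := law (fun x => e x * (1 + sin (t * x))).
  rewrite (comb 0 1 1 0 1 (fun x => e x * (1 + sin (t * x)))); last first.
    by move=> x y; rewrite /e !mulrDr expRD sinD; ring.
  move=> lawc; rewrite [RHS](_ : _ = (1 * M1 * M2 + (0 * A1 + 1 * B1) * A2 +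
      (1 * A1 + 0 * B1) * B2)%:E); last by congr EFin; ring.
  rewrite -lawc => [||x].
  + by apply: eq_integral => x _; rewrite /e; congr EFin; ring.
  + by move=> y; apply: cvgM; [exact: ce|apply: cvgD; [exact: cvg_cst|exact: continuous_sin_scale]].
  + by rewrite mulr_ge0 ?expR_ge0// -lerBlDl sub0r sin_geN1.
Qed.

End LaplaceTransform.

(** * Integrals of complex-valued functions *)

Section ComplexIntegral.
Context {R : realType} d (T : measurableType d) (mu : {measure set T -> \bar R}).
Variables (D : set T) (mD : measurable D).
Local Notation C := R[i].
Implicit Types f g : T -> C.

Lemma eq_Cintegral f g : {in D, f =1 g} -> Cintegral mu D f = Cintegral mu D g.
Proof.
by move=> fg; congr Complex; apply: eq_Rintegral => x xD; rewrite fg.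
Qed.

Lemma eq_Cintegrable f g : {in D, f =1 g} -> Cintegrable mu D f -> Cintegrable mu D g.
Proof.
move=> fg [f1 f2]; split; [apply: eq_integrable f1 => // x xD /=|apply: eq_integrable f2 => // x xD /=];
  by rewrite fg.
Qed.

Lemma CintegrableD f g : Cintegrable mu D f -> Cintegrable mu D g ->
  Cintegrable mu D (fun x => f x + g x).
Proof.
move=> [f1 f2] [g1 g2]; split.
  rewrite (_ : _ \o _ = EFin \o (fun x => Re (f x) + Re (g x))).
    exact: integrable_addR.
  by apply/funext => x; rewrite /comp ReD.
rewrite (_ : _ \o _ = EFin \o (fun x => Im (f x) + Im (g x))).
  exact: integrable_addR.
by apply/funext => x; rewrite /comp ImD.
Qed.

Lemma CintegrableZ (k : C) f : Cintegrable mu D f ->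
  Cintegrable mu D (fun x => k * f x).
Proof.
move=> [f1 f2]; split.
  rewrite (_ : _ \o _ = EFin \o (fun x => Re k * Re (f x) - Im k * Im (f x))).
    by apply: integrable_subR => //; exact: integrable_scaleR.
  by apply/funext => x; rewrite /comp ReM.
rewrite (_ : _ \o _ = EFin \o (fun x => Re k * Im (f x) + Im k * Re (f x))).
  by apply: integrable_addR => //; exact: integrable_scaleR.
by apply/funext => x; rewrite /comp ImM.
Qed.

Lemma CintegralD f g : Cintegrable mu D f -> Cintegrable mu D g ->
  Cintegral mu D (fun x => f x + g x) = Cintegral mu D f + Cintegral mu D g.
Proof.
move=> [f1 f2] [g1 g2]; apply: complex_ext; rewrite ?ReD ?ImD /Cintegral /=.
  by rewrite -RintegralD//; apply: eq_Rintegral => x _; rewrite ReD.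
by rewrite -RintegralD//; apply: eq_Rintegral => x _; rewrite ImD.
Qed.

Lemma CintegralZ (k : C) f : Cintegrable mu D f ->
  Cintegral mu D (fun x => k * f x) = k * Cintegral mu D f.
Proof.
move=> [f1 f2]; apply: complex_ext; rewrite ?ReM ?ImM /Cintegral /=.
  rewrite -!RintegralZl// -RintegralB//; try exact: integrable_scaleR.
  by apply: eq_Rintegral => x _; rewrite ReM.
rewrite -!RintegralZl// -RintegralD//; try exact: integrable_scaleR.
by apply: eq_Rintegral => x _; rewrite ImM.
Qed.

Lemma Cintegrable0 : Cintegrable mu D (fun=> 0).
Proof. by split; rewrite (_ : _ \o _ = cst 0%E)//; exact: integrable0. Qed.

Lemma Cintegral0 : Cintegral mu D (fun=> 0) = 0.
Proof. by rewrite /Cintegral /Rintegral /= !integral0. Qed.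

Lemma Cintegrable_sum (I : Type) (r : seq I) (F : I -> T -> C) :
  (forall i, Cintegrable mu D (F i)) ->
  Cintegrable mu D (fun x => \sum_(i <- r) F i x).
Proof.
move=> iF; elim: r => [|i r IH].
  by apply: eq_Cintegrable Cintegrable0 => x _; rewrite big_nil.
apply: eq_Cintegrable (CintegrableD _ _ (iF i) IH) => x _.
by rewrite big_cons.
Qed.

Lemma Cintegral_sum (I : Type) (r : seq I) (F : I -> T -> C) :
  (forall i, Cintegrable mu D (F i)) ->
  Cintegral mu D (fun x => \sum_(i <- r) F i x) =
  \sum_(i <- r) Cintegral mu D (F i).
Proof.
move=> iF; elim: r => [|i r IH].
  by rewrite big_nil -[RHS]Cintegral0; apply: eq_Cintegral => x _; rewrite big_nil.
rewrite big_cons -IH -CintegralD//; last exact: Cintegrable_sum.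
by apply: eq_Cintegral => x _; rewrite big_cons.
Qed.

Lemma Cintegrable_dominated f (g : T -> R) :
  measurable_fun D (fun x => Re (f x)) -> measurable_fun D (fun x => Im (f x)) ->
  (forall x, D x -> `|f x| <= (g x)%:C) -> mu.-integrable D (EFin \o g) ->
  Cintegrable mu D f.
Proof.
move=> m1 m2 fg ig; split; apply: le_integrable ig => //; try exact/measurable_EFinP.
  by move=> x /fg /normRe_le h /=; rewrite lee_fin (le_trans h)// ler_norm.
by move=> x /fg /normIm_le h /=; rewrite lee_fin (le_trans h)// ler_norm.
Qed.

Lemma norm_Cintegral_le f (g : T -> R) : Cintegrable mu D f ->
  mu.-integrable D (EFin \o g) -> (forall x, D x -> `|f x| <= (g x)%:C) ->
  `|Cintegral mu D f| <= (2 * \int[mu]_(x in D) g x)%:C.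
Proof.
move=> [f1 f2] ig fg; rewrite mulr_natl mulr2n.
apply: normc_le_ReIm; rewrite /Cintegral /=; apply: (le_trans (le_normr_Rintegral mD _)) => //.
  apply: le_Rintegral => // [|x Dx]; first exact: integrable_norm.
  exact/normRe_le/fg.
apply: le_Rintegral => // [|x Dx]; first exact: integrable_norm.
exact/normIm_le/fg.
Qed.

End ComplexIntegral.

Section LaplaceLaws.
Context {R : realType}.
Local Notation C := R[i].
Local Notation mu := (@lebesgue_measure R).

(** Additive counterpart of [Laplace_mul], with the same test functions 1 + cos and 1 + sin: the law
    is assumed for nonnegative functions only, where all integrals make sense in the extended
    reals. *)
Lemma Laplace_add (tau1 w1 tau2 w2 tau w : R -> R) (s : C) :
  Laplace_dom tau1 w1 (Re s) -> Laplace_dom tau2 w2 (Re s) ->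
  measurable_fun setT tau -> measurable_fun setT w -> (forall x, 0 <= w x) ->
  (forall h : R -> R, continuous h -> (forall x, (0 <= h x)%R) ->
    \int[mu]_x (h (tau x) * w x)%:E =
    \int[mu]_x (h (tau1 x) * w1 x)%:E + \int[mu]_x (h (tau2 x) * w2 x)%:E)%E ->
  Laplace_dom tau w (Re s) /\
  Laplace tau w s = Laplace tau1 w1 s + Laplace tau2 w2 s.
Proof.
move: s => [a t] /= dom1 dom2 mtau mw w0 law.
have [mt1 mw1 w10 i1] := dom1; have [mt2 mw2 w20 i2] := dom2.
have C1 := Laplace_cos_integrable _ _ _ t dom1.
have S1 := Laplace_sin_integrable _ _ _ t dom1.
have C2 := Laplace_cos_integrable _ _ _ t dom2.
have S2 := Laplace_sin_integrable _ _ _ t dom2.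
pose e x := expR (a * x).
have ce : continuous e by exact: continuous_expR_scale.
have me : measurable_fun setT e by exact: continuous_measurable_fun.
have aD := @integrable_addR _ _ _ mu setT measurableT.
have e0 x : 0 <= e x by exact: expR_ge0.
have dom : Laplace_dom tau w a.
  split => //; apply/integrableP; split.
    apply/measurable_EFinP; apply: measurable_funM => //.
    exact: (measurableT_comp me mtau).
  under eq_integral do rewrite gee0_abs ?lee_fin ?mulr_ge0 ?expR_ge0//.
  by rewrite (law e)// !integral_EFin_Rintegral// ltry.
split => //.
have iM : mu.-integrable setT (EFin \o (fun x => expR (a * tau x) * w x)) by case: dom.
have C := Laplace_cos_integrable _ _ _ t dom.
have S := Laplace_sin_integrable _ _ _ t dom.
pose M := \int[mu]_x (expR (a * tau x) * w x).
pose M1 := \int[mu]_x (expR (a * tau1 x) * w1 x).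
pose M2 := \int[mu]_x (expR (a * tau2 x) * w2 x).
have EM : M = M1 + M2.
  apply: EFin_inj; rewrite -integral_EFin_Rintegral// (law e)//.
  by rewrite EFinD -!integral_EFin_Rintegral.
have key (f : R -> R) : continuous f -> (forall x, `|f x| <= 1) ->
  mu.-integrable setT (EFin \o (fun x => expR (a * tau x) * f (tau x) * w x)) ->
  mu.-integrable setT (EFin \o (fun x => expR (a * tau1 x) * f (tau1 x) * w1 x)) ->
  mu.-integrable setT (EFin \o (fun x => expR (a * tau2 x) * f (tau2 x) * w2 x)) ->
  \int[mu]_x (expR (a * tau x) * f (tau x) * w x) =
  \int[mu]_x (expR (a * tau1 x) * f (tau1 x) * w1 x) +
  \int[mu]_x (expR (a * tau2 x) * f (tau2 x) * w2 x).
  move=> cf f1 j j1 j2; apply: (addrI M); rewrite -[X in X = _]RintegralD//.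
  rewrite EM addrACA -[X in _ = X + _]RintegralD// -[X in _ = _ + X]RintegralD//.
  apply: EFin_inj; rewrite EFinD -!integral_EFin_Rintegral; try exact: (aD).
  have := law (fun x => e x * (1 + f x)).
  have dE (t' v' : R -> R) : (\int[mu]_x (expR (a * t' x) * v' x + expR (a * t' x) * f (t' x) * v' x)%:E =
     \int[mu]_x (e (t' x) * (1 + f (t' x)) * v' x)%:E)%E.
    by apply: eq_integral => x _; congr EFin; rewrite /e; ring.
  rewrite !dE; apply; first by move=> y; apply: cvgM; [exact: ce|apply: cvgD; [exact: cvg_cst|exact: cf]].
  move=> x; rewrite mulr_ge0// -lerBlDl sub0r.
  by have := f1 x; rewrite ler_norml => /andP[].
apply: complex_ext; rewrite ?ReD ?ImD ?Re_Laplace ?Im_Laplace /=.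
  apply: (key (fun x => cos (t * x))) => //; last by move=> x; exact: cos_max.
  exact: continuous_cos_scale.
apply: (key (fun x => sin (t * x))) => //; last by move=> x; exact: sin_max.
exact: continuous_sin_scale.
Qed.

(** The change of variables principle, obtained from the additive law with a zero second summand. *)
Lemma Laplace_eq_law (tau1 w1 tau w : R -> R) (s : C) :
  Laplace_dom tau1 w1 (Re s) ->
  measurable_fun setT tau -> measurable_fun setT w -> (forall x, 0 <= w x) ->
  (forall h : R -> R, continuous h -> (forall x, (0 <= h x)%R) ->
    \int[mu]_x (h (tau x) * w x)%:E = \int[mu]_x (h (tau1 x) * w1 x)%:E)%E ->
  Laplace_dom tau w (Re s) /\ Laplace tau w s = Laplace tau1 w1 s.
Proof.
move=> dom1 mtau mw w0 law.
have dom0 : Laplace_dom idfun (fun=> 0) (Re s).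
  split; [exact: measurable_id|exact: measurable_cst|by []|].
  rewrite (_ : _ \o _ = cst 0%E); first exact: integrable0.
  by apply/funext => x /=; rewrite mulr0.
have [|dom ->] := @Laplace_add tau1 w1 idfun (fun=> 0) tau w s dom1 dom0 mtau mw w0.
  move=> h ch h0; rewrite law// [X in (_ + X)%E]integral0_eq ?adde0// => x _.
  by rewrite mulr0.
split => //; rewrite [X in _ + X](_ : _ = 0) ?addr0//.
rewrite /Laplace -[RHS](@Cintegral0 _ _ _ mu setT).
by apply: eq_Cintegral => x _; rewrite mulr0.
Qed.

Lemma eq_Laplace (tau w tau' w' : R -> R) (s s' : C) :
  (forall x, Cexp (s * (tau x)%:C) * (w x)%:C = Cexp (s' * (tau' x)%:C) * (w' x)%:C) ->
  Laplace tau w s = Laplace tau' w' s'.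
Proof. by move=> E; apply: eq_Cintegral => x _; rewrite E. Qed.

Lemma norm_Laplace_le (tau w : R -> R) (s : C) : Laplace_dom tau w (Re s) ->
  `|Laplace tau w s| <= (2 * \int[mu]_x (expR (Re s * tau x) * w x))%:C.
Proof.
move=> dom; apply: norm_Cintegral_le => //; first exact: Laplace_integrable.
  by case: dom.
move=> x _; rewrite normrM normCexp ReMr norm_real ger0_norm ?rmorphM//.
by case: dom.
Qed.

End LaplaceLaws.

(** * Integrals of exponentials *)

Section ExponentialIntegrals.
Context {R : realType}.
Local Notation C := R[i].
Local Notation mu := (@lebesgue_measure R).

(** The coefficients [p] and [q] stay free so that the real and the imaginary part of an
    antiderivative of e^(ct), c = a + ib, are both instances. *)
Lemma is_derive_expcos (a b p q t : R) :
  is_derive t (1:R) (fun x : R => expR (a * x) * (p * cos (b * x) + q * sin (b * x)))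
    (expR (a * t) * ((a * p + b * q) * cos (b * t) + (a * q - b * p) * sin (b * t))).
Proof.
have da : is_derive t (1:R) (fun x : R => a * x) a.
  by apply: is_derive_eq; rewrite ?scaler0 ?add0r /GRing.scale /= mulr1.
have db : is_derive t (1:R) (fun x : R => b * x) b.
  by apply: is_derive_eq; rewrite ?scaler0 ?add0r /GRing.scale /= mulr1.
have de : is_derive t (1:R) (fun x : R => expR (a * x)) (expR (a * t) * a).
  exact: (is_derive1_comp (f := expR)).
have dc : is_derive t (1:R) (fun x : R => cos (b * x)) (- sin (b * t) * b).
  exact: (is_derive1_comp (f := cos)).
have ds : is_derive t (1:R) (fun x : R => sin (b * x)) (cos (b * t) * b).
  exact: (is_derive1_comp (f := sin)).
apply: is_derive_eq; rewrite /GRing.scale /=; ring.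
Qed.

Lemma continuous_expcos (a b p q : R) :
  continuous (fun x : R => expR (a * x) * (p * cos (b * x) + q * sin (b * x))).
Proof.
move=> t; apply/differentiable_continuous/derivable1_diffP.
by apply: ex_derive; exact: is_derive_expcos.
Qed.

Lemma Rintegral_expcos (a b p q u v : R) : u < v -> 
  mu.-integrable `[u, v] (EFin \o (fun t => expR (a * t) * ((a * p + b * q) * cos (b * t) + (a * q - b * p) * sin (b * t)))) /\
  \int[mu]_(t in `[u, v]) (expR (a * t) * ((a * p + b * q) * cos (b * t) + (a * q - b * p) * sin (b * t)))
  = expR (a * v) * (p * cos (b * v) + q * sin (b * v)) - expR (a * u) * (p * cos (b * u) + q * sin (b * u)).
Proof.
move=> uv; split.
  apply: continuous_compact_integrable; first exact: segment_compact.
  by apply: continuous_subspaceT; exact: continuous_expcos.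
rewrite /Rintegral (@continuous_FTC2 _ _ (fun x => expR (a * x) * (p * cos (b * x) + q * sin (b * x))))//.
- by apply: continuous_subspaceT; exact: continuous_expcos.
- split.
  + by move=> x _; apply: ex_derive; exact: is_derive_expcos.
  + by apply: cvg_at_right_filter; exact: continuous_expcos.
  + by apply: cvg_at_left_filter; exact: continuous_expcos.
- by move=> x _; rewrite derive1E; have [] := is_derive_expcos a b p q x.
Qed.

Lemma ReIm_norm_neq0 (c : C) : c != 0 -> Re c ^+ 2 + Im c ^+ 2 != 0.
Proof.
move=> c0; apply/negP; rewrite paddr_eq0 ?sqr_ge0// !sqrf_eq0 => /andP[/eqP r0 /eqP i0].
by move/eqP: c0; apply; apply: complex_ext.
Qed.

Lemma complex_invE (c : C) : c^-1 =
  (Re c / (Re c ^+ 2 + Im c ^+ 2)) +i* (- Im c / (Re c ^+ 2 + Im c ^+ 2)).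
Proof. by case: c => x y; rewrite mulNr. Qed.

Lemma Cintegral_Cexp (c : C) (u v : R) : c != 0 -> u < v ->
  Cintegrable mu `[u, v] (fun t => Cexp (c * t%:C)) /\
  Cintegral mu `[u, v] (fun t => Cexp (c * t%:C)) = (Cexp (c * v%:C) - Cexp (c * u%:C)) / c.
Proof.
move=> c0 uv; have n0 := ReIm_norm_neq0 _ c0.
set a := Re c; set b := Im c; set n := a ^+ 2 + b ^+ 2.
(* The pairs (a/n, b/n) and (-b/n, a/n) are the coefficients of cos and sin in the real and
   imaginary parts of e^(ct) / c. *)
have [i1 e1] := Rintegral_expcos a b (a / n) (b / n) _ _ uv.
have [i2 e2] := Rintegral_expcos a b (- b / n) (a / n) _ _ uv.
have E1 t : expR (a * t) * ((a * (a / n) + b * (b / n)) * cos (b * t) + (a * (b / n) - b * (a / n)) * sin (b * t)) = Re (Cexp (c * t%:C)).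
  by rewrite ReCexp ReMr ImMr -/a -/b /n; field.
have E2 t : expR (a * t) * ((a * (- b / n) + b * (a / n)) * cos (b * t) + (a * (a / n) - b * (- b / n)) * sin (b * t)) = Im (Cexp (c * t%:C)).
  by rewrite ImCexp ReMr ImMr -/a -/b /n; field.
split.
  split.
    by apply: eq_integrable i1 => // x _; rewrite /comp E1.
  by apply: eq_integrable i2 => // x _; rewrite /comp E2.
rewrite (eq_Rintegral mu (fun t _ => E1 t)) in e1.
rewrite (eq_Rintegral mu (fun t _ => E2 t)) in e2.
have ci : c^-1 = (a / n) +i* (- b / n) by exact: complex_invE.
apply: complex_ext; rewrite /Cintegral [LHS]/=.
  by rewrite e1 ci ReM ReD ImD ReN ImN !ReCexp !ImCexp !ReMr !ImMr -/a -/b /=; field.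
by rewrite e2 ci ImM ReD ImD ReN ImN !ReCexp !ImCexp !ReMr !ImMr -/a -/b /=; field.
Qed.

Lemma integral_expR_neg (a : R) : 0 < a ->
  (\int[mu]_(x in `[0%R, +oo[) (expR (- (a * x)))%:E)%E = (a^-1)%:E.
Proof.
move=> a0.
have D x : is_derive x (1:R) (fun x : R => - a^-1 * expR (- (a * x))) (expR (- (a * x))).
  have := is_derive_expcos (- a) 0 (- a^-1) 0 x.
  have -> : (fun x : R => - a^-1 * expR (- (a * x))) = (fun x : R => expR (- a * x) * (- a^-1 * cos (0 * x) + 0 * sin (0 * x))).
    by apply/funext => y; rewrite !mul0r cos0 addr0 mulr1 [RHS]mulrC; congr (_ * expR _); rewrite mulNr.
  move=> h; apply: is_derive_eq; rewrite !mul0r cos0 -(mulNr a x); field.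
  by rewrite gt_eqF.
have cF : continuous (fun x : R => - a^-1 * expR (- (a * x))).
  by move=> t; apply/differentiable_continuous/derivable1_diffP; apply: ex_derive; exact: D.
rewrite (@ge0_continuous_FTC2y _ _ (fun x => - a^-1 * expR (- (a * x))) 0 0).
- by rewrite mulr0 oppr0 expR0 mulr1 sub0e -EFinN opprK.
- by move=> x _; exact: expR_ge0.
- apply: continuous_subspaceT => t.
  apply: (@continuous_comp _ _ _ (fun x : R => - (a * x)) expR); last exact: continuous_expR.
  by apply: continuousN; apply: continuousM; [exact: cst_continuous|].
- rewrite -(mulr0 (- a^-1)); apply: cvgM; first exact: cvg_cst.
  apply: (cvg_comp (fun x : R => a * x) (fun x => expR (- x))); last exact: cvgr_expR.
  by apply/gt0_cvgMry.
- by move=> x _; apply: ex_derive; exact: D.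
- by apply: cvg_at_right_filter; exact: cF.
- by move=> x _; rewrite derive1E; have [] := D x.
Qed.

End ExponentialIntegrals.

(** * The reflection integral *)

Section PartialFractions.
Context {R : realType}.
Local Notation C := R[i].
Local Notation mu := (@lebesgue_measure R).

Definition step (y : R) : R := \1_(`[0%R, +oo[%classic : set R) y.

Lemma measurable_step : measurable_fun setT step.
Proof. exact: measurable_indic. Qed.

Lemma stepE y : step y = if 0 <= y then 1 else 0.
Proof. by rewrite /step indicE mem_setE in_itv/= andbT; case: (0 <= y). Qed.

Lemma step_ge0 y : 0 <= step y.
Proof. by rewrite stepE; case: ifP. Qed.

Lemma integral_indic_mul (D : set R) (f : R -> R) :
  (\int[mu]_(x in D) (f x)%:E = \int[mu]_x (f x * \1_D x)%:E)%E.
Proof.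
rewrite integral_mkcond epatch_indic; apply: eq_integral => x _ /=.
by rewrite EFinM.
Qed.

Lemma Rintegral_indic_mul (D : set R) (f : R -> R) :
  \int[mu]_(x in D) f x = \int[mu]_x (f x * \1_D x).
Proof. by rewrite /Rintegral integral_indic_mul. Qed.

Lemma Cintegral_indic_mul (D : set R) (f : R -> C) :
  Cintegral mu D f = Cintegral mu setT (fun x => f x * (\1_D x)%:C).
Proof.
rewrite /Cintegral; congr Complex; rewrite Rintegral_indic_mul; apply: eq_Rintegral => x _.
  by rewrite ReMr.
by rewrite ImMr.
Qed.

Lemma integral_step_oo (f : R -> R) : measurable_fun setT f ->
  (\int[mu]_x (f x * step x)%:E = \int[mu]_x (f x * \1_(`]0%R, +oo[%classic : set R) x)%:E)%E.
Proof.
move=> mf; rewrite -!integral_indic_mul integral_itv_obnd_cbnd//.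
by apply/measurable_EFinP; exact: measurable_funTS.
Qed.

Lemma measurable_opp : measurable_fun setT (fun y : R => - y).
Proof. by apply: measurable_funN. Qed.

Lemma integral_step (a : R) : 0 < a ->
  (\int[mu]_x (expR (a * - x) * step x)%:E)%E = (a^-1)%:E.
Proof.
move=> a0; rewrite -integral_expR_neg// integral_indic_mul.
by apply: eq_integral => x _; rewrite mulrN.
Qed.

Lemma step_dom (a : R) : 0 < a -> Laplace_dom (fun y => - y) step a.
Proof.
move=> a0; split; [exact: measurable_opp|exact: measurable_step|exact: step_ge0|].
apply/integrableP; split.
  apply/measurable_EFinP; apply: measurable_funM; last exact: measurable_step.
  by apply: measurable_expRR; apply: measurable_funM => //; exact: measurable_opp.
under eq_integral do rewrite gee0_abs ?lee_fin ?mulr_ge0 ?expR_ge0 ?step_ge0//.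
by rewrite integral_step// ltry.
Qed.

Lemma Laplace_dom_le (tau w w' : R -> R) (a : R) : Laplace_dom tau w a ->
  measurable_fun setT w' -> (forall x, 0 <= w' x <= w x) -> Laplace_dom tau w' a.
Proof.
move=> [mt mw w0 iw] mw' w'w; split => //; first by move=> x; case/andP: (w'w x).
apply: integrable_dominated iw.
  by apply: measurable_funM => //; apply: measurable_expRR; exact: measurable_funM.
move=> x; have /andP[w'0 ww] := w'w x.
by rewrite ger0_norm ?mulr_ge0 ?expR_ge0// ler_wpM2l ?expR_ge0.
Qed.

Lemma Cexp_neq1 (z : C) : Re z != 0 -> Cexp z != 1.
Proof.
move=> z0; apply/eqP => /(congr1 (fun x : C => `|x|)); rewrite normCexp normr1.
move/complexI/eqP; rewrite -expR0 => /eqP /expR_inj h.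
by rewrite h eqxx in z0.
Qed.

Local Notation I01 := (`[0%R, 1%R[%classic : set R).

(** Self-similarity replaces a limit at infinity. Cutting the half-line at 1 and translating the far
    piece gives L = (1 - e^(-c)) / c + e^(-c) L, and e^(-c) differs from 1 because Re c > 0. *)
Lemma Laplace_step (c : C) : 0 < Re c -> Laplace (fun y => - y) step c = c^-1.
Proof.
move=> c0.
have domE := step_dom _ c0.
have c_neq0 : c != 0 by apply/eqP => cE; rewrite cE ltxx in c0.
have dom1 : Laplace_dom (fun y => - y) (\1_I01 : R -> R) (Re c).
  apply: Laplace_dom_le domE _ _; first by apply: measurable_indic; exact: measurable_itv.
  move=> x; rewrite stepE indicE mem_setE in_itv/=.
  by case: (0 <= x); rewrite ?andbF//=; case: (x < 1); rewrite ?lexx ?ler01.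
have [mt ms s0 is_] := domE.
have dom2 : Laplace_dom (fun y => - (y + 1)) step (Re c).
  split => //.
    by apply: measurable_funN; apply: measurable_funD.
  rewrite (_ : _ \o _ = EFin \o (fun x => expR (- Re c) * (expR (Re c * - x) * step x))).
    exact: integrable_scaleR.
  by apply/funext => x; rewrite /comp mulrA -expRD; congr (_ * _)%:E; congr expR; ring.
have [|_] := @Laplace_add _ _ _ _ _ (fun y => - y) step c dom1 dom2 mt ms s0.
  move=> h /continuous_measurable_fun mh h0.
  have mho : measurable_fun setT (fun x : R => h (- x)) by apply: (measurableT_comp mh measurable_opp).
  pose H (x : R) := (h (- x) * \1_(`[1%R, +oo[%classic : set R) x)%:E.
  have -> : (\int[mu]_x (h (- (x + 1)) * step x)%:E = \int[mu]_x H x)%E.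
    rewrite -(@ge0_integral_shift _ 1 H).
    - apply: eq_integral => x _; rewrite /H stepE indicE mem_setE in_itv/= andbT.
      by rewrite lerDr; case: (0 <= x).
    - apply/measurable_EFinP; apply: measurable_funM => //; exact: measurable_indic.
    - by move=> x; rewrite lee_fin mulr_ge0.
  rewrite -ge0_integralD//=.
  - apply: eq_integral => x _; rewrite -EFinD -mulrDr; congr (_ * _)%:E.
    rewrite stepE !indicE !mem_setE !in_itv/= andbT.
    case: (leP 1 x) => h1; last by case: (0 <= x); rewrite ?addr0.
    by rewrite (le_trans ler01 h1) andbF /= add0r.
  - by move=> x _; rewrite lee_fin mulr_ge0.
  - by apply/measurable_EFinP; apply: measurable_funM => //; exact: measurable_indic.
  - by move=> x _; rewrite lee_fin mulr_ge0.
  - by apply/measurable_EFinP; apply: measurable_funM => //; exact: measurable_indic.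
have -> : Laplace (fun y => - (y + 1)) step c = Cexp (- c) * Laplace (fun y => - y) step c.
  rewrite /Laplace -CintegralZ//; last exact: Laplace_integrable.
  apply: eq_Cintegral => x _; rewrite mulrA -CexpD; congr (Cexp _ * _).
  by rewrite !rmorphN rmorphD /=; ring.
have -> : Laplace (fun y => - y) (\1_I01 : R -> R) c = (1 - Cexp (- c)) / c.
  have nc0 : - c != 0 by rewrite oppr_eq0.
  have [_ V] := Cintegral_Cexp _ _ _ nc0 (@ltr01 R).
  have -> : (1 - Cexp (- c)) / c = (Cexp (- c * 1%:C) - Cexp (- c * 0%:C)) / - c.
    by rewrite rmorph1 rmorph0 mulr0 mulr1 Cexp0 invrN mulrN -mulNr opprB.
  rewrite -V; transitivity (Cintegral mu I01 (fun t => Cexp (- c * t%:C))).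
    rewrite Cintegral_indic_mul; apply: eq_Cintegral => x _.
    by rewrite rmorphN /= mulrN mulNr.
  have [V1 V2] : Cintegrable mu I01 (fun t : R => Cexp (- c * t%:C)).
    have [[W1 W2] _] := Cintegral_Cexp _ _ _ nc0 (@ltr01 R).
    have sub : I01 `<=` `[0%R, 1%R] by apply: subset_itvl; rewrite bnd_simp.
    by split; [apply: integrableS W1|apply: integrableS W2].
  by rewrite /Cintegral; congr Complex; rewrite Rintegral_itv_bndo_bndc.
move=> E; have E1 : (1 - Cexp (- c)) * Laplace (fun y => - y) step c = (1 - Cexp (- c)) * c^-1.
  by rewrite mulrBl mul1r {1}E addrK.
apply: (mulfI _ E1); rewrite subr_eq0 eq_sym; apply: Cexp_neq1.
by rewrite ReN oppr_eq0 gt_eqF.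
Qed.

(** The integral of e^(-cy) / (1 + e^(-y)) over y >= 0, that is, the alternating sum of the (-1)^n /
    (c + n). *)
Definition half_transform (c : C) : C := Laplace (fun y => - y) (fun y => step y / (1 + expR (- y))) c.

Lemma logistic_bounds (y : R) : 0 < (1 + expR y)^-1 <= 1.
Proof.
have h := expR_ge0 y; rewrite invr_gt0 invf_le1 ?ltr_wpDr ?ltr01//.
by rewrite lerDl h.
Qed.

Lemma measurable_logistic : measurable_fun setT (fun y : R => (1 + expR y)^-1).
Proof.
apply: continuous_measurable_fun => y; apply: cvgV.
  by rewrite gt_eqF// ltr_wpDr ?expR_ge0.
by apply: cvgD; [exact: cvg_cst|exact: continuous_expR].
Qed.

Lemma half_transform_dom (a : R) : 0 < a ->
  Laplace_dom (fun y => - y) (fun y => step y / (1 + expR (- y))) a.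
Proof.
move=> a0; apply: Laplace_dom_le (step_dom _ a0) _ _.
  apply: measurable_funM; first exact: measurable_step.
  by apply: (measurableT_comp measurable_logistic measurable_opp).
move=> x; have /andP[h1 h2] := logistic_bounds (- x).
by apply/andP; split; [rewrite mulr_ge0 ?step_ge0// ltW|rewrite ler_piMr ?step_ge0].
Qed.

(** With q = e^(-y), this is the identity 1 / (1 + q) + q / (1 + q) = 1 under the integral. *)
Lemma half_transformD1 (c : C) : 0 < Re c -> half_transform c + half_transform (c + 1) = c^-1.
Proof.
move=> c0; rewrite -Laplace_step//.
pose w2 y : R := step y / (1 + expR (- y)) * expR (- y).
have -> : half_transform (c + 1) = Laplace (fun y => - y) w2 c.
  apply: eq_Laplace => x; rewrite mulrDl CexpD mul1r Cexp_real /w2.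
  by rewrite !rmorphM /=; ring.
have dom1 := half_transform_dom _ c0.
have [mt mw w0 _] := dom1.
have mw2 : measurable_fun setT w2.
  by apply: measurable_funM => //; exact: measurable_expRR.
have w20 x : 0 <= w2 x by rewrite mulr_ge0 ?expR_ge0.
have e1 (x : R) : 1 + expR (- x) != 0 by rewrite gt_eqF// ltr_wpDr ?expR_ge0.
have dom2 : Laplace_dom (fun y => - y) w2 (Re c).
  apply: Laplace_dom_le (step_dom _ c0) mw2 _ => x; rewrite w20 /=.
  rewrite /w2 -mulrA ler_piMr ?step_ge0// mulrC ler_pdivrMr; last first.
    by rewrite ltr_wpDr ?expR_ge0.
  by rewrite mul1r lerDr ler01.
have [|_ ->] // := @Laplace_add _ _ _ _ _ (fun y => - y) step c dom1 dom2 mt measurable_step step_ge0.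
move=> h /continuous_measurable_fun mh h0.
have mho : measurable_fun setT (fun x : R => h (- x)) by apply: (measurableT_comp mh measurable_opp).
rewrite -ge0_integralD//=.
- apply: eq_integral => x _; rewrite -EFinD -mulrDr; congr (_ * _)%:E.
  by rewrite /w2; field.
- by move=> x _; rewrite lee_fin mulr_ge0.
- by apply/measurable_EFinP; apply: measurable_funM.
- by move=> x _; rewrite lee_fin mulr_ge0.
- by apply/measurable_EFinP; apply: measurable_funM.
Qed.

Lemma norm_half_transform_le (c : C) : 0 < Re c -> `|half_transform c| <= (2 / Re c)%:C.
Proof.
move=> c0; apply: (le_trans (norm_Laplace_le _ _ _ (half_transform_dom _ c0))).
rewrite lecR ler_wpM2l// -lee_fin.
have -> : ((Re c)^-1)%:E = (\int[mu]_x (expR (Re c * - x) * step x))%:E.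
  by rewrite -integral_EFin_Rintegral ?integral_step//; case: (step_dom _ c0).
rewrite lee_fin; apply: le_Rintegral => //.
- by case: (half_transform_dom _ c0).
- by case: (step_dom _ c0).
- move=> x _; rewrite ler_wpM2l ?expR_ge0//.
  by have /andP[h1 h2] := logistic_bounds (- x); rewrite ler_piMr ?step_ge0.
Qed.

Lemma half_transform_expansion (c : C) (N : nat) : 0 < Re c ->
  half_transform c = \sum_(0 <= n < N) (-1) ^+ n / (c + n%:R) + (-1) ^+ N * half_transform (c + N%:R).
Proof.
move=> c0; elim: N => [|N IH]; first by rewrite big_geq// expr0 add0r mul1r addr0.
have cN : 0 < Re (c + N%:R).
  by rewrite ReD -(rmorph_nat (real_complex R)) /= ltr_wpDr.
rewrite big_nat_recr//= -half_transformD1// {1}IH -natr1 addrA exprS; ring.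
Qed.

Definition logistic_transform (a : C) : C := Laplace idfun (fun y => (1 + expR y)^-1) a.

(** The line is cut at 0. Reflecting the negative half gives the first term; on the positive half 1
    / (1 + e^y) = e^(-y) / (1 + e^(-y)), which turns the exponent a into 1 - a. *)
Lemma logistic_transformE (a : C) : 0 < Re a < 1 ->
  Laplace_dom idfun (fun y => (1 + expR y)^-1) (Re a) /\
  logistic_transform a = half_transform a + half_transform (1 - a).
Proof.
move=> /andP[a0 a1].
have a1' : 0 < Re (1 - a) by rewrite ReD ReN /= subr_gt0.
have dom1 := half_transform_dom _ a0.
pose w2 y : R := step y / (1 + expR y).
have mw2 : measurable_fun setT w2.
  by apply: measurable_funM; [exact: measurable_step|exact: measurable_logistic].
have lb (x : R) : 0 <= (1 + expR x)^-1 by case/andP: (logistic_bounds x) => /ltW.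
have w20 x : 0 <= w2 x by rewrite mulr_ge0 ?step_ge0.
have e1 (x : R) : 1 + expR x != 0 by rewrite gt_eqF// ltr_wpDr ?expR_ge0.
have E x : expR (1 * - x) * (step x / (1 + expR (- x))) = w2 x.
  rewrite /w2 mul1r mulrCA; congr (_ * _).
  have ex : expR x != 0 by rewrite gt_eqF ?expR_gt0.
  have e2 : expR x + 1 != 0 by rewrite addrC.
  rewrite expRN; field.
  by rewrite e1 ex.
have dom2 : Laplace_dom idfun w2 (Re a).
  split; [exact: measurable_id|exact: mw2|exact: w20|].
  have [_ _ _ iU] := half_transform_dom _ a1'; apply: eq_integrable iU => // x _.
  rewrite /comp /= -E [in RHS]mulrA -expRD; congr (expR _ * _)%:E.
  by rewrite ReD ReN /=; ring.
have -> : half_transform (1 - a) = Laplace idfun w2 a.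
  apply: eq_Laplace => x; rewrite -[in RHS]E [X in _ = _ * X]rmorphM /= [RHS]mulrA -Cexp_real -CexpD.
  by congr (Cexp _ * _); rewrite rmorphM rmorphN /= rmorph1; ring.
apply: (@Laplace_add _ _ _ _ _ idfun (fun y => (1 + expR y)^-1) a dom1 dom2
  (@measurable_id _ _ _) measurable_logistic lb).
move=> h /continuous_measurable_fun mh h0.
pose H (x : R) := (h (- x) * (step x / (1 + expR (- x))))%:E.
have mho : measurable_fun setT (fun x : R => h (- x)) by apply: (measurableT_comp mh measurable_opp).
have mH0 : measurable_fun setT (fun x : R => h (- x) * (step x / (1 + expR (- x)))).
  by apply: measurable_funM => //; case: dom1.
have -> : (\int[mu]_x H x = \int[mu]_x H (- x)%R)%E.
  rewrite (@ge0_integral_affine _ (-1) 0 H).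
  - rewrite normrN1 mul1e; apply: eq_integral => x _; congr H; ring.
  - by rewrite oppr_eq0 oner_eq0.
  - exact/measurable_EFinP.
  - by move=> x; rewrite lee_fin mulr_ge0//; case: dom1.
have -> : (\int[mu]_x (h x * w2 x)%:E = \int[mu]_x (h x / (1 + expR x) * \1_(`]0%R, +oo[%classic : set R) x)%:E)%E.
  rewrite -integral_step_oo.
    by apply: eq_integral => x _; congr EFin; rewrite /w2; ring.
  by apply: measurable_funM => //; exact: measurable_logistic.
rewrite -ge0_integralD//=.
- apply: eq_integral => x _; rewrite -EFinD opprK -mulrA -mulrDr; congr (_ * _)%:E.
  rewrite stepE indicE mem_setE in_itv/= andbT oppr_ge0.
  by case: leP => _ /=; ring.
- by move=> x _; rewrite lee_fin opprK mulr_ge0// mulr_ge0 ?step_ge0.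
- by apply/measurable_EFinP; exact: (measurableT_comp mH0 measurable_opp).
- by move=> x _; rewrite lee_fin mulr_ge0// mulr_ge0.
- apply/measurable_EFinP; apply: measurable_funM.
    by apply: measurable_funM => //; exact: measurable_logistic.
  exact: measurable_indic.
Qed.

End PartialFractions.

(** * Taylor bounds for cosine, sine and the exponential *)

Section TrigonometricBounds.
Context {R : realType}.
Implicit Types x y : R.

(** Drives the ladder of Taylor bounds below: the derivative of each remainder is the remainder of
    the preceding bound. *)
Lemma ge0_of_derive_ge0 (f df : R -> R) : f 0 = 0 ->
  (forall x, is_derive x (1:R) f (df x)) -> (forall x, 0 <= x -> 0 <= df x) ->
  forall x, 0 <= x -> 0 <= f x.
Proof.
move=> f0 fdf df0 x; rewrite le_eqVlt => /predU1P[<-|x0]; first by rewrite f0.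
have cf : {within `[0, x], continuous f}.
  apply: continuous_subspaceT => y; apply/differentiable_continuous/derivable1_diffP.
  exact: ex_derive.
have [c] := @MVT R f df 0 x x0 (fun y _ => fdf y) cf.
rewrite in_itv/= => /andP[c0 _]; rewrite f0 !subr0 => ->.
by rewrite mulr_ge0 ?df0 ?ltW.
Qed.

Lemma sin_le_x x : 0 <= x -> sin x <= x.
Proof.
move=> x0; rewrite -subr_ge0; move: x x0.
apply: (@ge0_of_derive_ge0 (fun x => x - sin x) (fun x => 1 - cos x)).
- by rewrite sin0 subr0.
- by move=> y _; rewrite subr_ge0 cos_le1.
Qed.

Lemma cos_ge2 x : 0 <= x -> 1 - x ^+ 2 / 2 <= cos x.
Proof.
move=> x0; rewrite -subr_ge0; move: x x0.
apply: (@ge0_of_derive_ge0 (fun x => cos x - (1 - x ^+ 2 / 2)) (fun x => x - sin x)).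
- rewrite cos0; ring.
- by move=> y; apply: is_derive_eq; rewrite /GRing.scale /=; lra.
- by move=> y y0; rewrite subr_ge0 sin_le_x.
Qed.

Lemma sin_ge3 x : 0 <= x -> x - x ^+ 3 / 6 <= sin x.
Proof.
move=> x0; rewrite -subr_ge0; move: x x0.
apply: (@ge0_of_derive_ge0 (fun x => sin x - (x - x ^+ 3 / 6)) (fun x => cos x - (1 - x ^+ 2 / 2))).
- rewrite sin0; ring.
- by move=> y; apply: is_derive_eq; rewrite /GRing.scale /=; lra.
- by move=> y y0; rewrite subr_ge0 cos_ge2.
Qed.

Lemma cos_le4 x : 0 <= x -> cos x <= 1 - x ^+ 2 / 2 + x ^+ 4 / 24.
Proof.
move=> x0; rewrite -subr_ge0; move: x x0.
apply: (@ge0_of_derive_ge0 (fun x => 1 - x ^+ 2 / 2 + x ^+ 4 / 24 - cos x) (fun x => sin x - (x - x ^+ 3 / 6))).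
- rewrite cos0; ring.
- by move=> y; apply: is_derive_eq; rewrite /GRing.scale /=; lra.
- by move=> y y0; rewrite subr_ge0 sin_ge3.
Qed.

Lemma sin_le5 x : 0 <= x -> sin x <= x - x ^+ 3 / 6 + x ^+ 5 / 120.
Proof.
move=> x0; rewrite -subr_ge0; move: x x0.
apply: (@ge0_of_derive_ge0 (fun x => x - x ^+ 3 / 6 + x ^+ 5 / 120 - sin x) (fun x => 1 - x ^+ 2 / 2 + x ^+ 4 / 24 - cos x)).
- rewrite sin0; ring.
- by move=> y; apply: is_derive_eq; rewrite /GRing.scale /=; lra.
- by move=> y y0; rewrite subr_ge0 cos_le4.
Qed.

Lemma cos_ge6 x : 0 <= x -> 1 - x ^+ 2 / 2 + x ^+ 4 / 24 - x ^+ 6 / 720 <= cos x.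
Proof.
move=> x0; set k : R := 720^-1.
have k120 : 120^-1 = 6 * k.
  by rewrite /k -[720]/((6 * 120)%:R) natrM invfM mulrA divff// mul1r.
rewrite -subr_ge0; move: x x0.
apply: (@ge0_of_derive_ge0 (fun x => cos x - (1 - x ^+ 2 / 2 + x ^+ 4 / 24 - x ^+ 6 * k))
  (fun x => x - x ^+ 3 / 6 + x ^+ 5 * (6 * k) - sin x)).
- rewrite cos0; ring.
- by move=> y; apply: is_derive_eq; rewrite /GRing.scale /=; field.
- by move=> y y0; rewrite -k120 subr_ge0 sin_le5.
Qed.

Lemma oneBcos_le x : 0 <= 1 - cos x <= x ^+ 2 / 2.
Proof.
rewrite subr_ge0 cos_le1/=; wlog x0 : x / 0 <= x.
  move=> h; have [|/ltW x0] := leP 0 x; first exact: h.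
  by rewrite -cosN -sqrrN h// oppr_ge0.
have := cos_ge2 x x0; lra.
Qed.

Lemma norm_sinB_le x : `|sin x - x| <= 2 * x ^+ 2.
Proof.
wlog x0 : x / 0 <= x.
  move=> h; have [|/ltW x0] := leP 0 x; first exact: h.
  have := h (- x); rewrite oppr_ge0 sinN sqrrN -opprD normrN; exact.
have h1 := sin_le_x x x0; have h3 := sin_ge3 x x0; have hN := sin_geN1 x.
rewrite ler_norml; apply/andP; split; last by nra.
have [x1|x1] := leP x 1; nra.
Qed.

(** Up to 2 the fourth-order bound gives x^2 / 3. Beyond 2 the cosine is nonpositive, and x <= pi <=
    4 makes x^2 / 16 at most 1; this second range fixes the constant. *)
Lemma cos_quadratic_gap x : - pi <= x <= pi -> x ^+ 2 / 16 <= 1 - cos x.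
Proof.
wlog x0 : x / 0 <= x.
  move=> h; have [|/ltW x0] := leP 0 x; first exact: h.
  move=> /andP[h1 h2]; have := h (- x); rewrite oppr_ge0 cosN sqrrN; apply => //.
  by rewrite lerN2 h2 lerNl h1.
move=> /andP[_ xpi]; have [x2|/ltW x2] := leP x 2.
  have := cos_le4 x x0; have -> : x ^+ 4 = x ^+ 2 * x ^+ 2 by rewrite -exprD.
  have : x ^+ 2 <= 4 by nra.
  have := sqr_ge0 x; nra.
have pi4 : pi <= (4 : R) by have := @pihalf_lt2 R; lra.
have c2 : cos x <= 0.
  have [->|xn2] := eqVneq x 2; first exact/ltW/cos2_lt0.
  apply/ltW; apply: lt_trans (@cos2_lt0 R); rewrite ltr_cos ?in_itv/= ?x0 ?xpi//.
    by rewrite lt_neqAle eq_sym xn2.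
  by rewrite pi_ge2 andbT.
nra.
Qed.

Lemma expRB1_le x : `|expR x - 1| <= `|x| * expR `|x|.
Proof.
have [x0|x0] := leP 0 x.
  have h := expR_ge1Dx (- x); have e := expRxMexpNx_1 x; have p := expR_gt0 x.
  rewrite !ger0_norm// ?subr_ge0; last by have := expR_ge1Dx x; lra.
  by nra.
have := expR_ge1Dx x; have : expR x < 1 by rewrite expR_lt1.
move=> h1 h2; rewrite (ltr0_norm x0) ler0_norm; last by lra.
have : 1 <= expR (- x) by have := expR_ge1Dx (- x); lra.
nra.
Qed.

Lemma expRB1Bx_le x : `|expR x - 1 - x| <= x ^+ 2 * expR `|x|.
Proof.
have h := expR_ge1Dx (- x); have e := expRxMexpNx_1 x; have p := expR_gt0 x.
rewrite ger0_norm; last by have := expR_ge1Dx x; lra.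
apply: (@le_trans _ _ (x * (expR x - 1))); first by nra.
apply: (le_trans (ler_norm _)); rewrite normrM -(real_normK (num_real x)) expr2 -mulrA.
by rewrite ler_wpM2l// expRB1_le.
Qed.

End TrigonometricBounds.

Section ComplexExponentialBound.
Context {R : realType}.
Local Notation C := R[i].

Lemma normCE (z : C) : exists2 r : R, 0 <= r & `|z| = r%:C /\ r ^+ 2 = Re z ^+ 2 + Im z ^+ 2.
Proof.
exists (Num.sqrt (Re z ^+ 2 + Im z ^+ 2)); first exact: sqrtr_ge0.
by rewrite normc_def sqr_sqrtr// addr_ge0 ?sqr_ge0.
Qed.

(** Serves twice: for the Fejer estimate in the reflection formula and for differentiating Laplace
    transforms. The constant is not optimized; 10 = 4 + 6 is shared between the real and the
    imaginary part. *)
Lemma CexpB1Bz_le (z : C) (r : R) : `|z| <= r%:C ->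
  `|Cexp z - 1 - z| <= (10 * r ^+ 2 * expR r)%:C.
Proof.
move=> zr; have hx := normRe_le _ _ zr; have hy := normIm_le _ _ zr.
have r0 : 0 <= r by exact: le_trans (normr_ge0 _) hx.
set x := Re z in hx *; set y := Im z in hy *.
have er : expR `|x| <= expR r by rewrite ler_expR.
have er1 : 1 <= expR r by have := expR_ge1Dx r; lra.
have xr2 : x ^+ 2 <= r ^+ 2 by rewrite -real_normK ?num_real// lerXn2r ?nnegrE.
have yr2 : y ^+ 2 <= r ^+ 2 by rewrite -real_normK ?num_real// lerXn2r ?nnegrE.
have ex0 := expR_gt0 x; have exr : expR x <= expR r.
  by rewrite ler_expR (le_trans (ler_norm _)).
have B1 := expRB1Bx_le x; have B2 := expRB1_le x.
have [C1 C2] := andP (oneBcos_le y); have S1 := norm_sinB_le y.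
have -> : 10 * r ^+ 2 * expR r = 4 * r ^+ 2 * expR r + 6 * r ^+ 2 * expR r by ring.
apply: normc_le_ReIm.
- have -> : Re (Cexp z - 1 - z) = expR x * cos y - 1 - x.
    by rewrite !ReD !ReN ReCexp.
  have -> : expR x * cos y - 1 - x = (expR x - 1 - x) - expR x * (1 - cos y) by ring.
  apply: (le_trans (ler_normB _ _)).
  rewrite (ger0_norm (mulr_ge0 (ltW ex0) C1)).
  have : x ^+ 2 * expR `|x| <= r ^+ 2 * expR r by rewrite ler_pM ?sqr_ge0 ?expR_ge0.
  have : expR x * (1 - cos y) <= expR r * r ^+ 2.
    rewrite ler_pM ?(ltW ex0)//; lra.
  have : 0 <= r ^+ 2 * expR r by rewrite mulr_ge0 ?sqr_ge0 ?expR_ge0.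
  lra.
- have -> : Im (Cexp z - 1 - z) = expR x * sin y - y.
    by rewrite !ImD !ImN ImCexp /= oppr0 addr0.
  have -> : expR x * sin y - y = expR x * (sin y - y) + (expR x - 1) * y by ring.
  apply: (le_trans (ler_normD _ _)); rewrite !normrM (gtr0_norm ex0).
  have : expR x * `|sin y - y| <= expR r * (2 * r ^+ 2).
    rewrite ler_pM ?(ltW ex0)//; lra.
  have : `|expR x - 1| * `|y| <= (r * expR r) * r.
    rewrite ler_pM// (le_trans B2)// ler_pM ?expR_ge0//.
  have : 0 <= r ^+ 2 * expR r by rewrite mulr_ge0 ?sqr_ge0 ?expR_ge0.
  lra.
Qed.

End ComplexExponentialBound.

(** * Dirichlet kernels and the partial fractions of pi / sin(pi a) *)

Section Reflection.
Context {R : realType}.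
Local Notation C := R[i].
Local Notation mu := (@lebesgue_measure R).
Local Notation Dpi := (`[(- pi)%R, pi%R]%classic : set R).

(** After division by N the right-hand side is a null sequence: the average of the 1 / (m + 1) is a
    Cesaro mean of a null sequence, so no logarithm has to be estimated. *)
Lemma vanishing_of_harmonic_bound (x A K : R) :
  (forall N : nat, x * N%:R <= A + K * \sum_(0 <= m < N) (m.+1%:R)^-1) -> x <= 0.
Proof.
move=> H.
have lim0 : (fun N : nat => A * harmonic N + K * arithmetic_mean (@harmonic R) N) @ \oo --> (A * 0 + K * 0 : R).
  apply: cvgD; apply: cvgM; try exact: cvg_cst; first exact: cvg_harmonic.
  by apply: cesaro; exact: cvg_harmonic.
rewrite !mulr0 addr0 in lim0.
apply: (@ler_cvg_to _ _ _ _ (cst x) _ x 0 (cvg_cst x) lim0); near=> N.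
have n0 : 0 < N.+1%:R :> R by rewrite ltr0n.
rewrite /cst /= -(ler_pM2r n0) (le_trans (H N.+1))//.
rewrite /arithmetic_mean /harmonic /series /=; set S := \sum_(0 <= m < N.+1) _.
have -> : (A * N.+1%:R^-1 + K * (N.+1%:R^-1 * S)) * N.+1%:R = A + K * S.
  by field; rewrite gt_eqF// -natr1 in n0 *; rewrite ?gt_eqF.
by [].
Unshelve. all: by end_near. Qed.

Definition Dirichlet_kernel (m : nat) (t : R) : R :=
  1 + \sum_(1 <= n < m.+1) 2 * cos (n%:R * t).

Lemma Dirichlet_kernelS m t :
  Dirichlet_kernel m.+1 t = Dirichlet_kernel m t + 2 * cos (m.+1%:R * t).
Proof. by rewrite /Dirichlet_kernel big_nat_recr//= addrA. Qed.

(** Multiplying by 1 - cos t instead of dividing keeps t = 0 harmless, and the right-hand side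
    telescopes when the kernels are summed into the Fejer sum. *)
Lemma Dirichlet_kernel_cos m t :
  (1 - cos t) * Dirichlet_kernel m t = cos (m%:R * t) - cos (m.+1%:R * t).
Proof.
elim: m => [|m IH].
  by rewrite /Dirichlet_kernel big_geq// mul0r cos0 mul1r addr0 mulr1.
rewrite Dirichlet_kernelS mulrDr IH.
have -> : m.+2%:R * t = m.+1%:R * t + t by rewrite -(natr1 m.+1); ring.
have -> : m%:R * t = m.+1%:R * t - t by rewrite -(natr1 m); ring.
by rewrite cosB cosD; ring.
Qed.

Lemma Dirichlet_kernel_sum N t :
  (1 - cos t) * (\sum_(0 <= m < N) Dirichlet_kernel m t) = 1 - cos (N%:R * t).
Proof.
elim: N => [|N IH]; first by rewrite big_geq// mulr0 mul0r cos0 subrr.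
by rewrite big_nat_recr//= mulrDr IH Dirichlet_kernel_cos; ring.
Qed.

Definition exp_integral (b : C) : C := Cintegral mu Dpi (fun t => Cexp ('i * b * t%:C)).

Definition sinpiz (b : C) : C := Csin (pi%:C * b).

Lemma i_neq0 : ('i : C) != 0.
Proof. by apply/eqP => -[] /eqP; rewrite oner_eq0. Qed.

Lemma mpi_lt : (- pi : R) < pi.
Proof. by have := @pi_gt0 R; lra. Qed.

Lemma mu_Dpi : fine (mu Dpi) = 2 * pi.
Proof. by rewrite lebesgue_measure_itv/= lte_fin mpi_lt /= opprK mulr_natl mulr2n. Qed.

Lemma measurable_Dpi : measurable (Dpi : set (measurableTypeR R)).
Proof. exact: measurable_itv. Qed.

Lemma exp_integral_integrable (b : C) : Cintegrable mu Dpi (fun t => Cexp ('i * b * t%:C)).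
Proof.
have [->|b0] := eqVneq b 0; last first.
  by have [] := @Cintegral_Cexp R ('i * b) (- pi) pi (mulf_neq0 i_neq0 b0) mpi_lt.
have E : {in Dpi, (fun=> 1 : C) =1 fun t => Cexp ('i * 0 * t%:C)}.
  by move=> x _; rewrite mulr0 mul0r Cexp0.
refine (eq_Cintegrable _ _ mu Dpi measurable_Dpi _ _ E _).
by split; apply: continuous_compact_integrable; try exact: segment_compact;
  apply: continuous_subspaceT => x; exact: cst_continuous.
Qed.

Lemma exp_integralE (b : C) : b != 0 -> exp_integral b = 2 * sinpiz b / b.
Proof.
move=> b0; rewrite /exp_integral; have [_ ->] := @Cintegral_Cexp R ('i * b) (- pi) pi (mulf_neq0 i_neq0 b0) mpi_lt.
rewrite /sinpiz /Csin rmorphN /= mulrN.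
have -> : 'i * (pi%:C * b) = 'i * b * pi%:C by ring.
have i0 := i_neq0; field; by rewrite b0 i0.
Qed.

Lemma exp_integral0 : exp_integral 0 = (2 * pi)%:C.
Proof.
have -> : exp_integral 0 = Cintegral mu Dpi (fun=> 1).
  by apply: eq_Cintegral => x _; rewrite mulr0 mul0r Cexp0.
apply: complex_ext; rewrite /Cintegral /= (Rintegral_cst _ measurable_Dpi) mu_Dpi.
  by rewrite mul1r.
by rewrite mul0r.
Qed.

Lemma Cexp_ipi : Cexp ('i * pi%:C : C) = -1.
Proof.
have -> : 'i * pi%:C = 0 +i* pi :> C by apply: complex_ext; rewrite ?ReM ?ImM /=; ring.
by apply: complex_ext; rewrite ?ReCexp ?ImCexp /= expR0 mul1r ?cospi ?sinpi ?oppr0.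
Qed.

Lemma sinpizD1 (b : C) : sinpiz (b + 1) = - sinpiz b.
Proof.
have E' : Cexp (- ('i * pi%:C : C)) = -1.
  by have := CexpN_mul ('i * pi%:C : C); rewrite Cexp_ipi mulrN1 => /eqP; rewrite eqr_oppLR => /eqP.
rewrite /sinpiz /Csin !mulrDr !mulr1 opprD !CexpD Cexp_ipi E'; ring.
Qed.

Lemma sinpizDn (b : C) n : sinpiz (b + n%:R) = (-1) ^+ n * sinpiz b.
Proof.
elim: n => [|n IH]; first by rewrite addr0 mul1r.
by rewrite -natr1 addrA sinpizD1 IH exprS mulN1r mulNr.
Qed.

Lemma sinpizBn (b : C) n : sinpiz (b - n%:R) = (-1) ^+ n * sinpiz b.
Proof. by rewrite -[in RHS](subrK n%:R b) sinpizDn mulrA -expr2 sqrr_sign mul1r. Qed.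

Lemma sinpizN (b : C) : sinpiz (- b) = - sinpiz b.
Proof. by rewrite /sinpiz /Csin !mulrN opprK; ring. Qed.

Lemma sinpiz0 : sinpiz (0 : C) = 0.
Proof. by rewrite /sinpiz /Csin !mulr0 oppr0 subrr mul0r. Qed.

Lemma exp_integralDn (b : C) n : b + n%:R != 0 -> exp_integral (b + n%:R) = (-1) ^+ n * (2 * sinpiz b) / (b + n%:R).
Proof. by move=> /exp_integralE ->; rewrite sinpizDn; ring. Qed.

Lemma exp_integralBn (b : C) n : b - n%:R != 0 -> exp_integral (b - n%:R) = (-1) ^+ n * (2 * sinpiz b) / (b - n%:R).
Proof. by move=> /exp_integralE ->; rewrite sinpizBn; ring. Qed.

Definition Dirichlet_term (b : C) m (t : R) : C := Cexp ('i * b * t%:C) * (Dirichlet_kernel m t)%:C.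

Lemma Cexp_double_cos (b : C) (n : nat) (t : R) :
  Cexp ('i * b * t%:C) * (2 * cos (n%:R * t))%:C =
  Cexp ('i * (b + n%:R) * t%:C) + Cexp ('i * (b - n%:R) * t%:C).
Proof.
have -> : 'i * (b + n%:R) * t%:C = 'i * b * t%:C + 'i * (n%:R * t)%:C.
  by rewrite rmorphM rmorph_nat /=; ring.
have -> : 'i * (b - n%:R) * t%:C = 'i * b * t%:C + - ('i * (n%:R * t)%:C).
  by rewrite rmorphM rmorph_nat /=; ring.
rewrite !CexpD -mulrDr; congr (_ * _); set x := n%:R * t.
have -> : 'i * x%:C = 0 +i* x :> C by apply: complex_ext; rewrite ?ReM ?ImM /=; ring.
apply: complex_ext; rewrite ?ReD ?ImD ?ReCexp ?ImCexp /= ?oppr0 !expR0 !mul1r.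
  by rewrite cosN mulr_natl mulr2n.
by rewrite sinN subrr.
Qed.

Lemma Dirichlet_termE (b : C) m t : Dirichlet_term b m t =
  Cexp ('i * b * t%:C) + \sum_(1 <= n < m.+1)
    (Cexp ('i * (b + n%:R) * t%:C) + Cexp ('i * (b - n%:R) * t%:C)).
Proof.
rewrite /Dirichlet_term /Dirichlet_kernel rmorphD rmorph1 mulrDr mulr1 rmorph_sum mulr_sumr.
by congr (_ + _); apply: eq_bigr => n _; rewrite Cexp_double_cos.
Qed.

Lemma Dirichlet_term_integral (b : C) m :
  Cintegrable mu Dpi (Dirichlet_term b m) /\
  Cintegral mu Dpi (Dirichlet_term b m) =
    exp_integral b + \sum_(1 <= n < m.+1) (exp_integral (b + n%:R) + exp_integral (b - n%:R)).
Proof.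
have i2 n : Cintegrable mu Dpi (fun t => Cexp ('i * (b + n%:R) * t%:C) + Cexp ('i * (b - n%:R) * t%:C)).
  by apply: CintegrableD => //; exact: exp_integral_integrable.
have E : {in Dpi, (fun t => Cexp ('i * b * t%:C) + \sum_(1 <= n < m.+1)
    (Cexp ('i * (b + n%:R) * t%:C) + Cexp ('i * (b - n%:R) * t%:C))) =1 Dirichlet_term b m}.
  by move=> t _; rewrite Dirichlet_termE.
split.
  refine (eq_Cintegrable _ _ mu Dpi measurable_Dpi _ _ E _).
  by apply: CintegrableD => //; [exact: exp_integral_integrable|exact: Cintegrable_sum].
rewrite -(eq_Cintegral _ _ mu Dpi _ _ E) CintegralD//; [|exact: exp_integral_integrable|exact: Cintegrable_sum].
rewrite Cintegral_sum//; congr (_ + _); apply: eq_bigr => n _.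
by rewrite CintegralD//; exact: exp_integral_integrable.
Qed.

(** Partial sums of the partial-fraction expansion of pi / sin(pi b). *)
Definition symmetric_sum (b : C) (m : nat) : C :=
  b^-1 + \sum_(1 <= n < m.+1) (-1) ^+ n * ((b + n%:R)^-1 + (b - n%:R)^-1).

Lemma symmetric_sumN b m : symmetric_sum (- b) m = - symmetric_sum b m.
Proof.
rewrite /symmetric_sum opprD invrN -sumrN; congr (_ + _); apply: eq_bigr => n _.
rewrite -mulrN; congr (_ * _).
have -> : - b + n%:R = - (b - n%:R) by ring.
by rewrite -opprD !invrN; ring.
Qed.

Lemma Dirichlet_term_sinpi (b : C) m : b != 0 ->
  (forall n : nat, b + n%:R != 0) -> (forall n : nat, b - n%:R != 0) ->
  Cintegral mu Dpi (Dirichlet_term b m) = 2 * sinpiz b * symmetric_sum b m.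
Proof.
move=> b0 bp bm; have [_ ->] := Dirichlet_term_integral b m.
rewrite exp_integralE// /symmetric_sum mulrDr; congr (_ + _).
rewrite mulr_sumr; apply: eq_bigr => n _; rewrite exp_integralDn// exp_integralBn//; ring.
Qed.

Lemma Dirichlet_term_0 m : Cintegral mu Dpi (Dirichlet_term 0 m) = (2 * pi)%:C.
Proof.
have [_ ->] := Dirichlet_term_integral 0 m.
rewrite exp_integral0 big_nat big1 ?addr0// => n /andP[n1 _].
have n0 : (n%:R : C) != 0 by rewrite pnatr_eq0 -lt0n.
rewrite exp_integralDn; last by rewrite add0r.
rewrite exp_integralBn; last by rewrite sub0r oppr_eq0.
by rewrite sinpiz0 !mulr0 !mul0r addr0.
Qed.

(** The poles a + n with 0 <= n <= m come from m + 1 terms of the expansion at a. The poles a - n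
    with 1 <= n <= m are, up to sign, the points 1 - a + (n - 1), hence only m terms at 1 - a. *)
Lemma symmetric_sum_half_transform (a : C) m : 0 < Re a < 1 ->
  symmetric_sum a m = half_transform a - (-1) ^+ m.+1 * half_transform (a + m.+1%:R)
    + (half_transform (1 - a) - (-1) ^+ m * half_transform (1 - a + m%:R)).
Proof.
move=> /andP[a0 a1].
have a1' : 0 < Re (1 - a) by rewrite ReD ReN /= subr_gt0.
rewrite {1}(half_transform_expansion a m.+1)// {1}(half_transform_expansion (1 - a) m)// !addrK.
elim: m => [|m IH].
  by rewrite /symmetric_sum big_geq// big_nat1 big_geq// !addr0 expr0 mul1r.
rewrite /symmetric_sum big_nat_recr//= addrA -/(symmetric_sum a m) IH.
rewrite [in RHS]big_nat_recr//= [X in _ = _ + X]big_nat_recr//= mulrDr.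
have -> : (a - m.+1%:R)^-1 = - (1 - a + m%:R)^-1 by rewrite -invrN -natr1; congr (_^-1); ring.
by rewrite exprS; ring.
Qed.

(* With D_m the Dirichlet kernel, the integral of (cos(at) - 1) (D_0 + ... + D_(N-1)) over
   [-pi, pi] is bounded in N, because the Fejer sum is at most 2 / (1 - cos t).  It also
   equals 2 sum_(m < N) (sin(pi a) S_m - pi) for the symmetric partial-fraction sums S_m,
   and S_m differs from the logistic transform by O(1 / m), so that
   N |sin(pi a) R(a) - pi| = O(1 + log N). *)
Lemma logistic_reflection (a : C) : 0 < Re a < 1 -> sinpiz a * logistic_transform a = pi%:C.
Proof.
move=> a01; have /andP[a0 a1] := a01.
have Re_nat (n : nat) : Re (n%:R : C) = n%:R by rewrite -(rmorph_nat (real_complex R)).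
have a_neq0 : a != 0 by apply/eqP => aE; rewrite aE ltxx in a0.
have ap (n : nat) : a + n%:R != 0.
  apply/eqP => /(congr1 Re); rewrite ReD Re_nat /= => h.
  have : 0 < Re a + n%:R by rewrite ltr_wpDr.
  by rewrite h ltxx.
have am (n : nat) : a - n%:R != 0.
  apply/eqP => /(congr1 Re); rewrite ReD ReN Re_nat /= => h.
  have {h} : Re a = n%:R by move/eqP: h; rewrite subr_eq0 => /eqP.
  case: n => [|n] h; first by rewrite h ltxx in a0.
  by move: a1; rewrite h ltrn1 ltnS.
have [rho rho0 [rhoE _]] := normCE a.
have [sg sg0 [sgE _]] := normCE (sinpiz a).
have [x x0 [xE _]] := normCE (sinpiz a * logistic_transform a - pi%:C).
suff : x <= 0.
  move=> xle; have {}x0 : x = 0 by apply/le_anti; rewrite xle x0.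
  by apply/eqP; rewrite -subr_eq0 -normr_eq0 xE x0.
(* 320 = 10 * 16 * 2: the exponential remainder, the quadratic gap of 1 - cos t, and the bound 2 on
   the Fejer sum times 1 - cos t. *)
pose B : R := 320 * rho ^+ 2 * expR (rho * pi).
(* The two tails left by the expansions: 2 for the one at a + m + 1, and 2 / (1 - Re a) for the one
   at 1 - a + m, because 1 - Re a + m >= (1 - Re a) (m + 1). *)
pose K : R := 2 + 2 / (1 - Re a).
apply: (@vanishing_of_harmonic_bound x (B * (2 * pi)) (sg * K)) => N.
(* Averaging over a and -a removes the term linear in t, and the remaining O(t^2) absorbs the factor
   1 / (1 - cos t). The integral is unaffected, since sin(pi b) S_m(b) is even in b. *)
pose G t := \sum_(0 <= m < N) ((1/2) * (Dirichlet_term a m t + Dirichlet_term (- a) m t) - Dirichlet_term 0 m t).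
have iD b m : Cintegrable mu Dpi (Dirichlet_term b m) by have [] := Dirichlet_term_integral b m.
have iG0 m : Cintegrable mu Dpi (fun t => 1/2 * (Dirichlet_term a m t + Dirichlet_term (- a) m t) + (-1) * Dirichlet_term 0 m t).
  by apply: CintegrableD => //; apply: CintegrableZ => //; apply: CintegrableD.
have GE : {in Dpi, (fun t => \sum_(0 <= m < N) (1/2 * (Dirichlet_term a m t + Dirichlet_term (- a) m t) + (-1) * Dirichlet_term 0 m t)) =1 G}.
  by move=> t _; apply: eq_bigr => m _; rewrite mulN1r.
have iG : Cintegrable mu Dpi G by refine (eq_Cintegrable _ _ mu Dpi measurable_Dpi _ _ GE _); exact: Cintegrable_sum.
have IG : Cintegral mu Dpi G = 2 * \sum_(0 <= m < N) (sinpiz a * symmetric_sum a m - pi%:C).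
  rewrite -(eq_Cintegral _ _ mu Dpi _ _ GE) Cintegral_sum// mulr_sumr; apply: eq_bigr => m _.
  have i12 := CintegrableD _ _ mu Dpi measurable_Dpi _ _ (iD a m) (iD (- a) m).
  have j1 := CintegrableZ _ _ mu Dpi measurable_Dpi (1/2) _ i12.
  have j2 := CintegrableZ _ _ mu Dpi measurable_Dpi (-1) _ (iD 0 m).
  rewrite (CintegralD _ _ mu Dpi measurable_Dpi _ _ j1 j2).
  rewrite (CintegralZ _ _ mu Dpi measurable_Dpi (1/2) _ i12).
  rewrite (CintegralZ _ _ mu Dpi measurable_Dpi (-1) _ (iD 0 m)).
  rewrite (CintegralD _ _ mu Dpi measurable_Dpi _ _ (iD a m) (iD (- a) m)).
  have na0 : - a != 0 by rewrite oppr_eq0.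
  have nap (n : nat) : - a + n%:R != 0.
    have -> : - a + n%:R = - (a - n%:R) by ring.
    by rewrite oppr_eq0.
  have nam (n : nat) : - a - n%:R != 0.
    have -> : - a - n%:R = - (a + n%:R) by ring.
    by rewrite oppr_eq0.
  rewrite Dirichlet_term_0 (Dirichlet_term_sinpi _ m a_neq0 ap am).
  rewrite (Dirichlet_term_sinpi _ m na0 nap nam).
  by rewrite sinpizN symmetric_sumN rmorphM rmorph_nat /=; field.
have bG t : Dpi t -> `|G t| <= B%:C.
  rewrite /= in_itv/= => tpi.
  have -> : G t = ((1/2) * ((Cexp ('i * a * t%:C) - 1 - 'i * a * t%:C) + (Cexp (- ('i * a * t%:C)) - 1 - - ('i * a * t%:C)))) * (\sum_(0 <= m < N) Dirichlet_kernel m t)%:C.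
    rewrite rmorph_sum mulr_sumr; apply: eq_bigr => m _.
    by rewrite /Dirichlet_term mulrN mulNr mulr0 mul0r Cexp0; field.
  have tn : `|t| <= pi by rewrite ler_norml.
  have zle : `|'i * a * t%:C| <= (rho * `|t|)%:C.
    by rewrite !normrM rhoE norm_real normc_def /= expr0n expr1n add0r sqrtr1 mul1r rmorphM.
  have zle' : `|- ('i * a * t%:C)| <= (rho * `|t|)%:C by rewrite normrN.
  have h1 := CexpB1Bz_le _ _ zle; have h2 := CexpB1Bz_le _ _ zle'.
  set S := (\sum_(0 <= m < N) Dirichlet_kernel m t).
  set P := Cexp ('i * a * t%:C) - 1 - 'i * a * t%:C.
  set Q := Cexp (- ('i * a * t%:C)) - 1 - - ('i * a * t%:C).
  have gap := cos_quadratic_gap t tpi.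
  have SE := Dirichlet_kernel_sum N t; rewrite -/S in SE.
  have c0 : 0 <= 1 - cos t by rewrite subr_ge0 cos_le1.
  have SB : (1 - cos t) * `|S| <= 2.
    rewrite -[1 - cos t]ger0_norm// -normrM SE ger0_norm ?subr_ge0 ?cos_le1//.
    by have := cos_geN1 (N%:R * t); lra.
  apply: (@le_trans _ _ ((10 * (rho * `|t|) ^+ 2 * expR (rho * `|t|)) * `|S|)%:C).
    rewrite normrM norm_real [X in _ <= X]rmorphM ler_wpM2r ?ler0c//.
    apply: (@le_trans _ _ ((1/2) * (`|P| + `|Q|))).
      rewrite normrM ger0_norm; last by rewrite mulr_ge0// invr_ge0.
      by rewrite ler_wpM2l ?ler_normD// mulr_ge0// invr_ge0.
    apply: (@le_trans _ _ ((1/2) * ((10 * (rho * `|t|) ^+ 2 * expR (rho * `|t|))%:C + (10 * (rho * `|t|) ^+ 2 * expR (rho * `|t|))%:C))).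
      by rewrite ler_wpM2l ?lerD// mulr_ge0// invr_ge0.
    have half (y : C) : 1/2 * (y + y) = y by field.
    by rewrite half.
  rewrite lecR exprMn (real_normK (num_real t)).
  have et : expR (rho * `|t|) <= expR (rho * pi) by rewrite ler_expR ler_wpM2l.
  apply: (@le_trans _ _ ((10 * rho ^+ 2 * expR (rho * pi)) * (16 * ((1 - cos t) * `|S|)))).
    have -> : 10 * (rho ^+ 2 * t ^+ 2) * expR (rho * `|t|) * `|S| =
      (10 * rho ^+ 2 * expR (rho * `|t|)) * (t ^+ 2 * `|S|) by ring.
    have t16 : t ^+ 2 <= 16 * (1 - cos t) by lra.
    apply: ler_pM.
    - by rewrite !mulr_ge0 ?expR_ge0 ?sqr_ge0.
    - by rewrite mulr_ge0 ?sqr_ge0.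
    - by rewrite ler_wpM2l// mulr_ge0 ?sqr_ge0.
    - by rewrite mulrA ler_wpM2r.
  rewrite /B; set Y := (1 - cos t) * `|S| in SB *.
  set E := expR (rho * pi).
  have -> : 10 * rho ^+ 2 * E * (16 * Y) = rho ^+ 2 * E * (160 * Y) by ring.
  have -> : 320 * rho ^+ 2 * E = rho ^+ 2 * E * 320 by ring.
  by apply: ler_wpM2l; [rewrite mulr_ge0 ?sqr_ge0 ?expR_ge0|lra].
have iB : mu.-integrable Dpi (EFin \o (fun=> B)).
  by apply: continuous_compact_integrable; [exact: segment_compact|];
    apply: continuous_subspaceT => y; exact: cst_continuous.
have NG := norm_Cintegral_le _ _ mu Dpi measurable_Dpi _ _ iG iB bG.
have E2pi : \int[mu]_(t in Dpi) B = B * (2 * pi).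
  by rewrite (Rintegral_cst _ measurable_Dpi) mu_Dpi.
rewrite E2pi IG normrM in NG.
set T1 := \sum_(0 <= m < N) (sinpiz a * symmetric_sum a m - pi%:C) in NG.
have {}NG : `|T1| <= (B * (2 * pi))%:C.
  have n2 : `|2 : C| = 2%:C by rewrite -(rmorph_nat (real_complex R)) norm_real ger0_norm.
  rewrite n2 (rmorphM _ 2) in NG.
  by rewrite ler_pM2l in NG; last by rewrite -(rmorph0 (real_complex R)) ltcR.
have [_ RE] := logistic_transformE _ a01.
have a1' : 0 < 1 - Re a by rewrite subr_gt0.
have term m : `|logistic_transform a - symmetric_sum a m| <= (K * (m.+1%:R)^-1)%:C.
  rewrite symmetric_sum_half_transform// RE.
  have -> : half_transform a + half_transform (1 - a) - (half_transform a - (-1) ^+ m.+1 * half_transform (a + m.+1%:R)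
    + (half_transform (1 - a) - (-1) ^+ m * half_transform (1 - a + m%:R))) =
    (-1) ^+ m.+1 * half_transform (a + m.+1%:R) + (-1) ^+ m * half_transform (1 - a + m%:R) by ring.
  apply: (le_trans (ler_normD _ _)); rewrite !normrM !normrX !normrN1 !expr1n !mul1r.
  have r1 : Re (a + m.+1%:R) = Re a + m.+1%:R by rewrite ReD Re_nat.
  have r2 : Re (1 - a + m%:R) = 1 - Re a + m%:R by rewrite !ReD ReN Re_nat.
  have m1 : 0 < m.+1%:R :> R by rewrite ltr0n.
  rewrite /K mulrDl rmorphD lerD//.
    apply: (le_trans (norm_half_transform_le _ _)); first by rewrite r1 addr_gt0.
    rewrite lecR r1 ler_wpM2l// lef_pV2 ?posrE ?addr_gt0//.
    by rewrite lerDr ltW.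
  have p2 : 0 < 1 - Re a + m%:R by exact: (ltr_wpDr (ler0n _ m) a1').
  apply: (le_trans (norm_half_transform_le _ _)); first by rewrite r2.
  rewrite lecR r2 -mulrA -invfM ler_wpM2l// lef_pV2 ?posrE ?p2 ?mulr_gt0//.
  have : 0 <= m%:R * Re a by rewrite mulr_ge0// ltW.
  by rewrite -natr1; lra.
rewrite -lecR (rmorphM (real_complex R)) (rmorphD (real_complex R)) /= -[x%:C]xE.
have nN : `|N%:R : C| = (N%:R)%:C by rewrite -(rmorph_nat (real_complex R)) norm_real ger0_norm.
rewrite -nN -normrM.
have -> : (sinpiz a * logistic_transform a - pi%:C) * N%:R = T1 + \sum_(0 <= m < N) sinpiz a * (logistic_transform a - symmetric_sum a m).
  rewrite -big_split /= -[in LHS](subn0 N) mulr_natr -sumr_const_nat.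
  by apply: eq_bigr => m _; ring.
apply: (le_trans (ler_normD _ _)); apply: lerD => //.
apply: (le_trans (ler_norm_sum _ _ _)).
rewrite -mulrA rmorphM mulr_sumr rmorph_sum mulr_sumr /=.
apply: ler_sum => m _; rewrite normrM sgE ler_wpM2l ?ler0c//.
Qed.

End Reflection.

(** * Gamma and Beta integrals *)

Section LogSubstitution.
Context {R : realType}.

Definition stepo (y : R) : R := \1_(`]0%R, +oo[%classic : set R) y.

Lemma measurable_stepo : measurable_fun setT stepo.
Proof. exact: measurable_indic. Qed.

Lemma stepoE y : stepo y = if 0 < y then 1 else 0.
Proof. by rewrite /stepo indicE mem_setE in_itv/= andbT; case: (0 < y). Qed.

Lemma stepo_ge0 y : 0 <= stepo y.
Proof. by rewrite stepoE; case: ifP. Qed.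

(** The measure dv / v on ]0, 1], the image of dy on y >= 0 under v = e^(-y). The open step [stepo]
    removes v <= 0, where [ln] has only its default value. *)
Definition unit_weight (v : R) : R := stepo v * step (1 - v) * expR (- ln v).

Lemma unit_weight_ge0 v : 0 <= unit_weight v.
Proof. by rewrite !mulr_ge0 ?stepo_ge0 ?step_ge0 ?expR_ge0. Qed.

End LogSubstitution.

Ltac meas_step :=
  match goal with
  | |- measurable_fun _ (fun x => _ * _) => apply: measurable_funM
  | |- measurable_fun _ (fun x => _ + _) => apply: measurable_funD
  | |- measurable_fun _ (fun x => - _) => apply: measurable_funN
  | |- measurable_fun _ (fun x => expR _) =>
      apply: (measurableT_comp (@measurable_expR _))
  | |- measurable_fun _ (fun x => ln _) =>
      apply: (measurableT_comp (@measurable_ln _))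
  | |- measurable_fun _ (fun x => step _) =>
      apply: (measurableT_comp measurable_step)
  | |- measurable_fun _ (fun x => stepo _) =>
      apply: (measurableT_comp measurable_stepo)
  | |- measurable_fun _ (fun x => ?f _) => 
      match goal with H : measurable_fun _ f |- _ => apply: (measurableT_comp H) end
  end.
Ltac meas := repeat first [exact: measurable_id | exact: measurable_stepo | exact: measurable_step | exact: measurable_ln | exact: measurable_expR | exact: measurable_cst | done | exact: measurable_fst | exact: measurable_snd | meas_step].

Section UnitWeight.
Context {R : realType}.
Local Notation mu := (@lebesgue_measure R).

Lemma measurable_unit_weight : measurable_fun setT (@unit_weight R).
Proof. rewrite /unit_weight. meas. Qed.

Lemma expR_ln (v : R) : 0 < v -> expR (ln v) = v.
Proof. by move=> v0; apply: lnK. Qed.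

(** Substitution is applied on the compact intervals [-n, 0] and [e^(-n), 1], which exhaust both
    domains; monotone convergence then gives equality of the limits, finite or not. *)
Lemma log_substitution (g : R -> R) : continuous g -> (forall x, 0 <= g x) ->
  (\int[mu]_y (g (- y) * step y)%:E = \int[mu]_v (g (ln v) * unit_weight v)%:E)%E.
Proof.
move=> cg g0; have mg := continuous_measurable_fun cg.
pose G v := g (ln v) * expR (- ln v).
have mG : measurable_fun setT G by rewrite /G; meas.
have -> : (\int[mu]_y (g (- y) * step y)%:E = \int[mu]_(y in `]-oo, 0%R]) (g y)%:E)%E.
  rewrite [RHS]integral_indic_mul [RHS](@ge0_integral_affine _ (-1) 0 (fun y => (g y * \1_(`]-oo, 0%R]%classic : set R) y)%:E)).
  - rewrite normrN1 mul1e; apply: eq_integral => y _; rewrite mulN1r addr0.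
    by rewrite stepE indicE mem_setE in_itv/= oppr_le0; case: ifP.
  - by rewrite oppr_eq0 oner_eq0.
  - apply/measurable_EFinP; apply: measurable_funM => //; exact: measurable_indic.
  - by move=> x; rewrite lee_fin mulr_ge0.
have -> : (\int[mu]_v (g (ln v) * unit_weight v)%:E = \int[mu]_(v in `]0%R, 1%R]) (G v)%:E)%E.
  rewrite [RHS]integral_indic_mul; apply: eq_integral => v _; congr EFin.
  rewrite /G /unit_weight stepoE stepE indicE mem_setE in_itv/= subr_ge0.
  by case: (0 < v); case: (v <= 1); rewrite /= ?mulr0 ?mul0r ?mulr1 ?mul1r ?mulr0.
pose F1 (n : nat) : set R := `[(- n%:R), 0%R]%classic.
pose F2 (n : nat) : set R := `[expR (- n%:R), 1%R]%classic.
have lim1 : (\int[mu]_(x in F1 i) (g x)%:E @[i --> \oo] --> \int[mu]_(x in \bigcup_i F1 i) (g x)%:E)%E.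
  apply: ge0_nondecreasing_set_cvg_integral => //.
  - apply/nondecreasing_seqP => n; rewrite subsetEset; apply: subset_itvr.
    by rewrite bnd_simp lerN2 ler_nat.
  - by move=> n; exact: measurable_itv.
  - by move=> n; apply/measurable_EFinP; exact: measurable_funTS.
  - by move=> n x _; rewrite lee_fin.
have lim2 : (\int[mu]_(x in F2 i) (G x)%:E @[i --> \oo] --> \int[mu]_(x in \bigcup_i F2 i) (G x)%:E)%E.
  apply: ge0_nondecreasing_set_cvg_integral => //.
  - apply/nondecreasing_seqP => n; rewrite subsetEset; apply: subset_itvr.
    by rewrite bnd_simp ler_expR lerN2 ler_nat.
  - by move=> n; exact: measurable_itv.
  - by move=> n; apply/measurable_EFinP; exact: measurable_funTS.
  - by move=> n x _; rewrite lee_fin mulr_ge0 ?expR_ge0.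
have U1 : \bigcup_i F1 i = `]-oo, 0%R]%classic.
  apply/seteqP; split => x /=; first by move=> [n _] /=; rewrite !in_itv/= => /andP[].
  rewrite in_itv/= => x0; exists (Num.truncn (- x)).+1 => //=.
  by rewrite /F1 /= in_itv/= x0 andbT lerNl ltW// truncnS_gt.
have U2 : \bigcup_i F2 i = `]0%R, 1%R]%classic.
  apply/seteqP; split => x /=.
    move=> [n _]; rewrite /F2 /= !in_itv/= => /andP[h h1]; apply/andP; split; last exact: h1.
    by apply: lt_le_trans h; exact: expR_gt0.
  rewrite in_itv/= => /andP[x0 x1]; exists (Num.truncn (- ln x)).+1 => //=.
  rewrite /F2 /= in_itv/=; apply/andP; split; last exact: x1.
  by rewrite -[leRHS]expR_ln// ler_expR lerNl ltW// truncnS_gt.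
rewrite U1 in lim1; rewrite U2 in lim2.
have E : (fun n => \int[mu]_(x in F2 n) (G x)%:E)%E = (fun n => \int[mu]_(x in F1 n) (g x)%:E)%E.
  apply/funext => n; rewrite /F1 /F2.
  have D (x : R) : derive1 (@expR R) x = expR x by rewrite derive1E; have [_ ->] := is_derive_expR x.
  transitivity (\int[mu]_(x in `[expR (- n%:R), expR 0%R]) (G x)%:E)%E; first by rewrite expR0.
  rewrite (@integration_by_substitution_increasing _ expR G (- n%:R) 0).
  - apply: eq_integral => x _; congr EFin; rewrite /G /= !fctE D expRK.
    by rewrite -mulrA expRN mulVf ?mulr1// gt_eqF ?expR_gt0.
  - by rewrite oppr_le0.
  - by move=> x y _ _; rewrite ltr_expR.
  - move=> x _; rewrite (funext D); exact: continuous_expR.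
  - apply/cvg_ex; exists (expR (- n%:R)); rewrite (funext D).
    by apply: cvg_at_right_filter; exact: continuous_expR.
  - apply/cvg_ex; exists (expR 0); rewrite (funext D).
    by apply: cvg_at_left_filter; exact: continuous_expR.
  - split => [x _||]; first exact: derivable_expR.
    + by apply: cvg_at_right_filter; exact: continuous_expR.
    + by apply: cvg_at_left_filter; exact: continuous_expR.
  - apply: continuous_in_subspaceT => x; rewrite mem_setE in_itv/= => /andP[h _].
    have x0 : 0 < x by apply: lt_le_trans h; exact: expR_gt0.
    have cl : {for x, continuous (@ln R)} by exact: continuous_ln.
    apply: cvgM.
      by apply: continuous_comp => //; exact: cg.
    apply: continuous_comp; last exact: continuous_expR.
    exact: cvgN.
rewrite E in lim2.
exact: (cvg_unique _ lim1 lim2).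
Qed.

End UnitWeight.

(** * Gamma as a Laplace transform in ln t *)

Section GammaFunction.
Context {R : realType}.
Local Notation C := R[i].
Local Notation mu := (@lebesgue_measure R).

Lemma Laplace_unit_weight (c : C) : 0 < Re c ->
  Laplace_dom (@ln R) unit_weight (Re c) /\ Laplace (@ln R) unit_weight c = c^-1.
Proof.
move=> c0; rewrite -Laplace_step//.
apply: Laplace_eq_law (step_dom _ c0) _ _ _ _.
- exact: measurable_ln.
- exact: measurable_unit_weight.
- exact: unit_weight_ge0.
- by move=> h ch h0; rewrite (log_substitution h ch h0).
Qed.

Definition gamma_weight (t : R) : R := stepo t * expR (- t).

Lemma measurable_gamma_weight : measurable_fun setT gamma_weight.
Proof. rewrite /gamma_weight; meas. Qed.

Lemma gamma_weight_ge0 t : 0 <= gamma_weight t.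
Proof. by rewrite mulr_ge0 ?stepo_ge0 ?expR_ge0. Qed.

Lemma gamma_dom (a : R) : -1 < a -> Laplace_dom (@ln R) gamma_weight a.
Proof.
move=> a1; split; [exact: measurable_ln|exact: measurable_gamma_weight|exact: gamma_weight_ge0|].
have a0 : 0 < Re (a + 1)%:C by rewrite /=; lra.
have [[_ _ _ i1] _] := Laplace_unit_weight _ a0.
have h0 : 0 < 1 / 2 :> R by lra.
have [_ _ _ i2] := step_dom _ h0.
(* Majorant: t^a on ]0, 1], and [K] e^(-t/2) beyond 1. The second follows from ln x < x at x = t /
   (2B), that is, B ln t <= t/2 + B ln (2B). *)
pose B := `|a| + 1; pose K := expR (B * ln (2 * B)).
have B0 : 0 < B by rewrite ltr_wpDl.
have i3 := integrable_addR _ _ mu setT measurableT _ _ i1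
  (integrable_scaleR _ _ mu setT measurableT K _ i2).
apply: integrable_dominated i3.
  by have mg := measurable_gamma_weight; meas.
move=> t; rewrite ger0_norm; last by rewrite mulr_ge0 ?expR_ge0 ?gamma_weight_ge0.
rewrite /gamma_weight /unit_weight stepoE !stepE /=.
have [t0|t0] := ltP 0 t; last first.
  by rewrite !mul0r !mulr0 add0r mulr_ge0 ?expR_ge0// mulr_ge0 ?expR_ge0//; case: ifP.
rewrite subr_ge0 (ltW t0) !mul1r mulr1; have [t1|t1] := leP t 1.
  rewrite mul1r ler_wpDr ?mulr_ge0 ?expR_ge0//.
  rewrite -!expRD ler_expR; lra.
rewrite mul0r mulr0 add0r -expRD /K -expRD ler_expR.
have lt0 : 0 <= ln t by rewrite ln_ge0// ltW.
have l1 : ln (t / (2 * B)) < t / (2 * B) by rewrite ln_sublinear// divr_gt0// mulr_gt0.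
rewrite ln_div ?posrE ?mulr_gt0// in l1.
have l2 : B * (ln t - ln (2 * B)) <= t / 2.
  have -> : t / 2 = B * (t / (2 * B)) by field; rewrite gt_eqF.
  by rewrite ler_wpM2l ?ltW.
have l3 : a * ln t <= B * ln t.
  by rewrite ler_wpM2r// /B; have := ler_norm a; lra.
lra.
Qed.

Lemma Gamma_Laplace (s : C) : 0 < Re s -> Gamma s = Laplace (@ln R) gamma_weight (s - 1).
Proof.
move=> s0; rewrite /Gamma s0 big_ord0 divr1 addr0 /Euler_integral Cintegral_indic_mul.
apply: eq_Cintegral => t _; rewrite /Cpowr -mulrA -rmorphM; congr (_ * _%:C).
by rewrite mulrC.
Qed.

Definition gam (x : R) : R := \int[mu]_t (expR ((x - 1) * ln t) * gamma_weight t).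

Lemma gam_integrable (x : R) : 0 < x ->
  mu.-integrable setT (EFin \o (fun t => expR ((x - 1) * ln t) * gamma_weight t)).
Proof. by move=> x0; have x1 : -1 < x - 1 by [lra]; case: (gamma_dom _ x1). Qed.

Lemma Gamma_real (x : R) : 0 < x -> Gamma x%:C = (gam x)%:C.
Proof.
move=> x0; rewrite Gamma_Laplace//; apply: complex_ext.
  rewrite Re_Laplace; apply: eq_Rintegral => t _.
  by rewrite ReD ImD ReN ImN /= oppr0 addr0 mul0r cos0 mulr1.
rewrite Im_Laplace /Rintegral integral0_eq// => t _.
by rewrite ReD ImD ReN ImN /= oppr0 addr0 mul0r sin0 mulr0 mul0r.
Qed.

Lemma integral_expR_tail (s : R) :
  (\int[mu]_t (expR (- t) * step (t - s))%:E = (expR (- s))%:E)%E.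
Proof.
rewrite -(ge0_integral_shift s).
- under eq_integral => t _ do rewrite opprD expRD addrK mulrAC mulrC EFinM.
  rewrite ge0_integralZl//=.
  + have := integral_step _ (@ltr01 R).
    under eq_integral do rewrite mul1r.
    by move=> ->; rewrite invr1 mule1.
  + by apply/measurable_EFinP; meas.
  + by move=> t _; rewrite lee_fin mulr_ge0 ?expR_ge0 ?step_ge0.
- by apply/measurable_EFinP; meas.
- by move=> t; rewrite lee_fin mulr_ge0 ?expR_ge0 ?step_ge0.
Qed.

(** Only t >= A is kept, where t^(x-1) >= A^(x-1), and the tail of e^(-t) is e^(-A). The free A lets
    Gamma outgrow any prescribed geometric sequence. *)
Lemma gam_lower (x A : R) : 1 <= x -> 0 < A -> expR ((x - 1) * ln A - A) <= gam x.
Proof.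
move=> x1 A0; rewrite -lee_fin expRD EFinM -(integral_expR_tail A).
rewrite -ge0_integralZl//=; last 2 first.
- by apply/measurable_EFinP; meas.
- by move=> t _; rewrite lee_fin mulr_ge0 ?expR_ge0 ?step_ge0.
have x0 : 0 < x by lra.
rewrite -integral_EFin_Rintegral; last exact: gam_integrable.
apply: ge0_le_integral => //.
- by move=> t _; rewrite -EFinM lee_fin !mulr_ge0 ?expR_ge0 ?step_ge0.
- by apply/measurable_EFinP; meas.
- by apply/measurable_EFinP; have mg := measurable_gamma_weight; meas.
move=> t _; rewrite -EFinM lee_fin /gamma_weight stepE stepoE subr_ge0.
have [At|_] := leP A t; last by rewrite !mulr0 !mulr_ge0 ?expR_ge0//; case: ifP.
rewrite (lt_le_trans A0 At) mulr1 mul1r ler_wpM2r ?expR_ge0// ler_expR.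
by rewrite ler_wpM2l ?ler_ln ?posrE ?(lt_le_trans A0 At)//; lra.
Qed.

End GammaFunction.

Section GammaFunctional.
Context {R : realType}.
Local Notation C := R[i].
Local Notation mu := (@lebesgue_measure R).

Lemma tonelliR (f : R -> R -> R) :
  measurable_fun setT (fun z : R * R => f z.1 z.2) -> (forall x y, 0 <= f x y) ->
  (\int[mu]_x \int[mu]_y (f x y)%:E = \int[mu]_y \int[mu]_x (f x y)%:E)%E.
Proof.
move=> mf f0.
have mF : measurable_fun setT (fun z : R * R => (f z.1 z.2)%:E) by exact/measurable_EFinP.
have F0 (z : R * R) : (0 <= (f z.1 z.2)%:E)%E by rewrite lee_fin.
exact: (@fubini_tonelli _ _ (measurableTypeR R) (measurableTypeR R) R mu mu
  (fun z => (f z.1 z.2)%:E) mF F0).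
Qed.

Lemma ge0_integralZlR (k : R) (f : R -> R) : 0 <= k -> measurable_fun setT f ->
  (forall x, 0 <= f x) ->
  (\int[mu]_x (k * f x)%:E = k%:E * \int[mu]_x (f x)%:E)%E.
Proof.
move=> k0 mf f0; under eq_integral do rewrite EFinM.
rewrite ge0_integralZl//=; first exact/measurable_EFinP.
by move=> x _; rewrite lee_fin.
Qed.

Lemma stepo_pmul (t v : R) : 0 < t -> stepo (t * v) = stepo v.
Proof. by move=> t0; rewrite !stepoE pmulr_rgt0. Qed.

Lemma step_pmul (t v : R) : 0 < t -> step (t * v) = step v.
Proof. by move=> t0; rewrite !stepE pmulr_rge0. Qed.

Lemma gamma_weight_step (s t : R) : 0 < s ->
  step (t - s) * gamma_weight t = expR (- t) * step (t - s).
Proof.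
move=> s0; rewrite /gamma_weight stepE stepoE subr_ge0 mulrC.
by have [h|_] := leP s t; rewrite ?mulr0// (lt_le_trans s0 h) mul1r.
Qed.

(** Read as a product s = tv: the integral of e^(-t) over t >= s is e^(-s), so e^(-s) ds/s is the
    multiplicative convolution of e^(-t) dt with dv/v on ]0, 1]. On transforms this is Gamma(s) =
    Gamma(s + 1) / s, reached without integration by parts. *)
Lemma gamma_shift_law (h : R -> R) : measurable_fun setT h -> (forall x, 0 <= h x) ->
  (\int[mu]_x (h (ln x) * (gamma_weight x * expR (- ln x)))%:E =
   \int[mu]_t \int[mu]_v (h (ln t + ln v) * (gamma_weight t * unit_weight v))%:E)%E.
Proof.
move=> mh h0; have mg := @measurable_gamma_weight R.
pose f t s := h (ln s) * (stepo s * expR (- ln s)) * (step (t - s) * gamma_weight t).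
transitivity (\int[mu]_s \int[mu]_t (f t s)%:E)%E.
  apply: eq_integral => s _; rewrite /f ge0_integralZlR; last 3 first.
  - by rewrite mulr_ge0 ?mulr_ge0 ?stepo_ge0 ?expR_ge0.
  - by meas.
  - by move=> t; rewrite mulr_ge0 ?step_ge0 ?gamma_weight_ge0.
  have [s0|s0] := ltP 0 s; last first.
    by rewrite /gamma_weight stepoE ltNge s0 /= !mul0r !mulr0 mul0e.
  under eq_integral do rewrite gamma_weight_step//.
  by rewrite integral_expR_tail -EFinM /gamma_weight; congr EFin; ring.
rewrite -tonelliR; last 2 first.
- by rewrite /f; meas.
- move=> t s; rewrite /f mulr_ge0 ?mulr_ge0 ?stepo_ge0 ?expR_ge0 ?step_ge0 ?gamma_weight_ge0//.
apply: eq_integral => t _; have [t0|t0] := ltP 0 t; last first.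
  rewrite !integral0_eq// => s _; rewrite /f /gamma_weight (stepoE t) ltNge t0 /=.
    by rewrite !mul0r mulr0.
  by rewrite mul0r !mulr0.
rewrite (@ge0_integral_affine _ t 0 (fun s => (f t s)%:E)) ?gt_eqF//; last 2 first.
- by apply/measurable_EFinP; rewrite /f; meas.
- by move=> s; rewrite lee_fin /f mulr_ge0 ?mulr_ge0 ?stepo_ge0 ?expR_ge0 ?step_ge0 ?gamma_weight_ge0//.
rewrite (gtr0_norm t0) -(ge0_integralZlR t (fun s => f t (t * s + 0)) (ltW t0)); last 2 first.
- by rewrite /f; meas.
- by move=> s; rewrite /f mulr_ge0 ?mulr_ge0 ?stepo_ge0 ?expR_ge0 ?step_ge0 ?gamma_weight_ge0//.
apply: eq_integral => v _; congr EFin; rewrite /f addr0 /unit_weight.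
have -> : t - t * v = t * (1 - v) by ring.
rewrite stepo_pmul// step_pmul// stepoE.
have [v0|v0] := ltP 0 v; last by rewrite !mul0r !mulr0 !mul0r ?mulr0.
rewrite lnM ?posrE// opprD expRD !mul1r.
have -> : expR (- ln t) = t^-1 by rewrite expRN expR_ln.
by field; rewrite gt_eqF.
Qed.

Lemma GammaD1 (s : C) : 0 < Re s -> Gamma (s + 1) = s * Gamma s.
Proof.
move=> s0; have s1 : 0 < Re (s + 1) by rewrite ReD /=; lra.
have s_neq0 : s != 0 by apply/eqP => sE; rewrite sE ltxx in s0.
rewrite !Gamma_Laplace// addrK.
have sm1 : -1 < Re s by lra.
have [dom2 E2] := Laplace_unit_weight _ s0.
have [||||_ E] := @Laplace_mul R (@ln R) gamma_weight (@ln R) unit_weight (@ln R)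
  (fun x => gamma_weight x * expR (- ln x)) s (gamma_dom _ sm1) dom2.
- exact: measurable_ln.
- by have mg := @measurable_gamma_weight R; meas.
- by move=> x; rewrite mulr_ge0 ?gamma_weight_ge0 ?expR_ge0.
- by move=> h /continuous_measurable_fun mh h0; exact: gamma_shift_law.
have -> : Laplace (@ln R) gamma_weight (s - 1) = Laplace (@ln R) (fun x => gamma_weight x * expR (- ln x)) s.
  apply: eq_Laplace => x; rewrite mulrBl mul1r CexpD -rmorphN Cexp_real.
  by rewrite !rmorphM /=; ring.
by rewrite E E2 mulrCA divff// mulr1.
Qed.

Lemma gamD1 (x : R) : 0 < x -> gam (x + 1) = x * gam x.
Proof.
move=> x0; apply: (@complexI R); rewrite [RHS](rmorphM (real_complex R)) /=.
rewrite -!Gamma_real ?addr_gt0// -GammaD1//; congr Gamma.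
by rewrite (rmorphD (real_complex R)).
Qed.

Lemma gam_gt0 (x : R) : 0 < x -> 0 < gam x.
Proof.
move=> x0; have : 0 < gam (x + 1).
  have x1 : 1 <= x + 1 by lra.
  by apply: lt_le_trans (gam_lower _ _ x1 (@ltr01 R)); exact: expR_gt0.
by rewrite gamD1// pmulr_rgt0.
Qed.

Lemma gam1 : gam (1 : R) = 1.
Proof.
apply: EFin_inj; rewrite /gam -integral_EFin_Rintegral; last exact: gam_integrable.
have := integral_step (1 : R) ltr01; rewrite invr1 => <-.
transitivity (\int[mu]_x (expR (- x) * stepo x)%:E)%E.
  by apply: eq_integral => x _; rewrite subrr mul0r expR0 mul1r mulrC.
transitivity (\int[mu]_x (expR (- x) * step x)%:E)%E.
  by rewrite integral_step_oo//; meas.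
by apply: eq_integral => x _; rewrite mul1r.
Qed.

Lemma gam_fact n : gam (n%:R + 1 : R) = n`!%:R.
Proof.
elim: n => [|n IH]; first by rewrite add0r gam1 fact0.
by rewrite -{1}natr1 gamD1 ?IH ?ltr_wpDl// factS natrM natr1.
Qed.

Definition beta_weight (b v : R) : R :=
  stepo v * stepo (1 - v) * expR ((b - 1) * ln (1 - v)).

Lemma measurable_beta_weight b : measurable_fun setT (beta_weight b).
Proof. rewrite /beta_weight; meas. Qed.

Lemma beta_weight_ge0 b v : 0 <= beta_weight b v.
Proof. by rewrite !mulr_ge0 ?stepo_ge0 ?expR_ge0. Qed.

(** With s = tv the density t^b e^(-t) (1 - s/t)^(b-1) / t equals e^(-t) (t - s)^(b-1), and
    integrating over t > s leaves Gamma(b) e^(-s). Powers as test functions give the Beta moments;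
    the cosine remainder as test function gives the law of K. *)
Lemma beta_law (b : R) (h : R -> R) : 0 < b -> measurable_fun setT h ->
  (forall x, 0 <= h x) ->
  (\int[mu]_t \int[mu]_v (h (t * v)%R * (gamma_weight t * expR (b * ln t) * beta_weight b v))%:E =
   (gam b)%:E * \int[mu]_s (h s * gamma_weight s)%:E)%E.
Proof.
move=> b0 mh h0; have mg := @measurable_gamma_weight R; have mb := measurable_beta_weight b.
pose f t s := h s * stepo s * (gamma_weight t * stepo (t - s) * expR ((b - 1) * ln (t - s))).
have f0 t s : 0 <= f t s.
  by rewrite /f mulr_ge0 ?mulr_ge0 ?stepo_ge0 ?expR_ge0 ?gamma_weight_ge0.
have mf : measurable_fun setT (fun z : R * R => f z.1 z.2) by rewrite /f; meas.
transitivity (\int[mu]_t \int[mu]_s (f t s)%:E)%E.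
  apply: eq_integral => t _; have [t0|t0] := ltP 0 t; last first.
    rewrite !integral0_eq// => s _; rewrite /f /gamma_weight (stepoE t) ltNge t0 /=.
      by rewrite !mul0r mulr0.
    by rewrite !mul0r !mulr0.
  rewrite (@ge0_integral_affine _ t 0 (fun s => (f t s)%:E)) ?gt_eqF//; last 2 first.
  - by apply/measurable_EFinP; rewrite /f; meas.
  - by move=> s; rewrite lee_fin.
  rewrite (gtr0_norm t0) -(ge0_integralZlR t (fun s => f t (t * s + 0)) (ltW t0)); last 2 first.
  - by rewrite /f; meas.
  - by move=> s; exact: f0.
  apply: eq_integral => v _; congr EFin; rewrite /f addr0 /beta_weight.
  have -> : t - t * v = t * (1 - v) by ring.
  rewrite stepo_pmul// stepo_pmul// (stepoE (1 - v)).
  have [v0|v0] := ltP 0 (1 - v); last by rewrite !(mul0r, mulr0).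
  rewrite lnM ?posrE// mulrDr expRD.
  have -> : expR (b * ln t) = t * expR ((b - 1) * ln t).
    by rewrite -{2}(expR_ln t t0) -expRD; congr expR; ring.
  by rewrite mulr1; ring.
rewrite tonelliR// -ge0_integralZlR; last 3 first.
- exact/ltW/gam_gt0.
- by meas.
- by move=> s; rewrite mulr_ge0 ?gamma_weight_ge0.
apply: eq_integral => s _; have [s0|s0] := ltP 0 s; last first.
  rewrite integral0_eq.
    by rewrite /gamma_weight stepoE ltNge s0 /= !(mul0r, mulr0).
  by move=> t _; rewrite /f stepoE ltNge s0 /= !(mul0r, mulr0).
rewrite /f ge0_integralZlR; last 3 first.
- by rewrite mulr_ge0 ?stepo_ge0.
- by meas.
- by move=> t; rewrite !mulr_ge0 ?stepo_ge0 ?expR_ge0 ?gamma_weight_ge0.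
rewrite -(ge0_integral_shift s); last 2 first.
- by apply/measurable_EFinP; meas.
- by move=> t; rewrite lee_fin !mulr_ge0 ?stepo_ge0 ?expR_ge0 ?gamma_weight_ge0.
transitivity ((h s * stepo s)%:E * \int[mu]_t (expR (- s) * (expR ((b - 1) * ln t) * gamma_weight t))%:E)%E.
  congr (_ * _)%E; apply: eq_integral => t _; congr EFin.
  rewrite addrK /gamma_weight !stepoE.
  have [t0|t0] := ltP 0 t; last by rewrite !(mul0r, mulr0).
  by rewrite addr_gt0// opprD expRD; ring.
rewrite ge0_integralZlR ?expR_ge0//; last 2 first.
- by meas.
- by move=> t; rewrite mulr_ge0 ?expR_ge0 ?gamma_weight_ge0.
rewrite integral_EFin_Rintegral; last exact: gam_integrable.
rewrite -/(gam b) -!EFinM /gamma_weight; congr EFin; ring.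
Qed.

Lemma gam_pow (x : R) n : 0 < x ->
  (\int[mu]_t (t ^+ n * gamma_weight t * expR ((x - 1) * ln t))%:E = (gam (x + n%:R))%:E)%E.
Proof.
move=> x0; rewrite /gam -integral_EFin_Rintegral; last by apply: gam_integrable; rewrite ltr_wpDr.
apply: eq_integral => t _; congr EFin; rewrite /gamma_weight stepoE.
have [t0|t0] := ltP 0 t; last by rewrite !(mul0r, mulr0).
have -> : t ^+ n = expR (n%:R * ln t) by rewrite expRM_natl expR_ln.
have -> : x + n%:R - 1 = n%:R + (x - 1) by ring.
by rewrite [(_ + (x - 1)) * _]mulrDl [expR (_ + (x - 1) * _)]expRD; ring.
Qed.

(** The preceding law tested on s^n. Even n makes this function nonnegative on the whole line, as
    the law requires. *)
Lemma beta_moment_ereal (b : R) (n : nat) : 0 < b -> ~~ odd n ->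
  ((gam (b + 1 + n%:R))%:E * \int[mu]_v (v ^+ n * beta_weight b v)%:E =
   (gam b * n`!%:R)%:E)%E.
Proof.
move=> b0 en; have mg := @measurable_gamma_weight R; have mb := measurable_beta_weight b.
have mX : measurable_fun setT (fun x : R => x ^+ n) by exact: measurable_funX.
have pos (x : R) : 0 <= x ^+ n by rewrite exprn_even_ge0.
have := beta_law b (fun x => x ^+ n) b0 mX pos.
have -> : (\int[mu]_s (s ^+ n * gamma_weight s)%:E = (n`!%:R)%:E)%E.
  rewrite -gam_fact [n%:R + 1]addrC -gam_pow//; apply: eq_integral => s _.
  by rewrite subrr mul0r expR0 mulr1.
rewrite -EFinM => <-.
have b1 : 0 < b + 1 by rewrite addr_gt0.
transitivity (\int[mu]_t ((t ^+ n * gamma_weight t * expR (b * ln t))%:E * \int[mu]_v (v ^+ n * beta_weight b v)%:E))%E.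
  rewrite ge0_integralZr//=.
  - congr (_ * _)%E; rewrite -gam_pow//; apply: eq_integral => t _.
    by rewrite addrK.
  - by apply/measurable_EFinP; meas.
  - by move=> t _; rewrite lee_fin !mulr_ge0 ?expR_ge0 ?gamma_weight_ge0.
  - by apply: integral_ge0 => v _; rewrite lee_fin mulr_ge0 ?beta_weight_ge0.
apply: eq_integral => t _; rewrite -ge0_integralZlR.
- by apply: eq_integral => v _; congr EFin; rewrite exprMn; ring.
- by rewrite !mulr_ge0 ?expR_ge0 ?gamma_weight_ge0.
- by apply: measurable_funM.
- by move=> v; rewrite mulr_ge0 ?beta_weight_ge0.
Qed.

Lemma beta_weight_integrable (b : R) : 0 < b ->
  mu.-integrable setT (EFin \o beta_weight b).
Proof.
move=> b0; have mb := measurable_beta_weight b.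
apply/integrableP; split; first exact/measurable_EFinP.
under eq_integral do rewrite gee0_abs ?lee_fin ?beta_weight_ge0//.
have E : (\int[mu]_v (v ^+ 0 * beta_weight b v)%:E = \int[mu]_v (beta_weight b v)%:E)%E.
  by apply: eq_integral => v _; rewrite expr0 mul1r.
have := beta_moment_ereal b 0 b0 isT; rewrite addr0 E.
have g0 : 0 < gam (b + 1) by apply: gam_gt0; rewrite addr_gt0.
case: (integral _ _ _) => [r _||]; first exact: ltry.
  by rewrite gt0_muley ?lte_fin.
by rewrite gt0_muleNy ?lte_fin.
Qed.

Lemma beta_weight_support (b v : R) : v <= 0 \/ 1 <= v -> beta_weight b v = 0.
Proof.
by rewrite /beta_weight !stepoE subr_gt0 => -[h|h]; [rewrite [0 < v]ltNge h|rewrite [v < 1]ltNge h]; rewrite /= !(mul0r, mulr0).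
Qed.

Lemma beta_moment_integrable (b : R) (f : R -> R) : 0 < b -> measurable_fun setT f ->
  (forall v, 0 < v < 1 -> `|f v| <= 1) ->
  mu.-integrable setT (EFin \o (fun v => f v * beta_weight b v)).
Proof.
move=> b0 mf f1; have mb := measurable_beta_weight b.
apply: integrable_dominated (beta_weight_integrable b b0); first exact: measurable_funM.
move=> v; rewrite normrM (ger0_norm (beta_weight_ge0 b v)).
have [v0|v0] := leP v 0; first by rewrite beta_weight_support ?mulr0//; left.
have [v1|v1] := leP 1 v; first by rewrite beta_weight_support ?mulr0//; right.
by rewrite ler_piMl ?beta_weight_ge0// f1// v0 v1.
Qed.

Lemma beta_moment (b : R) (n : nat) : 0 < b -> ~~ odd n ->
  \int[mu]_v (v ^+ n * beta_weight b v) = gam b * n`!%:R / gam (b + 1 + n%:R).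
Proof.
move=> b0 en; have g0 : 0 < gam (b + 1 + n%:R) by rewrite gam_gt0// ltr_wpDr// addr_gt0.
apply: (mulfI (lt0r_neq0 g0)); apply: EFin_inj.
have mX : measurable_fun setT (fun x : R => x ^+ n) by exact: measurable_funX.
rewrite EFinM -(integral_EFin_Rintegral (fun v => v ^+ n * beta_weight b v)); last first.
  apply: (beta_moment_integrable b (fun v : R => v ^+ n)) => // v /andP[v0 v1].
  by rewrite normrX (ger0_norm (ltW v0)); apply: exprn_ile1; exact: ltW.
rewrite beta_moment_ereal//; congr EFin; field.
by rewrite gt_eqF.
Qed.

End GammaFunctional.

(** * The alternating series K *)

Section CosineRemainder.
Context {R : realType}.
Implicit Types x y t : R.

Definition cos_rem x : R := x ^+ 2 / 2 - 1 + cos x.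

Lemma cos_rem_even x : cos_rem `|x| = cos_rem x.
Proof. by rewrite /cos_rem cos_norm real_normK ?num_real. Qed.

Lemma cos_rem_ge0 x : 0 <= cos_rem x.
Proof.
by rewrite -cos_rem_even /cos_rem; have := cos_ge2 `|x| (normr_ge0 x); lra.
Qed.

Lemma cos_rem_le2 x : cos_rem x <= x ^+ 2 / 2.
Proof. by rewrite /cos_rem; have := cos_le1 x; lra. Qed.

Lemma cos_rem_le4 x : 0 <= x -> cos_rem x <= x ^+ 4 / 24.
Proof. by move=> x0; rewrite /cos_rem; have := cos_le4 x x0; lra. Qed.

(** The sixth-order term is dominated as long as x^2 <= 15, while the complementary bound for large
    x only needs x^2 >= 8; the threshold 9 lies between. *)
Lemma cos_rem_ge_small x : 0 <= x -> x ^+ 2 <= 9 -> x ^+ 4 / 48 <= cos_rem x.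
Proof.
move=> x0 x8; have h := cos_ge6 x x0; rewrite /cos_rem.
suff : x ^+ 6 / 720 <= x ^+ 4 / 48 by lra.
have -> : x ^+ 6 / 720 = x ^+ 4 * (x ^+ 2 / 720) by rewrite mulrA -exprD.
apply: ler_wpM2l; first exact: exprn_ge0.
by have -> : 720^-1 = 48^-1 * 15^-1 :> R; [rewrite -invfM -natrM|]; nra.
Qed.

Lemma cos_rem_ge_large x : 0 <= x -> 9 <= x ^+ 2 -> x ^+ 2 / 4 <= cos_rem x.
Proof. by move=> x0 x8; have := cos_geN1 x; rewrite /cos_rem; lra. Qed.

(** Below the threshold the remainder lies between x^4 / 48 and x^4 / 24, beyond it between x^2 / 4
    and x^2 / 2. The factor 2 is the ratio of upper to lower bound in either range, and the bound
    x^2 / 2 holds for every x, which covers mixed pairs. *)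
Lemma cos_rem_almost_increasing x y : 0 < x -> x <= y ->
  cos_rem x * y ^+ 2 <= 2 * cos_rem y * x ^+ 2.
Proof.
move=> x0 xy; have y0 : 0 < y by exact: lt_le_trans xy.
have x2y2 : x ^+ 2 <= y ^+ 2 by rewrite lerXn2r ?nnegrE// ltW.
have [y9|/ltW y9] := leP (y ^+ 2) 9.
  apply: (@le_trans _ _ (x ^+ 4 / 24 * y ^+ 2)).
    by rewrite ler_wpM2r ?sqr_ge0// cos_rem_le4// ltW.
  apply: (@le_trans _ _ (2 * (y ^+ 4 / 48) * x ^+ 2)); last first.
    by rewrite ler_wpM2r ?sqr_ge0// ler_wpM2l// cos_rem_ge_small// ltW.
  have -> : x ^+ 4 / 24 * y ^+ 2 = (x ^+ 2 * y ^+ 2 / 24) * x ^+ 2 by rewrite (exprD x 2 2); ring.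
  have -> : 2 * (y ^+ 4 / 48) * x ^+ 2 = (x ^+ 2 * y ^+ 2 / 24) * y ^+ 2.
    by rewrite (exprD y 2 2); field.
  by rewrite ler_wpM2l// mulr_ge0// mulr_ge0 ?sqr_ge0.
apply: (@le_trans _ _ (x ^+ 2 / 2 * y ^+ 2)).
  by rewrite ler_wpM2r ?sqr_ge0// cos_rem_le2.
apply: (@le_trans _ _ (2 * (y ^+ 2 / 4) * x ^+ 2)); first lra.
by rewrite ler_wpM2r ?sqr_ge0// ler_wpM2l// cos_rem_ge_large// ltW.
Qed.

Definition cos_rem_coeff x i : R := (2 <= i)%N%:R * cos_coeff' x i.

Lemma cos_rem_series x : series (cos_rem_coeff x) @ \oo --> cos_rem x.
Proof.
have c0 : cos_coeff' x 0 = 1.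
  by rewrite /cos_coeff' -exprnP double0 !expr0 fact0 mulr1 divr1.
have c1 : cos_coeff' x 1 = - (x ^+ 2 / 2).
  by rewrite /cos_coeff' -exprnP expr1 -[1.*2]/2%N mulN1r mulNr.
have E n : series (cos_rem_coeff x) n.+2 = series (cos_coeff' x) n.+2 + (x ^+ 2 / 2 - 1).
  elim: n => [|n IH].
    rewrite /series /= !big_nat_recr//= !big_geq// /cos_rem_coeff /= c0 c1; ring.
  rewrite (seriesSr _ n.+2) IH (seriesSr _ n.+2) /cos_rem_coeff /= mul1r; ring.
rewrite -(cvg_shiftn 2) /=.
have -> : (fun n => series (cos_rem_coeff x) (n + 2)%N) = (fun n => series (cos_coeff' x) (n + 2)%N + (x ^+ 2 / 2 - 1)).
  by apply/funext => n; rewrite addn2 E.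
have -> : cos_rem x = cos x + (x ^+ 2 / 2 - 1) by rewrite /cos_rem; ring.
apply: cvgD; last exact: cvg_cst.
by have := @cvg_cos_coeff' R x; rewrite -(cvg_shiftn 2).
Qed.

(** Comparing (2i)! with i! bounds all partial sums by the exponential series, which provides the
    dominating function for termwise integration. *)
Lemma norm_cos_rem_series x n : `|series (cos_rem_coeff x) n| <= expR (x ^+ 2).
Proof.
apply: (@le_trans _ _ (series (exp_coeff (x ^+ 2)) n)); last first.
  have -> : expR (x ^+ 2) = limn (series (exp_coeff (x ^+ 2))).
    by rewrite expRE exp_coeffE.
  apply: nondecreasing_cvgn_le.
    apply/nondecreasing_seqP => k; rewrite /series /= big_nat_recr//= lerDl.
    by rewrite exp_coeffE mulr_ge0// exprn_ge0 ?sqr_ge0.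
  exact: is_cvg_series_exp_coeff.
apply: (le_trans (ler_norm_sum _ _ _)); apply: ler_sum => i _.
rewrite /cos_rem_coeff normrM; apply: (@le_trans _ _ (`|cos_coeff' x i|)).
  by case: (2 <= i)%N; rewrite ?normr0 ?normr1 ?mul0r ?mul1r.
rewrite /cos_coeff' !normrM -exprnP normrX normrN1 expr1n mul1r.
have y0 := exprn_ge0 i (sqr_ge0 x).
rewrite -mul2n exprM (ger0_norm y0) /exp_coeff /= ler_wpM2l//.
rewrite ger0_norm ?invr_ge0// lef_pV2 ?posrE ?ltr0n ?fact_gt0// ler_nat.
by apply: leq_fact; rewrite mul2n -addnn leq_addl.
Qed.

End CosineRemainder.

Section SeriesIntegral.
Context {R : realType}.
Local Notation mu := (@lebesgue_measure R).

Lemma cvg_integral_series (f : nat -> R -> R) (F g : R -> R) :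
  (forall n, measurable_fun setT (f n)) -> measurable_fun setT F ->
  (forall n, mu.-integrable setT (EFin \o f n)) ->
  (forall x, series (f ^~ x) n @[n --> \oo] --> F x) ->
  mu.-integrable setT (EFin \o g) ->
  (forall x n, `|series (f ^~ x) n| <= g x) ->
  mu.-integrable setT (EFin \o F) /\
  series (fun n => \int[mu]_x f n x) @ \oo --> \int[mu]_x F x.
Proof.
move=> mf mF fi fF gi fg.
pose S n x := series (f ^~ x) n.
have mS n : measurable_fun setT (S n).
  by rewrite /S /series /=; apply: measurable_sum.
have [|||||Fi _ lim] := @dominated_convergence _ _ _ mu setT measurableT
  (fun n => EFin \o S n) (EFin \o F) (EFin \o g).
- by move=> n; apply/measurable_EFinP; exact: mS.
- exact/measurable_EFinP.
- by apply: aeW => x _; apply: cvg_EFin; [exact: nearW|exact: fF].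
- exact: gi.
- by apply: aeW => x n _; rewrite /= lee_fin; exact: fg.
split => //.
rewrite integral_EFin_Rintegral// in lim.
have Si n : mu.-integrable setT (EFin \o S n).
  rewrite /S /series /=; elim: n => [|n IH].
    rewrite (_ : _ \o _ = cst 0%E); first exact: integrable0.
    by apply/funext => x /=; rewrite big_geq.
  rewrite (_ : _ \o _ = EFin \o (fun x => \sum_(0 <= k < n) f k x + f n x)).
    exact: integrable_addR.
  by apply/funext => x /=; rewrite big_nat_recr.
have SE n : \int[mu]_x S n x = series (fun n => \int[mu]_x f n x) n.
  elim: n => [|n IH].
    rewrite /series /= big_geq// /S /series /Rintegral integral0_eq// => x _ /=.
    by rewrite big_geq.
  rewrite seriesSr -IH -RintegralD//; apply: eq_Rintegral => x _.
  by rewrite /S seriesSr.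
rewrite (_ : series _ = (fun n => \int[mu]_x S n x)); last by apply/funext => n; rewrite SE.
have -> : (fun n => \int[mu]_x S n x) = fine \o (fun n => \int[mu]_x (S n x)%:E)%E by [].
exact: (fine_cvg lim).
Qed.

End SeriesIntegral.

(** * Even power series majorized by 1 / Gamma(2k + 5/4) *)

Section PowerSeries.
Context {R : realType}.

(** Common majorant: every coefficient sequence of the proof is bounded by a constant times this
    one. *)
Definition ecoef (k : nat) : R := (gam ((2 * k)%:R + 5 / 4))^-1.

Lemma ecoef_arg_gt0 k : 0 < (2 * k)%:R + 5 / 4 :> R.
Proof. by rewrite ltr_wpDl. Qed.

Lemma ecoef_gt0 k : 0 < ecoef k.
Proof. by rewrite invr_gt0 gam_gt0// ecoef_arg_gt0. Qed.

Lemma ecoef_geometric (y : R) : 0 <= y ->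
  exists2 c : R, 0 <= c & forall k, ecoef k * y ^+ k <= c * (1 / 2) ^+ k.
Proof.
(* The lower bound on Gamma at this A is at least a^(2k) e^(-a), and a^2 >= 2y turns the quotient
   into a multiple of (1/2)^k. *)
move=> y0; pose a := 1 + 2 * y.
have a1 : 1 <= a by rewrite /a; lra.
have a0 : 0 < a by lra.
exists (expR a); first exact: expR_ge0.
move=> k; rewrite /ecoef mulrC ler_pdivrMr ?gam_gt0 ?ecoef_arg_gt0//.
have g1 : 1 <= (2 * k)%:R + 5 / 4 :> R by have := ler0n R (2 * k); lra.
have := gam_lower _ _ g1 a0.
have la : 0 <= ln a by rewrite ln_ge0.
have h : a ^+ (2 * k) * expR (- a) <= expR (((2 * k)%:R + 5 / 4 - 1) * ln a - a).
  rewrite expRD ler_wpM2r ?expR_ge0// -{1}(expR_ln a a0) -expRM_natl ler_expR.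
  by rewrite ler_wpM2r//; lra.
move=> /(le_trans h) {}h.
apply: (@le_trans _ _ (expR a * (1 / 2) ^+ k * (a ^+ (2 * k) * expR (- a)))); last first.
  by rewrite ler_wpM2l// mulr_ge0 ?expR_ge0 ?exprn_ge0.
have -> : expR a * (1 / 2) ^+ k * (a ^+ (2 * k) * expR (- a)) =
    (expR a * expR (- a)) * ((1 / 2) ^+ k * a ^+ (2 * k)) by ring.
rewrite expRxMexpNx_1 mul1r exprM -exprMn lerXn2r ?nnegrE//.
  by rewrite mulr_ge0 ?sqr_ge0.
by rewrite /a; nra.
Qed.

Definition pser (al : nat -> R) (z : R) : R := limn (series (fun k => al k * z ^+ (2 * k))).

Lemma even_pow_ge0 (z : R) k : 0 <= z ^+ (2 * k).
Proof. by rewrite exprM exprn_ge0// sqr_ge0. Qed.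

Lemma ecoef_cvg (z : R) : cvgn (series (fun k => ecoef k * z ^+ (2 * k))).
Proof.
have [c c0 H] := ecoef_geometric _ (sqr_ge0 z).
apply: (@series_le_cvg _ _ (geometric c (1 / 2))).
- by move=> k; rewrite mulr_ge0 ?even_pow_ge0 ?ltW ?ecoef_gt0.
- by move=> k; rewrite /= mulr_ge0// exprn_ge0.
- by move=> k; rewrite exprM /=; exact: H.
- by apply: is_cvg_geometric_series; rewrite ger0_norm; lra.
Qed.

Lemma pser_normed_cvg (al : nat -> R) (z eta : R) : (forall k, `|al k| <= eta * ecoef k) ->
  cvgn [normed series (fun k => al k * z ^+ (2 * k))].
Proof.
move=> H; have e0 : 0 <= eta.
  by have := le_trans (normr_ge0 _) (H 0%N); rewrite pmulr_lge0// ecoef_gt0.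
apply: (@series_le_cvg _ _ (fun k => eta * (ecoef k * z ^+ (2 * k)))).
- by move=> k; exact: normr_ge0.
- by move=> k; rewrite mulr_ge0// mulr_ge0 ?even_pow_ge0 ?ltW ?ecoef_gt0.
- by move=> k; rewrite /= normrM (ger0_norm (even_pow_ge0 z k)) mulrA ler_wpM2r ?even_pow_ge0.
- by have := @is_cvg_seriesZ R _ eta (ecoef_cvg z).
Qed.

Lemma pser_cvg (al : nat -> R) (z eta : R) : (forall k, `|al k| <= eta * ecoef k) ->
  cvgn (series (fun k => al k * z ^+ (2 * k))).
Proof. by move=> H; apply: normed_cvg; exact: pser_normed_cvg H. Qed.

Lemma pser_partial_le (al : nat -> R) (z eta : R) n : (forall k, `|al k| <= eta * ecoef k) ->
  `|series (fun k => al k * z ^+ (2 * k)) n| <= eta * pser ecoef z.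
Proof.
move=> H; have e0 : 0 <= eta.
  by have := le_trans (normr_ge0 _) (H 0%N); rewrite pmulr_lge0// ecoef_gt0.
apply: (@le_trans _ _ (eta * series (fun k => ecoef k * z ^+ (2 * k)) n)).
  rewrite /series /= mulr_sumr; apply: (le_trans (ler_norm_sum _ _ _)).
  apply: ler_sum => k _; rewrite normrM (ger0_norm (even_pow_ge0 z k)) mulrA.
  by rewrite ler_wpM2r ?even_pow_ge0.
rewrite ler_wpM2l//; apply: nondecreasing_cvgn_le; last exact: ecoef_cvg.
apply/nondecreasing_seqP => k; rewrite seriesSr lerDl.
by rewrite mulr_ge0 ?even_pow_ge0 ?ltW ?ecoef_gt0.
Qed.

Lemma pser_le (al : nat -> R) (z eta : R) : (forall k, `|al k| <= eta * ecoef k) ->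
  `|pser al z| <= eta * pser ecoef z.
Proof.
move=> H; have cv := pser_cvg al z eta H.
have lim : `|series (fun k => al k * z ^+ (2 * k)) n| @[n --> \oo] --> `|pser al z|.
  exact: cvg_norm.
apply: (@ler_cvg_to _ _ _ _ _ _ _ _ lim (cvg_cst (eta * pser ecoef z))).
by apply: nearW => n; exact: pser_partial_le.
Qed.

Lemma pserD (al be : nat -> R) (z eta eta' : R) : (forall k, `|al k| <= eta * ecoef k) ->
  (forall k, `|be k| <= eta' * ecoef k) ->
  pser (fun k => al k + be k) z = pser al z + pser be z.
Proof.
move=> Ha Hb; rewrite /pser -(lim_seriesD (pser_cvg _ _ _ Ha) (pser_cvg _ _ _ Hb)).
by congr (limn (series _)); apply/funext => k /=; rewrite mulrDl.
Qed.

Lemma pserZ (al : nat -> R) (z eta c : R) : (forall k, `|al k| <= eta * ecoef k) ->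
  pser (fun k => c * al k) z = c * pser al z.
Proof.
move=> Ha; rewrite /pser -[RHS](lim_seriesZ c (pser_cvg _ _ _ Ha)).
by congr (limn (series _)); apply/funext => k /=; rewrite -mulrA.
Qed.

Lemma pser_scale (al : nat -> R) (z c : R) :
  pser al (z * c) = pser (fun k => al k * c ^+ (2 * k)) z.
Proof.
by congr (limn (series _)); apply/funext => k; rewrite exprMn; ring.
Qed.

Lemma measurable_pser (al : nat -> R) (eta : R) : (forall k, `|al k| <= eta * ecoef k) ->
  measurable_fun setT (pser al).
Proof.
move=> H; apply: (@measurable_fun_cvg _ _ R setT (fun n (z : R) => series (fun k => al k * z ^+ (2 * k)) n)).
  move=> n; rewrite /series /=; apply: measurable_sum => k.
  by apply: measurable_funM => //; exact: measurable_funX.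
by move=> z _; exact: pser_cvg H.
Qed.

(** Writing x = z (x / z), each surviving term gains (x / z)^(2k) <= (x / z)^(2w). This supplies the
    crude bound from which the bootstrap for [phat] starts. *)
Lemma pser_vanishing_order (al : nat -> R) (eta : R) (w : nat) (x z : R) :
  (forall k, `|al k| <= eta * ecoef k) -> (forall k, (k <= w)%N -> al k = 0) ->
  0 < x -> x <= z -> `|pser al x| <= (x / z) ^+ (2 * w) * (eta * pser ecoef z).
Proof.
move=> H H0 x0 xz; have z0 : 0 < z by exact: lt_le_trans xz.
have r0 : 0 <= x / z by rewrite divr_ge0// ltW.
have r1 : x / z <= 1 by rewrite ler_pdivrMr// mul1r.
have -> : x = z * (x / z) by field; rewrite gt_eqF.
rewrite pser_scale.
have -> : z * (x / z) / z = x / z by field; rewrite gt_eqF.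
rewrite mulrA; apply: pser_le => k; rewrite normrM (ger0_norm (even_pow_ge0 _ _)).
have e0 : 0 <= eta * ecoef k by exact: le_trans (H k).
have [kw|wk] := leqP k w.
  by rewrite H0// normr0 mul0r -mulrA mulr_ge0 ?even_pow_ge0.
rewrite -mulrA mulrC ler_pM ?even_pow_ge0//.
by apply: ler_wiXn2l => //; rewrite leq_mul2l ltnW.
Qed.

End PowerSeries.

Section AlternatingSeries.
Context {R : realType}.
Local Notation mu := (@lebesgue_measure R).
Variable m : nat.

(* m stands for w - 1. *)
Definition K_coef (k : nat) : R := (m.+2 <= k)%N%:R * (-1) ^+ (m + k) * ecoef k.

Lemma K_coef_le k : `|K_coef k| <= 1 * ecoef k.
Proof.
rewrite /K_coef !normrM normrX normrN1 expr1n mulr1 (gtr0_norm (ecoef_gt0 k)).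
by apply: ler_wpM2r; [exact/ltW/ecoef_gt0|rewrite normr_nat lern1 leq_b1].
Qed.

Lemma K_coef_eq0 k : (k <= m.+1)%N -> K_coef k = 0.
Proof. by move=> h; rewrite /K_coef leqNgt ltnS h !mul0r. Qed.

Definition K_fun (z : R) : R := pser K_coef z.

(** Chosen so that b + 1 + 2i = 2 (m + i) + 5/4: the Beta moment of degree 2i then has in its
    denominator the Gamma value of the coefficient of index m + i. *)
Definition K_exponent : R := (2 * m)%:R + 1 / 4.

Lemma K_exponent_gt0 : 0 < K_exponent.
Proof. by rewrite /K_exponent ltr_wpDl. Qed.

Lemma measurable_cos_rem : measurable_fun setT (@cos_rem R).
Proof.
rewrite /cos_rem; apply: measurable_funD; last by apply: continuous_measurable_fun; exact: continuous_cos.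
by apply: measurable_funD => //; apply: measurable_funM => //; exact: measurable_funX.
Qed.

Lemma measurable_cos_rem_scale (z : R) : measurable_fun setT (fun v : R => cos_rem (z * v)).
Proof.
apply: (measurableT_comp measurable_cos_rem); exact: measurable_funM.
Qed.

Lemma beta_pow_integrable (b : R) n : 0 < b ->
  mu.-integrable setT (EFin \o (fun v => v ^+ n * beta_weight b v)).
Proof.
move=> b0; have mX : measurable_fun setT (fun v : R => v ^+ n) by exact: measurable_funX.
apply: (beta_moment_integrable b _ b0 mX) => v /andP[v0 v1].
by rewrite normrX (ger0_norm (ltW v0)); apply: exprn_ile1; exact: ltW.
Qed.

(** The factorial in the cosine series cancels against the one in the Beta moment, so only the Gamma
    factors remain. *)
Lemma K_integral_term (z : R) i :
  mu.-integrable setT (EFin \o (fun v => cos_rem_coeff (z * v) i * beta_weight K_exponent v)) /\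
  \int[mu]_v (cos_rem_coeff (z * v) i * beta_weight K_exponent v) =
  (2 <= i)%N%:R * (-1) ^+ i * z ^+ (2 * i) * (gam K_exponent * ecoef (m + i)).
Proof.
have b0 := K_exponent_gt0.
have E v : cos_rem_coeff (z * v) i * beta_weight K_exponent v =
   ((2 <= i)%N%:R * (-1) ^+ i * z ^+ (2 * i) / (2 * i)`!%:R) * (v ^+ (2 * i) * beta_weight K_exponent v).
  by rewrite /cos_rem_coeff /cos_coeff' -exprnP exprMn -mul2n; ring.
have iv : mu.-integrable setT (EFin \o (fun v => v ^+ (2 * i) * beta_weight K_exponent v)).
  exact: beta_pow_integrable.
split.
  rewrite (_ : (fun v => _) = fun v => ((2 <= i)%N%:R * (-1) ^+ i * z ^+ (2 * i) / (2 * i)`!%:R) * (v ^+ (2 * i) * beta_weight K_exponent v)).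
    exact: integrable_scaleR.
  by apply/funext => v; rewrite E.
transitivity (\int[mu]_v (((2 <= i)%N%:R * (-1) ^+ i * z ^+ (2 * i) / (2 * i)`!%:R) * (v ^+ (2 * i) * beta_weight K_exponent v))).
  by apply: eq_Rintegral => v _; rewrite E.
rewrite RintegralZl// beta_moment//; last by rewrite mul2n odd_double.
have -> : K_exponent + 1 + (2 * i)%:R = (2 * (m + i))%:R + 5 / 4.
  by rewrite /K_exponent mulnDr natrD; field.
rewrite /ecoef; have f0 : (2 * i)`!%:R != 0 :> R by rewrite pnatr_eq0 -lt0n fact_gt0.
have g0 : gam ((2 * (m + i))%:R + 5 / 4) != 0 :> R by rewrite gt_eqF// gam_gt0// ecoef_arg_gt0.
by field; rewrite f0 g0.
Qed.

Lemma K_repr (z : R) : K_fun z = z ^+ (2 * m) / gam K_exponent *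
  \int[mu]_v (cos_rem (z * v) * beta_weight K_exponent v).
Proof.
have b0 := K_exponent_gt0.
have gb0 : gam K_exponent != 0 by rewrite gt_eqF// gam_gt0.
have [||||||_ lim] := @cvg_integral_series R
  (fun i v => cos_rem_coeff (z * v) i * beta_weight K_exponent v)
  (fun v => cos_rem (z * v) * beta_weight K_exponent v)
  (fun v => expR (z ^+ 2) * beta_weight K_exponent v).
- move=> i; have [/integrableP[mf _] _] := K_integral_term z i.
  exact/measurable_EFinP.
- apply: measurable_funM; [exact: measurable_cos_rem_scale|exact: measurable_beta_weight].
- by move=> i; have [] := K_integral_term z i.
- move=> v; rewrite (_ : series _ = (fun n => series (cos_rem_coeff (z * v)) n * beta_weight K_exponent v)).
    by apply: cvgM; [exact: cos_rem_series|exact: cvg_cst].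
  by apply/funext => n; rewrite /series /= mulr_suml.
- by apply: integrable_scaleR => //; exact: beta_weight_integrable.
- move=> v n; rewrite (_ : series _ n = series (cos_rem_coeff (z * v)) n * beta_weight K_exponent v); last first.
    by rewrite /series /= mulr_suml.
  rewrite normrM (ger0_norm (beta_weight_ge0 _ v)).
  have [v0|v0] := leP v 0; first by rewrite beta_weight_support ?mulr0//; left.
  have [v1|v1] := leP 1 v; first by rewrite beta_weight_support ?mulr0//; right.
  rewrite ler_wpM2r ?beta_weight_ge0// (le_trans (norm_cos_rem_series _ _))// ler_expR.
  by rewrite exprMn ler_piMr ?sqr_ge0// exprn_ile1// ltW.
set I := \int[mu]_v (cos_rem (z * v) * _) in lim *.
have lim2 : z ^+ (2 * m) / gam K_exponent * series (fun n => \int[mu]_x (cos_rem_coeff (z * x) n * beta_weight K_exponent x)) n @[n --> \oo] --> z ^+ (2 * m) / gam K_exponent * I.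
  by apply: cvgM => //; exact: cvg_cst.
(* Index k = m + i: the first m terms of the series vanish, and the sign (-1)^(m + k) becomes the
   sign (-1)^i of the cosine series. *)
apply/cvg_lim => //; rewrite -(cvg_shiftn m) /=.
apply: cvg_trans lim2; apply: near_eq_cvg; apply: nearW => n.
rewrite /series /= (addnC n m) /index_iota !subn0 iotaD big_cat /= add0n.
rewrite [X in _ = X + _]big1_seq ?add0r; last first.
  move=> k /=; rewrite mem_iota add0n => /andP[_ km].
  by rewrite K_coef_eq0 ?mul0r// ltnW// ltnW.
have -> : iota m n = map (addn m) (iota 0 n) by rewrite -iotaDl addn0.
rewrite big_map mulr_sumr; apply: eq_bigr => i _.
have [_ ->] := K_integral_term z i.
have sg : (-1) ^+ (m + (m + i)) = (-1) ^+ i :> R.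
  by rewrite addnA addnn exprD -mul2n exprM sqrrN !expr1n mul1r.
have le2 : (m.+2 <= m + i)%N = (2 <= i)%N by rewrite -(leq_add2l m 2) addn2.
by rewrite /K_coef sg le2 mulnDr exprD; field.
Qed.

Lemma beta_cos_rem_integrable (z : R) :
  mu.-integrable setT (EFin \o (fun v => cos_rem (z * v) * beta_weight K_exponent v)).
Proof.
apply: integrable_dominated (integrable_scaleR _ _ mu setT measurableT (z ^+ 2 / 2) _ (beta_weight_integrable _ K_exponent_gt0)).
  by apply: measurable_funM; [exact: measurable_cos_rem_scale|exact: measurable_beta_weight].
move=> v; rewrite normrM (ger0_norm (beta_weight_ge0 _ v)) (ger0_norm (cos_rem_ge0 _)).
have [v0|v0] := leP v 0; first by rewrite beta_weight_support ?mulr0//; left.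
have [v1|v1] := leP 1 v; first by rewrite beta_weight_support ?mulr0//; right.
rewrite ler_wpM2r ?beta_weight_ge0// (le_trans (cos_rem_le2 _))//.
by rewrite ler_wpM2r// exprMn ler_piMr ?sqr_ge0// exprn_ile1// ltW.
Qed.

Lemma K_gt0 (z : R) : 0 < z -> 0 < K_fun z.
Proof.
move=> z0; have b0 := K_exponent_gt0.
rewrite K_repr mulr_gt0 ?divr_gt0 ?exprn_gt0 ?gam_gt0//.
(* Strict positivity comes from an explicit minorant with positive fourth Beta moment. Capping z at
   1 allows the lower bound x^4 / 48 for small arguments, and almost monotonicity carries it from z1
   v to z v at the cost of a factor 2, whence 96. *)
pose z1 := Num.min z 1; have z10 : 0 < z1 by rewrite /z1 lt_min z0 ltr01.
have z1z : z1 <= z by rewrite /z1 ge_min lexx.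
have z11 : z1 <= 1 by rewrite /z1 ge_min lexx orbT.
have low v : 0 < v < 1 -> z1 ^+ 4 / 96 * v ^+ 4 <= cos_rem (z * v).
  move=> /andP[v0 v1]; have zv : z1 * v <= z * v by apply: ler_wpM2r => //; exact: ltW.
  have p0 : 0 < z1 * v by rewrite mulr_gt0.
  have z1v : z1 * v <= 1 by apply: le_trans (ltW v1); rewrite ler_piMl// ltW.
  have h1 := cos_rem_almost_increasing _ _ p0 zv.
  have h2 : (z1 * v) ^+ 4 / 48 <= cos_rem (z1 * v) by apply: cos_rem_ge_small; [exact: ltW|nra].
  have s1 : 0 < (z1 * v) ^+ 2 by rewrite exprn_gt0.
  have s2 : (z1 * v) ^+ 2 <= (z * v) ^+ 2 by rewrite lerXn2r ?nnegrE ?(ltW p0) ?(le_trans (ltW p0) zv).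
  have h3 : cos_rem (z1 * v) * (z1 * v) ^+ 2 <= 2 * cos_rem (z * v) * (z1 * v) ^+ 2.
    by apply: le_trans h1; rewrite ler_wpM2l// cos_rem_ge0.
  rewrite ler_pM2r// in h3.
  have -> : z1 ^+ 4 / 96 * v ^+ 4 = (z1 * v) ^+ 4 / 48 / 2 by rewrite exprMn; field.
  lra.
have mom := beta_moment K_exponent 4 b0 isT.
have M0 : 0 < \int[mu]_v (z1 ^+ 4 / 96 * (v ^+ 4 * beta_weight K_exponent v)).
  rewrite RintegralZl//; last first.
    exact: beta_pow_integrable.
  have g1 : 0 < gam (K_exponent + 1 + 4%:R) by apply: gam_gt0; lra.
  have g2 := gam_gt0 _ b0.
  by rewrite mom mulr_gt0 ?divr_gt0 ?mulr_gt0 ?exprn_gt0 ?ltr0n ?fact_gt0.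
apply: (lt_le_trans M0); apply: le_Rintegral => //.
- apply: integrable_scaleR => //.
  exact: beta_pow_integrable.
- exact: beta_cos_rem_integrable.
move=> v _; rewrite mulrA.
have [v0|v0] := leP v 0; first by rewrite beta_weight_support ?mulr0//; left.
have [v1|v1] := leP 1 v; first by rewrite beta_weight_support ?mulr0//; right.
by rewrite ler_wpM2r ?beta_weight_ge0// low// v0 v1.
Qed.

Lemma K_almost_increasing (x z : R) : 0 < x -> x <= z ->
  K_fun x * z ^+ (2 * m.+1) <= 2 * K_fun z * x ^+ (2 * m.+1).
Proof.
move=> x0 xz; have z0 : 0 < z by exact: lt_le_trans xz.
rewrite !K_repr; set Ix := \int[mu]_v _; set Iz := \int[mu]_v _.
have key : Ix * z ^+ 2 <= 2 * Iz * x ^+ 2.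
  rewrite -RintegralZr//; last exact: beta_cos_rem_integrable.
  rewrite [2 * Iz * _]mulrAC -RintegralZl//; last exact: beta_cos_rem_integrable.
  apply: le_Rintegral => //.
  - rewrite (_ : (fun v => _) = (fun v => z ^+ 2 * (cos_rem (x * v) * beta_weight K_exponent v))).
      by apply: integrable_scaleR => //; exact: beta_cos_rem_integrable.
    by apply/funext => v; rewrite mulrC.
  - by apply: integrable_scaleR => //; exact: beta_cos_rem_integrable.
  move=> v _.
  have [v0|v0] := leP v 0; first by rewrite beta_weight_support ?(mulr0, mul0r)//; left.
  rewrite mulrAC [leRHS]mulrA ler_wpM2r ?beta_weight_ge0//.
  have xv : x * v <= z * v by rewrite ler_wpM2r// ltW.
  have h := cos_rem_almost_increasing _ _ (mulr_gt0 x0 v0) xv.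
  by rewrite -(ler_pM2r (exprn_gt0 2 v0)); rewrite !exprMn in h; lra.
have g0 : 0 < gam K_exponent by rewrite gam_gt0// K_exponent_gt0.
have -> : x ^+ (2 * m) / gam K_exponent * Ix * z ^+ (2 * m.+1) =
   x ^+ (2 * m) * z ^+ (2 * m) / gam K_exponent * (Ix * z ^+ 2).
  by rewrite mulnS exprD; ring.
have -> : 2 * (z ^+ (2 * m) / gam K_exponent * Iz) * x ^+ (2 * m.+1) =
   x ^+ (2 * m) * z ^+ (2 * m) / gam K_exponent * (2 * Iz * x ^+ 2).
  by rewrite mulnS exprD; ring.
by rewrite ler_wpM2l// !mulr_ge0 ?invr_ge0 ?exprn_ge0 ?ltW.
Qed.

End AlternatingSeries.

(** * The Gamma average of K *)

Section KernelLaw.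
Context {R : realType}.
Local Notation mu := (@lebesgue_measure R).

(** The real part of the transform 1 / c of the half-line at c = 1 + ix; the added 1 keeps the
    integrand nonnegative. *)
Lemma integral_cos_gamma_weight (x : R) :
  (\int[mu]_s ((1 + cos (x * s)) * gamma_weight s)%:E = (1 + (1 + x ^+ 2)^-1)%:E)%E.
Proof.
pose c : R[i] := 1 +i* x.
have c0 : 0 < Re c by rewrite /= ltr01.
have dom := step_dom _ c0.
have iM : mu.-integrable setT (EFin \o (fun y => expR (Re c * - y) * step y)) by case: dom.
have iC := Laplace_cos_integrable _ _ _ x dom.
have V1 : \int[mu]_y (expR (Re c * - y) * step y) = 1.
  by apply: EFin_inj; rewrite -integral_EFin_Rintegral// integral_step// invr1.
have V2 : \int[mu]_y (expR (Re c * - y) * cos (x * - y) * step y) = (1 + x ^+ 2)^-1.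
  have := congr1 Re (Laplace_step _ c0).
  by rewrite Re_Laplace /= => ->; rewrite expr1n mul1r.
transitivity (\int[mu]_y (expR (Re c * - y) * step y + expR (Re c * - y) * cos (x * - y) * step y)%:E)%E.
  have mf : measurable_fun setT (fun y : R => (1 + cos (x * y)) * expR (- y)).
    apply: measurable_funM; last by meas.
    by apply: measurable_funD => //; apply: measurable_cosR; exact: measurable_funM.
  transitivity (\int[mu]_y ((1 + cos (x * y)) * expR (- y) * step y)%:E)%E.
    rewrite integral_step_oo//; apply: eq_integral => y _; congr EFin.
    by rewrite /gamma_weight /stepo; ring.
  by apply: eq_integral => y _; congr EFin; rewrite /= mul1r mulrN cosN; ring.
rewrite integral_EFin_Rintegral; last exact: integrable_addR.
by rewrite RintegralD// V1 V2.
Qed.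

Lemma integral_cos_rem_gamma (x : R) :
  (\int[mu]_s (cos_rem (x * s) * gamma_weight s)%:E = (x ^+ 4 / (1 + x ^+ 2))%:E)%E.
Proof.
have mg := @measurable_gamma_weight R.
have mX : measurable_fun setT (fun s : R => s ^+ 2) by exact: measurable_funX.
have mc := measurable_cos_rem_scale x.
have g3 : (\int[mu]_s (s ^+ 2 * gamma_weight s)%:E = 2%:E)%E.
  have -> : 2%:E = (gam (1 + 2%:R : R))%:E by rewrite addrC gam_fact.
  rewrite -gam_pow//; apply: eq_integral => s _.
  by rewrite subrr mul0r expR0 mulr1.
have g1 : (\int[mu]_s (gamma_weight s)%:E = 1%:E)%E.
  rewrite -gam1 /gam -integral_EFin_Rintegral; last exact: gam_integrable.
  by apply: eq_integral => s _; rewrite subrr mul0r expR0 mul1r.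
have x1 : 1 + x ^+ 2 != 0 by rewrite gt_eqF// ltr_wpDr// sqr_ge0.
have gw0 := @gamma_weight_ge0 R.
(* cos_rem (xs) + 2 = x^2 s^2 / 2 + (1 + cos (xs)) keeps every term nonnegative *)
have E : (\int[mu]_s (cos_rem (x * s) * gamma_weight s)%:E + \int[mu]_s (2 * gamma_weight s)%:E =
   \int[mu]_s (x ^+ 2 / 2 * (s ^+ 2 * gamma_weight s))%:E + \int[mu]_s ((1 + cos (x * s)) * gamma_weight s)%:E)%E.
  have mcos : measurable_fun setT (fun y : R => (1 + cos (x * y))).
    by apply: measurable_funD => //; apply: measurable_cosR; exact: measurable_funM.
  have c0 s : 0 <= 1 + cos (x * s) by rewrite -lerBlDl sub0r cos_geN1.
  rewrite -!ge0_integralD//=.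
  - apply: eq_integral => s _; rewrite -!EFinD; congr EFin.
    by rewrite /cos_rem exprMn; field.
  - by move=> s _; rewrite lee_fin mulr_ge0// ?divr_ge0 ?sqr_ge0// mulr_ge0 ?sqr_ge0.
  - by apply/measurable_EFinP; apply: measurable_funM => //; exact: measurable_funM.
  - by move=> s _; rewrite lee_fin mulr_ge0.
  - by apply/measurable_EFinP; apply: measurable_funM.
  - by move=> s _; rewrite lee_fin mulr_ge0 ?cos_rem_ge0.
  - by apply/measurable_EFinP; apply: measurable_funM.
  - by move=> s _; rewrite lee_fin mulr_ge0.
  - by apply/measurable_EFinP; apply: measurable_funM.
rewrite integral_cos_gamma_weight in E.
rewrite (ge0_integralZlR 2) // in E.
rewrite ge0_integralZlR in E.
2: by rewrite divr_ge0 ?sqr_ge0.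
2: exact: measurable_funM.
2: by move=> s; rewrite mulr_ge0 ?sqr_ge0.
rewrite g3 g1 -!EFinM -!EFinD mulr1 in E.
have -> : x ^+ 4 / (1 + x ^+ 2) = x ^+ 2 / 2 * 2 + (1 + (1 + x ^+ 2)^-1) - 2.
  by rewrite (exprD x 2 2); field.
by rewrite EFinB -E addeK.
Qed.

Lemma measurable_inner_integral (f : R -> R -> R) :
  measurable_fun setT (fun z : R * R => f z.1 z.2) -> (forall x y, 0 <= f x y) ->
  measurable_fun setT (fun x => \int[mu]_y (f x y)%:E)%E.
Proof.
move=> mf f0.
apply: (@measurable_fun_fubini_tonelli_F _ _ (measurableTypeR R) (measurableTypeR R) R mu
  (fun z => (f z.1 z.2)%:E)).
  by apply/measurable_EFinP.
by move=> z; rewrite lee_fin.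
Qed.

Variable m : nat.

(** The factor t^(2m) from the integral representation of K and the kernel's t^(1/4) combine to t^b
    with b = [K_exponent], exactly the density that makes tv exponentially distributed. What remains
    is the average of c(xs) against e^(-s). *)
Lemma K_law (x : R) : 0 < x ->
  (\int[mu]_t (expR (1 / 4 * ln t) * gamma_weight t * K_fun m (x * t))%:E =
   (x ^+ (2 * m + 4) / (1 + x ^+ 2))%:E)%E.
Proof.
move=> x0; have b0 := K_exponent_gt0 m : 0 < K_exponent m :> R.
have g0 := gam_gt0 _ b0; have mg := @measurable_gamma_weight R.
have mb := measurable_beta_weight (K_exponent m : R).
pose h s := cos_rem (x * s).
have mh : measurable_fun setT h by exact: measurable_cos_rem_scale.
have h0 s : 0 <= h s by exact: cos_rem_ge0.
have law := beta_law _ h b0 mh h0.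
pose F t v := h (t * v) * (gamma_weight t * expR (K_exponent m * ln t) * beta_weight (K_exponent m) v).
have F0 t v : 0 <= F t v by rewrite /F mulr_ge0// mulr_ge0 ?beta_weight_ge0// mulr_ge0 ?expR_ge0 ?gamma_weight_ge0.
have mF : measurable_fun setT (fun z : R * R => F z.1 z.2) by rewrite /F; meas.
transitivity (\int[mu]_t ((x ^+ (2 * m) / gam (K_exponent m))%:E * \int[mu]_v (F t v)%:E))%E.
  apply: eq_integral => t _; have [t0|t0] := ltP 0 t; last first.
    rewrite [X in (_ * X)%E]integral0_eq; last first.
      by move=> v _; rewrite /F /gamma_weight stepoE ltNge t0 /= !(mul0r, mulr0).
    by rewrite mule0 /gamma_weight stepoE ltNge t0 /= !(mul0r, mulr0).
  have -> : (\int[mu]_v (F t v)%:E = \int[mu]_v (gamma_weight t * expR (K_exponent m * ln t) * (cos_rem (x * t * v) * beta_weight (K_exponent m) v))%:E)%E.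
    by apply: eq_integral => v _; rewrite /F /h (mulrA x); congr EFin; ring.
  rewrite integral_EFin_Rintegral; last by apply: integrable_scaleR => //; exact: beta_cos_rem_integrable.
  rewrite RintegralZl//; last exact: beta_cos_rem_integrable.
  rewrite -EFinM K_repr; congr EFin.
  have -> : expR (K_exponent m * ln t) = t ^+ (2 * m) * expR (1 / 4 * ln t).
    by rewrite -{2}(expR_ln t t0) -expRM_natl -expRD; congr expR; rewrite /K_exponent; ring.
  by rewrite exprMn; ring.
rewrite ge0_integralZl//=; last 3 first.
- exact: measurable_inner_integral.
- by move=> t _; apply: integral_ge0 => v _; rewrite lee_fin.
- by rewrite lee_fin divr_ge0 ?even_pow_ge0 ?ltW.
rewrite law integral_cos_rem_gamma -!EFinM; congr EFin; rewrite exprD; field.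
by rewrite gt_eqF ?gt_eqF// ltr_wpDr// sqr_ge0.
Qed.

End KernelLaw.

(** * Restoring the zeta factor *)

Section RealZeta.
Context {R : realType}.

Definition zpart (x : R) (N : nat) : R := \sum_(1 <= n < N) expR (- (x * ln n%:R)).

Definition zt (x : R) : R := limn (zpart x).

(** For n = k + 2, n^(-x) <= n^(-4) <= 1 / (4 n (n - 1)), by n^2 >= 4 (n - 1). The telescoping form
    makes every tail of the Dirichlet series explicit and is the source of zeta - 1 <= 1/4. *)
Lemma zterm_le (x : R) k : 4 <= x ->
  expR (- (x * ln k.+2%:R)) <= 1 / 4 * (k.+1%:R^-1 - k.+2%:R^-1).
Proof.
move=> x4; have n0 : 0 < k.+2%:R :> R by rewrite ltr0n.
have n1 : 0 < k.+1%:R :> R by rewrite ltr0n.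
have ln0 : 0 <= ln k.+2%:R :> R by rewrite ln_ge0// ler1n.
apply: (@le_trans _ _ (expR (- (4%:R * ln k.+2%:R)))).
  by rewrite ler_expR lerN2 ler_wpM2r.
rewrite expRN expRM_natl expR_ln//.
have -> : 1 / 4 * (k.+1%:R^-1 - k.+2%:R^-1) = (4 * (k.+1%:R * k.+2%:R))^-1 :> R.
  have e2 : k.+2%:R = k.+1%:R + 1 :> R by rewrite natr1.
  by rewrite e2 in n0 *; field; rewrite !gt_eqF.
rewrite lef_pV2 ?posrE ?exprn_gt0 ?mulr_gt0//.
have e2 : k.+2%:R = k.+1%:R + 1 :> R by rewrite natr1.
have e1 : 1 <= k.+1%:R :> R by rewrite ler1n.
rewrite e2 (exprD _ 2 2); nra.
Qed.

Lemma zpartS (x : R) N : zpart x N.+2 = zpart x N.+1 + expR (- (x * ln N.+1%:R)).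
Proof. by rewrite /zpart big_nat_recr. Qed.

Lemma zpart2 (x : R) : zpart x 2 = 1.
Proof. by rewrite /zpart big_nat1 ln1 mulr0 oppr0 expR0. Qed.

Lemma zpart_tail (x : R) N d : 4 <= x ->
  0 <= zpart x (N.+2 + d) - zpart x N.+2 <= 1 / 4 * (N.+1%:R^-1 - (N + d).+1%:R^-1).
Proof.
move=> x4; elim: d => [|d /andP[IH1 IH2]]; first by rewrite !addn0 !subrr mulr0 lexx.
have e := expR_ge0 (- (x * ln (N + d).+2%:R)).
have t := zterm_le x (N + d) x4.
have E : zpart x (N.+2 + d.+1) = zpart x (N.+2 + d) + expR (- (x * ln (N + d).+2%:R)).
  by rewrite addnS !addSn zpartS.
rewrite E addnS; apply/andP; split; first by rewrite addrAC addr_ge0.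
rewrite addrAC; apply: le_trans (lerD IH2 t) _; rewrite -mulrDr; apply: ler_wpM2l => //.
by rewrite addrA subrK.
Qed.

Lemma zpart_nd (x : R) : nondecreasing_seq (zpart x).
Proof.
apply/nondecreasing_seqP => -[|n]; first by rewrite /zpart !big_geq.
by rewrite /zpart [leRHS]big_nat_recr//= lerDl expR_ge0.
Qed.

Lemma zpart_cvg (x : R) : 4 <= x -> cvgn (zpart x).
Proof.
move=> x4; apply: nondecreasing_is_cvgn; first exact: zpart_nd.
exists (1 + 1 / 4) => _ [n _ <-].
have := zpart_nd x n (2 + n)%N (leq_addl 2 n); have := zpart_tail x 0 n x4.
rewrite zpart2 invr1 => /andP[_ h] h'.
apply: le_trans h' _; rewrite -lerBlDl; apply: le_trans h _.
by rewrite -[leRHS]mulr1; apply: ler_wpM2l => //; rewrite gerBl.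
Qed.

Lemma zt_ge_zpart (x : R) N : 4 <= x -> zpart x N <= zt x.
Proof. by move=> x4; apply: nondecreasing_cvgn_le; [exact: zpart_nd|exact: zpart_cvg]. Qed.

Lemma zt_ge1 (x : R) : 4 <= x -> 1 <= zt x.
Proof. by move=> x4; rewrite -(zpart2 x) zt_ge_zpart. Qed.

Lemma zt_tail (x : R) N : 4 <= x -> zt x - zpart x N.+2 <= 1 / 4 * N.+1%:R^-1.
Proof.
move=> x4; rewrite lerBlDr; apply: limr_le; first exact: zpart_cvg.
exists N.+2 => // n /= /subnKC <-; rewrite -lerBlDr.
have /andP[_ h] := zpart_tail x N (n - N.+2) x4; apply: le_trans h _.
by apply: ler_wpM2l => //; rewrite gerBl.
Qed.

End RealZeta.

(** * Dividing the coefficients by zeta, and the bootstrap *)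

Section ZetaQuotient.
Context {R : realType}.
Variable m : nat.
Local Notation K_coef := (K_coef m).
Local Notation K_fun := (K_fun m).

Lemma le_of_le_harmonic (a b c : R) : (forall n, a <= b + c * n.+1%:R^-1) -> a <= b.
Proof.
move=> H; have lim : (b + c * n.+1%:R^-1) @[n --> \oo] --> b.
  rewrite -[X in _ --> X]addr0 -(mulr0 c); apply: cvgD; first exact: cvg_cst.
  by apply: cvgMr; exact: (@cvg_harmonic R).
by apply: (@ler_cvg_to _ _ _ _ _ _ _ _ (cvg_cst a) lim); apply: nearW.
Qed.

Lemma zpart_ge0 (x : R) N : 0 <= zpart x N.
Proof. by apply: sumr_ge0 => n _; exact: expR_ge0. Qed.

Definition zeta_arg (k : nat) : R := (4 * k)%:R + 1 / 2.

Lemma zeta_arg_ge4 k : (1 <= k)%N -> 4 <= zeta_arg k.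
Proof.
move=> k1; rewrite /zeta_arg natrM.
have : 1 <= k%:R :> R by rewrite ler1n.
lra.
Qed.

Definition P_coef (k : nat) : R := K_coef k / zt (zeta_arg k).

Definition P_coef_part N (k : nat) : R := P_coef k * zpart (zeta_arg k) N.

Lemma P_coef_eq0 k : (k <= m.+1)%N -> P_coef k = 0.
Proof. by move=> km; rewrite /P_coef K_coef_eq0// mul0r. Qed.

(** Common form of the coefficient bounds of this section: the extra factor [y] is compared with
    [zt], and only for k >= m + 2, since below that index the coefficient is 0. *)
Lemma norm_P_coefM_le k (y d : R) : 0 <= y -> ((m.+2 <= k)%N -> y <= d * zt (zeta_arg k)) ->
  0 <= d -> `|P_coef k * y| <= d * ecoef k.
Proof.
move=> y0 H d0; have [km|mk] := leqP k m.+1.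
  by rewrite P_coef_eq0// mul0r normr0 mulr_ge0// ltW// ecoef_gt0.
have z1 := zt_ge1 _ (zeta_arg_ge4 k (ltn_trans (ltn0Sn _) mk)).
have z0 : 0 < zt (zeta_arg k) by exact: lt_le_trans z1.
rewrite /P_coef -mulrA normrM mulrC; apply: ler_pM => //.
  rewrite ger0_norm; last by rewrite mulr_ge0// invr_ge0 ltW.
  by rewrite mulrC ler_pdivrMr//; exact: H.
by rewrite -[leRHS]mul1r; exact: K_coef_le.
Qed.

Lemma P_coef_le k : `|P_coef k| <= 1 * ecoef k.
Proof.
rewrite -[X in `|X|]mulr1; apply: norm_P_coefM_le => // mk.
by rewrite mul1r zt_ge1// zeta_arg_ge4// (ltn_trans _ mk).
Qed.

Lemma P_coef_part_le N k : `|P_coef_part N k| <= 1 * ecoef k.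
Proof.
apply: norm_P_coefM_le => // [|mk]; first exact: zpart_ge0.
by rewrite mul1r zt_ge_zpart// zeta_arg_ge4// (ltn_trans _ mk).
Qed.

Definition phat (z : R) : R := pser P_coef z.

Definition phat_part N (z : R) : R :=
  \sum_(1 <= n < N) expR (- (1 / 2 * ln n%:R)) * phat (z * expR (- (2 * ln n%:R))).

Lemma phat_partS N z : phat_part N.+2 z = phat_part N.+1 z +
  expR (- (1 / 2 * ln N.+1%:R)) * phat (z * expR (- (2 * ln N.+1%:R))).
Proof. by rewrite /phat_part big_nat_recr. Qed.

(** On the coefficient of z^(2k), passing to n^(-1/2) phat(z / n^2) multiplies by n^(-1/2) n^(-4k) =
    n^(-(4k + 1/2)), the n-th term of the zeta value that was divided out. *)
Lemma phat_partE N z : phat_part N z = pser (P_coef_part N) z.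
Proof.
have base n : (n <= 1)%N -> phat_part n z = pser (P_coef_part n) z.
  move=> n1; have -> : P_coef_part n = (fun k => 0 * P_coef k).
    by apply/funext => k; rewrite /P_coef_part /zpart big_geq// mulr0 mul0r.
  by rewrite (pserZ _ _ 1 _ P_coef_le) mul0r /phat_part big_geq.
case: N => [|N]; first exact: base.
elim: N => [|N IH]; first exact: base.
rewrite phat_partS IH /phat pser_scale.
set c := expR (- (2 * _)); set e := expR _.
have c01 : 0 <= c <= 1.
  by rewrite expR_ge0 /c expR_le1 oppr_le0 mulr_ge0// ln_ge0// ?ler1n.
have cle k : `|P_coef k * c ^+ (2 * k)| <= 1 * ecoef k.
  have /andP[c0 c1] := c01.
  apply: norm_P_coefM_le => [||//]; first by rewrite exprn_ge0.
  move=> mk; rewrite mul1r (@le_trans _ _ 1)//; first by rewrite exprn_ile1.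
  by rewrite zt_ge1// zeta_arg_ge4// (ltn_trans _ mk).
rewrite -(pserZ _ _ 1 e cle) -(pserD _ _ _ 1 e).
- congr (pser _ z); apply/funext => k; rewrite /P_coef_part zpartS mulrDr; congr (_ + _).
  rewrite mulrCA; congr (_ * _); rewrite /e /c -expRM_natl -expRD; congr expR.
  by rewrite /zeta_arg !natrM; ring.
- exact: P_coef_part_le.
- move=> k; rewrite normrM ger0_norm ?expR_ge0//; apply: ler_wpM2l; rewrite ?expR_ge0//.
  by apply: le_trans (cle k) _; rewrite mul1r.
Qed.

(** An absolute error, measured by the majorant series, which is not controlled by K. It is good
    enough for passing to the limit at a fixed z; the version relative to K comes after
    positivity. *)
Lemma phat_part_close N z :
  `|K_fun z - phat_part N.+2 z| <= 1 / 4 * N.+1%:R^-1 * pser ecoef z.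
Proof.
have N0 : 0 <= 1 / 4 * N.+1%:R^-1 :> R by rewrite mulr_ge0.
have -> : K_fun z - phat_part N.+2 z = pser (fun k => P_coef k * (zt (zeta_arg k) - zpart (zeta_arg k) N.+2)) z.
  rewrite phat_partE -[X in _ + X]mulN1r -(pserZ _ _ 1 _ (P_coef_part_le _)).
  rewrite /K_fun -(pserD _ _ _ 1 1) => [||k]; last by rewrite normrM normrN1 !mul1r -[leRHS]mul1r; exact: P_coef_part_le.
  - congr (pser _ z); apply/funext => k; rewrite mulrBr mulN1r /P_coef_part; congr (_ - _).
    have [km|mk] := leqP k m.+1; first by rewrite P_coef_eq0// mul0r K_coef_eq0.
    have z1 := zt_ge1 _ (zeta_arg_ge4 k (ltn_trans (ltn0Sn _) mk)).
    by rewrite /P_coef divfK// gt_eqF// (lt_le_trans _ z1).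
  - exact: K_coef_le.
apply: pser_le => k; have [km|mk] := leqP k m.+1.
  by rewrite P_coef_eq0// mul0r normr0 mulr_ge0// ltW// ecoef_gt0.
have k4 := zeta_arg_ge4 k (ltn_trans (ltn0Sn _) mk).
apply: norm_P_coefM_le => // [|_]; first by rewrite subr_ge0 zt_ge_zpart.
by apply: le_trans (zt_tail _ _ k4) _; rewrite ler_peMr// zt_ge1.
Qed.

Lemma pow_arg_ge4 : 4 <= (4 * m.+1)%:R + 1 / 2 :> R.
Proof. exact: (zeta_arg_ge4 m.+1). Qed.

(* Only the terms n >= 2 of K = sum_n n^(-1/2) phat (z / n^2) separate K from phat, and
   they are of total relative size zeta (4w + 1/2) - 1 <= 1/4. *)
Lemma phat_improve (B z : R) : 0 < z ->
  (forall x, 0 < x -> x <= z -> `|phat x| <= B * x ^+ (2 * m.+1)) ->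
  forall x, 0 < x -> x <= z -> `|phat x - K_fun x| <= B / 4 * x ^+ (2 * m.+1).
Proof.
move=> z0 H x x0 xz.
have B0 : 0 <= B.
  have := le_trans (normr_ge0 _) (H z z0 (lexx _)).
  by rewrite pmulr_lge0// exprn_gt0.
have xw0 : 0 <= x ^+ (2 * m.+1) by rewrite even_pow_ge0.
have tail N : `|phat_part N.+2 x - phat x| <=
    B * x ^+ (2 * m.+1) * (zpart ((4 * m.+1)%:R + 1 / 2) N.+2 - 1).
  elim: N => [|N IH].
    rewrite zpart2 subrr mulr0 /phat_part big_nat1 ln1 !mulr0 oppr0 expR0 mul1r mulr1.
    by rewrite subrr normr0.
  rewrite phat_partS zpartS addrAC [X in _ <= _ * X]addrAC mulrDr.
  apply: le_trans (ler_normD _ _) _; apply: lerD => //.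
  rewrite normrM ger0_norm ?expR_ge0//.
  set c := expR (- (2 * _)).
  have c0 : 0 < c by exact: expR_gt0.
  have c1 : c <= 1 by rewrite /c expR_le1 oppr_le0 mulr_ge0// ln_ge0// ?ler1n.
  apply: (@le_trans _ _ (expR (- (1 / 2 * ln N.+2%:R)) * (B * (x * c) ^+ (2 * m.+1)))).
    apply: ler_wpM2l; rewrite ?expR_ge0//; apply: H; first exact: mulr_gt0.
    by apply: le_trans xz; rewrite ger_pMr.
  rewrite exprMn /c -[X in _ * (_ * (_ * X))]expRM_natl.
  have -> : - (((4 * m.+1)%:R + 1 / 2) * ln N.+2%:R) =
     - (1 / 2 * ln N.+2%:R) + (2 * m.+1)%:R * - (2 * ln N.+2%:R) :> R.
    by rewrite !natrM; ring.
  by rewrite expRD; rewrite le_eqVlt; apply/orP; left; apply/eqP; ring.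
apply: (@le_of_le_harmonic _ _ (1 / 4 * pser ecoef x)) => N.
have -> : phat x - K_fun x = (phat x - phat_part N.+2 x) - (K_fun x - phat_part N.+2 x) by ring.
apply: le_trans (ler_normB _ _) _; apply: lerD.
  rewrite distrC; apply: le_trans (tail N) _.
  have /andP[_] := zpart_tail _ 0 N pow_arg_ge4; rewrite zpart2 invr1 add2n => h.
  rewrite [leRHS]mulrAC; apply: ler_wpM2l; first exact: mulr_ge0.
  by apply: le_trans h _; rewrite -[leRHS]mul1r -[leRHS]mulr1; apply: ler_wpM2l => //; rewrite gerBl.
by apply: le_trans (phat_part_close N x) _; rewrite mulrAC.
Qed.

(** With kappa = K(z) / z^(2w), a bound B x^(2w) on |phat| over ]0, z] improves to (2 kappa + B/4)
    x^(2w). The fixed point of this map is 8 kappa / 3, and one last application leaves the error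
    (8/3) / 4 = 2/3, which is below 1. *)
Lemma phat_sandwich (z : R) : 0 < z -> `|phat z - K_fun z| <= 2 / 3 * K_fun z.
Proof.
move=> z0; have zw0 : 0 < z ^+ (2 * m.+1) by rewrite exprn_gt0.
pose kappa := K_fun z / z ^+ (2 * m.+1).
have k0 : 0 <= kappa by rewrite divr_ge0 ?ltW ?K_gt0.
have Kle x : 0 < x -> x <= z -> K_fun x <= 2 * kappa * x ^+ (2 * m.+1).
  move=> x0 xz; rewrite /kappa mulrA mulrAC ler_pdivlMr//.
  exact: K_almost_increasing.
pose B0 := 1 * pser ecoef z / z ^+ (2 * m.+1).
have step B : (forall x, 0 < x -> x <= z -> `|phat x| <= B * x ^+ (2 * m.+1)) ->
    forall x, 0 < x -> x <= z -> `|phat x| <= (2 * kappa + B / 4) * x ^+ (2 * m.+1).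
  move=> H x x0 xz; have h := phat_improve B z z0 H x x0 xz.
  have -> : phat x = K_fun x + (phat x - K_fun x) by ring.
  apply: le_trans (ler_normD _ _) _; rewrite mulrDl; apply: lerD => //.
  by rewrite ger0_norm ?Kle// ltW// K_gt0.
have bound n : forall x, 0 < x -> x <= z ->
    `|phat x| <= (8 / 3 * kappa + B0 / 4 ^+ n) * x ^+ (2 * m.+1).
  elim: n => [|n IH] x x0 xz.
    rewrite expr0 divr1 mulrDl -[leLHS]add0r; apply: lerD.
      by rewrite mulr_ge0 ?even_pow_ge0// mulr_ge0.
    apply: le_trans (pser_vanishing_order _ _ m.+1 _ _ P_coef_le P_coef_eq0 x0 xz) _.
    by rewrite /B0 expr_div_n le_eqVlt; apply/orP; left; apply/eqP; ring.
  have := step _ IH x x0 xz.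
  suff -> : 2 * kappa + (8 / 3 * kappa + B0 / 4 ^+ n) / 4 = 8 / 3 * kappa + B0 / 4 ^+ n.+1 by [].
  by rewrite exprSr; field; rewrite expf_neq0.
(* 4^n >= n + 1, so the excess over the fixed point is at most a constant times 1 / (n + 1). *)
have lim x : 0 < x -> x <= z -> `|phat x| <= 8 / 3 * kappa * x ^+ (2 * m.+1).
  move=> x0 xz; apply: (@le_of_le_harmonic _ _ (B0 * x ^+ (2 * m.+1))) => n.
  apply: le_trans (bound n x x0 xz) _; rewrite mulrDl lerD2l mulrAC.
  apply: ler_wpM2l.
    rewrite mulr_ge0 ?even_pow_ge0// divr_ge0 ?even_pow_ge0// mul1r.
    by have := le_trans (normr_ge0 _) (pser_le _ z _ P_coef_le); rewrite mul1r.
  rewrite lef_pV2 ?posrE ?exprn_gt0 ?ltr0n// -natrX ler_nat.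
  exact: ltn_expl.
have := phat_improve _ z z0 lim z z0 (lexx z).
suff -> : 8 / 3 * kappa / 4 * z ^+ (2 * m.+1) = 2 / 3 * K_fun z by [].
by rewrite /kappa; field; rewrite gt_eqF.
Qed.

Lemma phat_gt0 (z : R) : 0 < z -> 0 < phat z.
Proof.
move=> z0; have := phat_sandwich z z0; have := K_gt0 m _ z0.
rewrite ler_norml => ? /andP[]; lra.
Qed.

Lemma phat_le (z : R) : 0 < z -> phat z <= 5 / 3 * K_fun z.
Proof. by move=> z0; have := phat_sandwich z z0; rewrite ler_norml => /andP[]; lra. Qed.

(** The error is now relative to K with a factor independent of z, so it can be integrated against
    e^(sy). Constants: phat <= (5/3) K and the factor 2 of almost monotonicity give 10/3, and the
    zeta tail contributes 1/4. *)
Lemma phat_part_tail N z : 0 < z ->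
  `|K_fun z - phat_part N.+2 z| <= 5 / 6 * N.+1%:R^-1 * K_fun z.
Proof.
move=> z0; have K0 := ltW (K_gt0 m _ z0).
pose w4 : R := (4 * m.+1)%:R + 1 / 2.
have step n : `|phat_part (N.+2 + n) z - phat_part N.+2 z| <=
    10 / 3 * K_fun z * (zpart w4 (N.+2 + n) - zpart w4 N.+2).
  elim: n => [|n IH]; first by rewrite addn0 !subrr normr0 mulr0.
  rewrite addnS !addSn phat_partS zpartS addrAC [X in _ <= _ * X]addrAC mulrDr -!addSn.
  apply: le_trans (ler_normD _ _) _; apply: lerD => //.
  rewrite normrM ger0_norm ?expR_ge0//.
  set c := expR (- (2 * _)).
  have c0 : 0 < c by exact: expR_gt0.
  have c1 : c <= 1 by rewrite /c expR_le1 oppr_le0 mulr_ge0// ln_ge0// ?ler1n.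
  have zc0 : 0 < z * c by exact: mulr_gt0.
  have zc : z * c <= z by rewrite ger_pMr.
  rewrite ger0_norm; last by rewrite ltW// phat_gt0.
  have zw : 0 < z ^+ (2 * m.+1) by rewrite exprn_gt0.
  have Kc : K_fun (z * c) <= 2 * K_fun z * c ^+ (2 * m.+1).
    rewrite -(ler_pM2r zw); apply: le_trans (K_almost_increasing m _ _ zc0 zc) _.
    by rewrite exprMn mulrA mulrAC.
  apply: (@le_trans _ _ (expR (- (1 / 2 * ln (N + n).+2%:R)) * (10 / 3 * K_fun z * c ^+ (2 * m.+1)))).
    apply: ler_wpM2l; rewrite ?expR_ge0//; apply: le_trans (phat_le _ zc0) _.
    by apply: (@le_trans _ _ (5 / 3 * (2 * K_fun z * c ^+ (2 * m.+1)))); [exact: ler_wpM2l|lra].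
  rewrite /c -expRM_natl.
  have -> : - (w4 * ln (N + n).+2%:R) =
     - (1 / 2 * ln (N + n).+2%:R) + (2 * m.+1)%:R * - (2 * ln (N + n).+2%:R) :> R.
    by rewrite /w4 !natrM; ring.
  by rewrite expRD mulrCA.
apply: (@le_of_le_harmonic _ _ (1 / 4 * pser ecoef z)) => n.
have -> : K_fun z - phat_part N.+2 z =
  (K_fun z - phat_part (n + N).+2 z) + (phat_part (n + N).+2 z - phat_part N.+2 z) by ring.
apply: le_trans (ler_normD _ _) _; rewrite addrC; apply: lerD.
  have := step n; rewrite !addSn (addnC N) => h; apply: le_trans h _.
  have /andP[_] := zpart_tail _ N n pow_arg_ge4; rewrite !addSn (addnC N) => h.
  apply: (@le_trans _ _ (10 / 3 * K_fun z * (1 / 4 * N.+1%:R^-1))).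
    apply: ler_wpM2l; first by rewrite mulr_ge0.
    by apply: le_trans h _; apply: ler_wpM2l => //; rewrite gerBl.
  by rewrite le_eqVlt; apply/orP; left; apply/eqP; field; rewrite addrC natr1 pnatr_eq0.
apply: le_trans (phat_part_close (n + N) z) _; rewrite mulrAC.
apply: ler_wpM2l.
  rewrite mulr_ge0//.
  by have := le_trans (normr_ge0 _) (pser_le _ z _ P_coef_le); rewrite mul1r.
by rewrite lef_pV2 ?posrE ?ltr0n// ler_nat ltnS leq_addr.
Qed.

End ZetaQuotient.

(** * Transforms of the kernels *)

Section Convolution.
Context {R : realType}.
Local Notation C := R[i].
Local Notation mu := (@lebesgue_measure R).
Variables a k F G : R -> R.
Hypotheses (ma : measurable_fun setT a) (mk : measurable_fun setT k).
Hypotheses (mF : measurable_fun setT F) (mG : measurable_fun setT G).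
Hypotheses (k0 : forall t, 0 <= k t) (F0 : forall y, 0 <= F y) (G0 : forall y, 0 <= G y).
Hypothesis conv : forall y, (\int[mu]_t (k t * F (y - a t))%:E = (G y)%:E)%E.

Lemma convolution_law (h : R -> R) : measurable_fun setT h -> (forall x, 0 <= h x) ->
  (\int[mu]_y (h y * G y)%:E = \int[mu]_t \int[mu]_y (h (a t + y) * (k t * F y))%:E)%E.
Proof.
move=> mh h0.
transitivity (\int[mu]_y \int[mu]_t (h y * (k t * F (y - a t)))%:E)%E.
  apply: eq_integral => y _; rewrite ge0_integralZlR//.
  - by rewrite conv.
  - by meas.
  - by move=> t; rewrite mulr_ge0.
rewrite tonelliR.
- apply: eq_integral => t _.
  rewrite -(ge0_integral_shift (a t)).
  + by apply: eq_integral => y _; rewrite addrK addrC.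
  + by apply/measurable_EFinP; meas.
  + by move=> y; rewrite lee_fin mulr_ge0// mulr_ge0.
- by meas.
- by move=> y t; rewrite mulr_ge0// mulr_ge0.
Qed.

Lemma Laplace_convolution (s : C) : Laplace_dom a k (Re s) -> Laplace_dom idfun F (Re s) ->
  Laplace_dom idfun G (Re s) /\ Laplace idfun G s = Laplace a k s * Laplace idfun F s.
Proof.
move=> domk domF; apply: Laplace_mul => //; first exact: measurable_id.
move=> h ch h0; have mh := continuous_measurable_fun ch.
exact: (convolution_law h mh h0).
Qed.

(** All integrands being nonnegative, the transform of [G] at c is the product of the kernel's mass
    and that of [F] in the extended reals. A finite product with a positive factor forces the other
    factor to be finite. *)
Lemma convolution_dom (c : R) : Laplace_dom a k c -> Laplace_dom idfun G c ->
  0 < \int[mu]_t (expR (c * a t) * k t) -> Laplace_dom idfun F c.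
Proof.
move=> [_ _ _ ik] [_ _ _ iG] k_gt0; split => //; first exact: measurable_id.
apply/integrableP; split; first by apply/measurable_EFinP; meas.
under eq_integral do rewrite gee0_abs ?lee_fin ?mulr_ge0 ?expR_ge0//.
set M := (\int[mu]_x _)%E.
have M0 : (0 <= M)%E by apply: integral_ge0 => y _; rewrite lee_fin mulr_ge0 ?expR_ge0.
have law := @convolution_law (fun y => expR (c * y)) _ (fun y => expR_ge0 _).
rewrite integral_EFin_Rintegral// in law.
have E : (\int[mu]_t \int[mu]_y (expR (c * (a t + y)) * (k t * F y))%:E =
    (\int[mu]_t (expR (c * a t) * k t))%:E * M)%E.
  rewrite -integral_EFin_Rintegral// -ge0_integralZr//=.
  - apply: eq_integral => t _; rewrite -ge0_integralZlR.
    + by apply: eq_integral => y _; rewrite mulrDr expRD; congr EFin; ring.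
    + by rewrite mulr_ge0 ?expR_ge0.
    + by meas.
    + by move=> y; rewrite mulr_ge0 ?expR_ge0.
  - by apply/measurable_EFinP; meas.
  - by move=> t _; rewrite lee_fin mulr_ge0 ?expR_ge0.
have mexp : measurable_fun setT (fun y : R => expR (c * y)) by meas.
move: {law} (law mexp); rewrite E; case: M M0 {E} => [r|_|//]; first by rewrite ltry.
by rewrite mulry gtr0_sg// mul1e.
Qed.

End Convolution.

Section ShiftAndPositivity.
Context {R : realType}.
Local Notation mu := (@lebesgue_measure R).

Lemma Laplace_shift (F : R -> R) (b : R) (s : R[i]) : Laplace_dom idfun F (Re s) ->
  Laplace_dom idfun (fun y => F (y + b)) (Re s) /\
  Laplace idfun (fun y => F (y + b)) s = Cexp (- (s * b%:C)) * Laplace idfun F s.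
Proof.
move=> dom; have [_ mF F0 iF] := dom.
have dom' : Laplace_dom (fun y => y - b) F (Re s).
  split => //; first by meas.
  apply: eq_integrable (integrable_scaleR _ _ mu setT measurableT (expR (- (Re s * b))) _ iF) => //.
  by move=> y _ /=; rewrite mulrA -expRD; congr (expR _ * _)%:E; ring.
have mFb : measurable_fun setT (fun y : R => F (y + b)) by apply: (measurableT_comp mF); meas.
have [|d ->] := Laplace_eq_law _ _ idfun (fun y => F (y + b)) _ dom' (@measurable_id _ _ _) mFb (fun y => F0 _).
  move=> h ch h0; rewrite -[RHS](ge0_integral_shift b).
  - by apply: eq_integral => y _; rewrite addrK.
  - apply/measurable_EFinP; have mh := continuous_measurable_fun ch; meas.
  - by move=> y; rewrite lee_fin mulr_ge0.
split=> //; rewrite -CintegralZ//; last exact: Laplace_integrable.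
apply: eq_Cintegral => y _; rewrite mulrA -CexpD rmorphB /=; congr (Cexp _ * _).
by ring.
Qed.

Lemma Laplace_domZ (F : R -> R) (c a : R) : 0 <= c -> Laplace_dom idfun F a ->
  Laplace_dom idfun (fun y => c * F y) a.
Proof.
move=> c0 [mi mF F0 iF]; split => //; first by meas.
- by move=> x; rewrite mulr_ge0.
apply: eq_integrable (integrable_scaleR _ _ mu setT measurableT c _ iF) => //.
by move=> y _ /=; rewrite mulrCA.
Qed.

(** A zero integral would make the integrand vanish almost everywhere, in particular almost
    everywhere on [0, 1], which has measure 1. *)
Lemma integral_step_gt0 (F : R -> R) : measurable_fun setT F ->
  mu.-integrable setT (EFin \o (fun v => F v * step v)) ->
  (forall v, 0 < F v) -> 0 < \int[mu]_v (F v * step v).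
Proof.
move=> mF iF F_gt0.
have F0 v : 0 <= F v * step v by rewrite mulr_ge0 ?step_ge0// ltW.
rewrite lt_def Rintegral_ge0 ?andbT; last by move=> v _.
apply/eqP => I0.
have : (\int[mu]_v `|(F v * step v)%:E| = 0)%E.
  under eq_integral do rewrite gee0_abs ?lee_fin//.
  by rewrite integral_EFin_Rintegral// I0.
have mFs : measurable_fun setT (fun v : R => (F v * step v)%:E).
  by apply/measurable_EFinP; meas.
move/(ae_eq_integral_abs mu measurableT mFs) => [N [mN N0 sub]].
have : (mu (`[0%R, 1%R]%classic : set R) <= mu N)%E.
  rewrite le_measure ?inE//.
  move=> v /=; rewrite in_itv/= => /andP[v0 v1]; apply: (sub v) => /= h.
  have := h I => -[]; rewrite stepE v0 mulr1 => /eqP.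
  by rewrite gt_eqF.
by rewrite N0 lebesgue_measure_itv/= lte_fin ltr01 oppr0 adde0 lee_fin ler10.
Qed.

End ShiftAndPositivity.

(** * The transforms of theta and K *)

Section Transforms.
Context {R : realType}.
Local Notation C := R[i].
Local Notation mu := (@lebesgue_measure R).

Definition arg (y : R) : R := pi * expR (- (2 * y)).

Lemma arg_gt0 y : 0 < arg y.
Proof. by rewrite mulr_gt0 ?pi_gt0 ?expR_gt0. Qed.

Lemma argB y b : arg (y - b) = arg y * expR (2 * b).
Proof. by rewrite /arg -mulrA -expRD; congr (_ * expR _); ring. Qed.

Lemma measurable_arg : measurable_fun setT arg.
Proof. by rewrite /arg; meas. Qed.

Variable m : nat.

Definition theta (y : R) : R := arg y ^+ (2 * m + 4) / (1 + arg y ^+ 2).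

Lemma theta_ge0 y : 0 <= theta y.
Proof. by have a := ltW (arg_gt0 y); rewrite divr_ge0 ?addr_ge0 ?exprn_ge0. Qed.

(** The substitution is chosen so that [arg] squared becomes e^Y, which turns theta into an
    exponential times the logistic weight. *)
Lemma theta_affine Y :
  theta (- (1 / 4) * Y + ln pi / 2) = expR (m.+2%:R * Y) * (1 + expR Y)^-1.
Proof.
have E : arg (- (1 / 4) * Y + ln pi / 2) = expR (Y / 2).
  rewrite /arg -{1}(expR_ln pi (pi_gt0 R)) -expRD; congr expR.
  by field.
rewrite /theta E -!expRM_natl; congr (expR _ / (1 + expR _)).
  by rewrite natrD natrM -(addn2 m) natrD; field.
by field.
Qed.

Lemma measurable_theta : measurable_fun setT theta.
Proof.
rewrite (_ : theta = (fun y => expR (m.+2%:R * (2 * ln pi - 4 * y)) * (1 + expR (2 * ln pi - 4 * y))^-1)).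
  apply: measurable_funM; first by meas.
  by apply: (measurableT_comp measurable_logistic); meas.
by apply/funext => y; rewrite -theta_affine; congr theta; field.
Qed.

(** The strip is exactly the set where a = m + 2 - s/4 satisfies 0 < Re a < 1, the range of
    convergence of the logistic transform. *)
Lemma Laplace_theta (s : C) : strip m.+1 s ->
  Laplace_dom idfun theta (Re s) /\
  Laplace idfun theta s = Cexp (s * (ln pi / 2)%:C) * (1 / 4)%:C * logistic_transform (m.+2%:R%:C - s * (1 / 4)%:C).
Proof.
rewrite /strip /= => /andP[s1 s2].
set a : C := _ - s * _.
have Rea : Re a = m.+2%:R - Re s * (1 / 4) by rewrite ReD ReN ReMr.
have a01 : 0 < Re a < 1.
  have e : m.+2%:R = m.+1%:R + 1 :> R by rewrite natr1.
  by rewrite Rea e; rewrite natrM in s1 s2; apply/andP; split; lra.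
have [domR _] := logistic_transformE _ a01; have [mi ml l0 iR] := domR.
pose tau1 (Y : R) := - (1 / 4) * Y + ln pi / 2.
pose w1 (Y : R) := 1 / 4 * (expR (m.+2%:R * Y) * (1 + expR Y)^-1).
have mw1 : measurable_fun setT w1.
  by apply: measurable_funM => //; apply: measurable_funM => //; meas.
have mt1 : measurable_fun setT tau1 by rewrite /tau1; meas.
have w10 Y : 0 <= w1 Y by rewrite mulr_ge0// mulr_ge0 ?expR_ge0.
have dom1 : Laplace_dom tau1 w1 (Re s).
  split => //.
  apply: eq_integrable (integrable_scaleR _ _ mu setT measurableT (expR (Re s * (ln pi / 2)) / 4) _ iR) => //.
  move=> Y _ /=; congr EFin; rewrite /w1 /tau1 Rea.
  have -> : expR (Re s * (- (1 / 4) * Y + ln pi / 2)) = expR (Re s * (ln pi / 2)) * expR (- (Re s * (1 / 4)) * Y).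
    by rewrite -expRD; congr expR; ring.
  have -> : expR ((m.+2%:R - Re s * (1 / 4)) * Y) = expR (m.+2%:R * Y) * expR (- (Re s * (1 / 4)) * Y).
    by rewrite -expRD; congr expR; ring.
  by ring.
have [||d ->] := Laplace_eq_law _ _ idfun theta _ dom1 (@measurable_id _ _ _) measurable_theta.
- exact: theta_ge0.
- move=> h ch h0; have mh := continuous_measurable_fun ch; have mth := measurable_theta.
  rewrite (ge0_integral_affine (- (1 / 4)) (ln pi / 2)).
  + rewrite normrN ger0_norm// -ge0_integralZlR//.
    * by apply: eq_integral => Y _; rewrite theta_affine /w1 mulrCA.
    * by meas.
    * by move=> Y; rewrite mulr_ge0// theta_ge0.
  + by rewrite oppr_eq0; apply/eqP; lra.
  + by apply/measurable_EFinP; meas.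
  + by move=> Y; rewrite lee_fin mulr_ge0// theta_ge0.
split => //; rewrite /logistic_transform /Laplace -(CintegralZ _ _ mu setT measurableT); last exact: Laplace_integrable.
apply: eq_Cintegral => Y _; rewrite /w1 /tau1.
have -> : (1 / 4 * (expR (m.+2%:R * Y) * (1 + expR Y)^-1))%:C =
    (1 / 4)%:C * (Cexp (m.+2%:R * Y)%:C * (1 + expR Y)^-1%:C) by rewrite Cexp_real -!rmorphM.
have -> : s * (- (1 / 4) * Y + ln pi / 2)%:C = s * (ln pi / 2)%:C - s * (1 / 4)%:C * Y%:C.
  by rewrite rmorphD rmorphM rmorphN /=; ring.
have -> : a * Y%:C = (m.+2%:R * Y)%:C - s * (1 / 4)%:C * Y%:C by rewrite /a mulrBl (rmorphM _ m.+2%:R).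
by rewrite !CexpD; ring.
Qed.

Definition K_arg (y : R) : R := K_fun m (arg y).

Lemma measurable_K_arg : measurable_fun setT K_arg.
Proof.
by have mK := measurable_pser _ _ (@K_coef_le R m); apply: (measurableT_comp mK); exact: measurable_arg.
Qed.

Lemma K_arg_gt0 y : 0 < K_arg y.
Proof. by rewrite K_gt0// arg_gt0. Qed.

Definition gamma_kernel (t : R) : R := expR (1 / 4 * ln t) * gamma_weight t.

Lemma measurable_gamma_kernel : measurable_fun setT gamma_kernel.
Proof. by have mg := @measurable_gamma_weight R; rewrite /gamma_kernel; meas. Qed.

Lemma gamma_kernel_ge0 t : 0 <= gamma_kernel t.
Proof. by rewrite mulr_ge0 ?expR_ge0 ?gamma_weight_ge0. Qed.

(** Translating y by -(1/2) ln t multiplies [arg] by t, so the multiplicative average of [K_law] is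
    an additive convolution in y. *)
Lemma gamma_kernel_conv y :
  (\int[mu]_t (gamma_kernel t * K_arg (y - 1 / 2 * ln t))%:E = (theta y)%:E)%E.
Proof.
rewrite -(K_law m _ (arg_gt0 y)); apply: eq_integral => t _; congr EFin.
have [t0|t0] := ltP 0 t; last by rewrite /gamma_kernel /gamma_weight stepoE ltNge t0 /= !(mul0r, mulr0).
rewrite /gamma_kernel /K_arg argB.
have -> : 2 * (1 / 2 * ln t) = ln t by field.
by rewrite expR_ln.
Qed.

Lemma Laplace_gamma_kernel (s : C) : 0 < Re s ->
  Laplace_dom (fun t => 1 / 2 * ln t) gamma_kernel (Re s) /\
  Laplace (fun t => 1 / 2 * ln t) gamma_kernel s = Gamma (s * (1 / 2)%:C + (5 / 4)%:C).
Proof.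
move=> s0; have q0 : -1 < Re s / 2 + 1 / 4 by lra.
have [ml mg g0 ig] := gamma_dom _ q0.
split.
  split; [by meas|exact: measurable_gamma_kernel|exact: gamma_kernel_ge0|].
  apply: eq_integrable ig => //= t _; congr EFin; rewrite /gamma_kernel mulrA -expRD.
  by congr (expR _ * _); field.
rewrite Gamma_Laplace; last by rewrite ReD ReMr /=; lra.
apply: eq_Laplace => t.
have -> : (gamma_kernel t)%:C = Cexp (1 / 4 * ln t)%:C * (gamma_weight t)%:C.
  by rewrite Cexp_real -rmorphM.
rewrite mulrA -CexpD; congr (Cexp _ * _).
have -> : 5 / 4 = 1 + 1 / 4 :> R by field.
by rewrite rmorphD /= rmorph1 !(rmorphM _ _ (ln t)); ring.
Qed.

Lemma Laplace_K (s : C) : strip m.+1 s ->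
  Laplace_dom idfun K_arg (Re s) /\
  Gamma (s * (1 / 2)%:C + (5 / 4)%:C) * Laplace idfun K_arg s = Laplace idfun theta s.
Proof.
move=> strs; have [domT _] := Laplace_theta _ strs.
have s0 : 0 < Re s by move: strs => /= /andP[h _]; apply: le_lt_trans h.
have [domk <-] := Laplace_gamma_kernel _ s0.
have [mk_ mk k0 ik] := domk.
have q0 : 0 < Re s / 2 + 5 / 4 by lra.
(* This mass is the real Gamma value at Re s / 2 + 5/4. *)
have kpos : 0 < \int[mu]_t (expR (Re s * (1 / 2 * ln t)) * gamma_kernel t).
  have := gam_gt0 _ q0; rewrite /gam; congr (0 < _); apply: eq_Rintegral => t _.
  by rewrite /gamma_kernel mulrA -expRD; congr (expR _ * _); field.
have dF := convolution_dom _ _ _ _ mk_ mk measurable_K_arg k0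
  (fun y => ltW (K_arg_gt0 y)) gamma_kernel_conv _ domk domT kpos.
split=> //.
by have [_ ->] := Laplace_convolution _ _ _ _ mk_ mk measurable_K_arg measurable_theta k0
  (fun y => ltW (K_arg_gt0 y)) theta_ge0 gamma_kernel_conv _ domk dF.
Qed.

End Transforms.

Section ComplexLimits.
Context {R : realType}.
Local Notation C := R[i].

Lemma Ccvg_of_norm (u : nat -> C) (l : C) (d : nat -> R) :
  (\forall n \near \oo, `|l - u n| <= (d n)%:C) -> d @ \oo --> 0 -> (u : nat -> C^o) @ \oo --> (l : C^o).
Proof.
move=> ud d0; apply/cvgrPdist_lt => e e0.
have [r eE] : exists r : R, e = r%:C.
  by exists (Re e); case: e e0 => x y; rewrite ltcE /= => /andP[/eqP -> _].
rewrite eE ltcR in e0.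
move/cvgrPdist_lt : d0 => /(_ r e0) d0; near=> n.
apply: (@le_lt_trans _ _ (d n)%:C); first by near: n.
rewrite eE ltcR; apply: le_lt_trans (ler_norm _) _.
have : `|0 - d n| < r by near: n.
by rewrite sub0r normrN.
Unshelve. all: by end_near. Qed.

Lemma Ccvg_real (u : nat -> R) (l : R) : u @ \oo --> l ->
  ((fun n => (u n)%:C) : nat -> C^o) @ \oo --> (l%:C : C^o).
Proof.
move=> ul; apply: (@Ccvg_of_norm _ _ (fun n => `|l - u n|)).
  by apply: nearW => n; rewrite -rmorphB /= norm_real.
have := cvg_norm (cvgB (cvg_cst l) ul); rewrite subrr normr0; exact.
Qed.

Lemma CcvgZ (k : C) (u : nat -> C) (l : C) : (u : nat -> C^o) @ \oo --> (l : C^o) ->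
  ((fun n => k * u n) : nat -> C^o) @ \oo --> (k * l : C^o).
Proof. by move=> ul; exact: (@cvgZl_tmp _ C^o). Qed.

Lemma Cpowr_realE (n : nat) (x : R) : Cpowr n%:R (- x%:C) = (expR (- (x * ln n%:R)))%:C.
Proof. by rewrite /Cpowr -Cexp_real -rmorphN -rmorphM mulNr. Qed.

Lemma zeta_real (x : R) : 4 <= x -> zeta x%:C = (zt x)%:C.
Proof.
move=> x4; rewrite /zeta /= (lt_le_trans _ x4) ?ltr1n//.
rewrite /Dirichlet_zeta /Cseries.
have -> : Cpsum 1 (fun n => Cpowr n%:R (- x%:C)) = (fun n => (zpart x n)%:C).
  apply/funext => n; rewrite /Cpsum /zpart rmorph_sum /=.
  by apply: eq_bigr => k _; exact: Cpowr_realE.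
apply: (@cvg_lim C^o) => //.
by apply: Ccvg_real; exact: zpart_cvg.
Qed.

End ComplexLimits.

(** * The zeta factor on the transform side *)

Section ZetaTransform.
Context {R : realType}.
Local Notation C := R[i].
Local Notation mu := (@lebesgue_measure R).
Variable m : nat.
Local Notation K_arg := (@K_arg R m).

Definition phat_arg (y : R) : R := phat m (arg y).

Lemma measurable_phat_arg : measurable_fun setT phat_arg.
Proof.
have mp := measurable_pser _ _ (@P_coef_le R m); have ma := @measurable_arg R.
exact: (measurableT_comp mp ma).
Qed.

Lemma phat_arg_gt0 y : 0 < phat_arg y.
Proof. by rewrite phat_gt0// arg_gt0. Qed.

Lemma phat_arg_dom (s : C) : strip m.+1 s -> Laplace_dom idfun phat_arg (Re s).
Proof.
move=> /Laplace_K[domK _].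
apply: Laplace_dom_le (Laplace_domZ _ (5 / 3) _ _ domK) _ _ => //.
- exact: measurable_phat_arg.
- by move=> y; rewrite phat_le ?arg_gt0// ltW// phat_arg_gt0.
Qed.

Lemma strip_coord (s : C) : strip m.+1 s -> 0 < Re (m.+2%:R%:C - s * (1 / 4)%:C) < 1.
Proof.
rewrite /strip /= => /andP[s1 s2]; rewrite ReD ReN ReMr /=.
have e : m.+2%:R = m.+1%:R + 1 :> R by rewrite natr1.
by rewrite e; rewrite natrM in s1 s2; apply/andP; split; lra.
Qed.

(** If it vanished, so would the transform of theta; but its logistic factor times a sine equals pi.
    Needed in order to divide in the next identity. *)
Lemma Laplace_K_neq0 (s : C) : strip m.+1 s -> Laplace idfun K_arg s != 0.
Proof.
move=> strs; have [_ E] := Laplace_K _ _ strs; have [_ E'] := Laplace_theta _ _ strs.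
have R0 := logistic_reflection _ (strip_coord _ strs).
apply/eqP => L0; move: E; rewrite L0 mulr0 E' => /esym/eqP; apply/negP.
apply: mulf_neq0; first apply: mulf_neq0.
- by rewrite -normr_eq0 normCexp fmorph_eq0 gt_eqF// expR_gt0.
- have q0 : 1 / 4 != 0 :> R by rewrite div1r invr_eq0 pnatr_eq0.
  by rewrite fmorph_eq0.
- apply/eqP => Rf; move: R0; rewrite Rf mulr0 => /eqP.
  by rewrite eq_sym fmorph_eq0 gt_eqF ?pi_gt0.
Qed.

Definition zeta_sum (s : C) : nat -> C^o := Cpsum 1 (fun n => Cpowr n%:R (- (2^-1 + s))).

(** Translating by ln n divides [arg] by n^2 and multiplies the transform by n^(-s); with the weight
    n^(-1/2) this is the Dirichlet term at 1/2 + s. *)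
Lemma Laplace_phat_part (s : C) N : strip m.+1 s ->
  Cintegrable mu setT (fun y => Cexp (s * y%:C) * (phat_part m N (arg y))%:C) /\
  Cintegral mu setT (fun y => Cexp (s * y%:C) * (phat_part m N (arg y))%:C) =
  zeta_sum s N * Laplace idfun phat_arg s.
Proof.
move=> strs; have dom := phat_arg_dom _ strs.
pose F n (y : R) : C := (expR (- (1 / 2 * ln n%:R)))%:C * (Cexp (s * y%:C) * (phat_arg (y + ln n%:R))%:C).
have iF n : Cintegrable mu setT (F n).
  apply: (CintegrableZ _ _ mu setT measurableT).
  have [d _] := Laplace_shift _ (ln n%:R) _ dom; exact: (Laplace_integrable _ _ _ d).
have E y : \sum_(1 <= n < N) F n y = Cexp (s * y%:C) * (phat_part m N (arg y))%:C.
  rewrite /phat_part rmorph_sum /= mulr_sumr; apply: eq_bigr => n _.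
  rewrite /F rmorphM /= mulrCA; congr (_ * (_ * (phat m _)%:C)).
  by rewrite -[in LHS](opprK (ln n%:R)) argB mulrN.
split.
  apply: (eq_Cintegrable _ _ mu setT measurableT _ _ (fun y _ => E y)).
  exact: (Cintegrable_sum _ _ mu setT measurableT).
rewrite -(eq_Cintegral _ _ mu setT _ _ (fun y _ => E y)).
rewrite (Cintegral_sum _ _ mu setT measurableT)//.
rewrite /zeta_sum /Cpsum mulr_suml; apply: eq_bigr => n _.
have [d EL] := Laplace_shift _ (ln n%:R) _ dom.
rewrite (CintegralZ _ _ mu setT measurableT) -/(Laplace idfun (fun y => phat_arg (y + ln n%:R)) s); last first.
  exact: (Laplace_integrable _ _ _ d).
rewrite EL mulrA; congr (_ * _).
rewrite -Cexp_real -CexpD /Cpowr; congr Cexp.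
by rewrite rmorphN !rmorphM /= fmorphV /= rmorphMn /= rmorph1; field.
Qed.

(** Integrating the relative tail bound shows that the partial Dirichlet sums times L_phat converge
    to L_K. Since L_K is nonzero, L_phat is too, and division yields at once the convergence of the
    complex Dirichlet series, which the definition by [limn] requires, and its value. *)
Lemma zeta_Laplace (s : C) : strip m.+1 s ->
  zeta (2^-1 + s) * Laplace idfun phat_arg s = Laplace idfun K_arg s.
Proof.
move=> strs; have [domK _] := Laplace_K _ _ strs; have [_ mK _ iK] := domK.
have half : Re (2^-1 : C) = 2^-1.
  by rewrite -[2^-1]/((2%:R : C)^-1) -(rmorph_nat (real_complex R)) -fmorphV.
have s1 : 1 < Re (2^-1 + s).
  have : 4 <= (4 * m.+1)%:R :> R by rewrite natrM ler_peMr// ler1n.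
  by move: strs; rewrite /strip /= ReD half => /andP[h _]; lra.
have bound N : `|Laplace idfun K_arg s - zeta_sum s N.+2 * Laplace idfun phat_arg s| <=
    (2 * (5 / 6 * \int[mu]_y (expR (Re s * y) * K_arg y)) * N.+1%:R^-1)%:C.
  have [iP <-] := Laplace_phat_part _ N.+2 strs.
  rewrite -mulN1r -(CintegralZ _ _ mu setT measurableT)// -(CintegralD _ _ mu setT measurableT); last 2 first.
  - exact: Laplace_integrable.
  - exact: (CintegrableZ _ _ mu setT measurableT).
  have iK' : mu.-integrable setT (EFin \o (fun y => 5 / 6 * N.+1%:R^-1 * (expR (Re s * y) * K_arg y))).
    exact: (integrable_scaleR _ _ mu setT measurableT).
  apply: (le_trans (norm_Cintegral_le _ _ mu setT measurableT _ _ _ iK' _)).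
  - apply: (CintegrableD _ _ mu setT measurableT); first exact: Laplace_integrable.
    exact: (CintegrableZ _ _ mu setT measurableT).
  - move=> y _; rewrite mulN1r -mulrBr -rmorphB normrM normCexp ReMr norm_real -rmorphM lecR mulrCA.
    by apply: ler_wpM2l; rewrite ?expR_ge0// phat_part_tail// arg_gt0.
  - rewrite lecR RintegralZl// le_eqVlt; apply/orP; left; apply/eqP; ring.
have cvgD : (fun n => zeta_sum s n * Laplace idfun phat_arg s : C^o) @ \oo --> (Laplace idfun K_arg s : C^o).
  apply: (@Ccvg_of_norm _ _ _ (fun n => 2 * (5 / 6 * \int[mu]_y (expR (Re s * y) * K_arg y)) * harmonic n.-2)).
    by exists 2%N => // -[|[|n]]//= _; exact: bound.
  rewrite -(mulr0 (2 * (5 / 6 * \int[mu]_y (expR (Re s * y) * K_arg y)))).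
  apply: cvgMr; rewrite -(cvg_shiftn 2%N).
  by under eq_fun do rewrite addn2; exact: cvg_harmonic.
have L0 : Laplace idfun phat_arg s != 0.
  apply/negP => /eqP L0; move: cvgD; rewrite L0; under eq_fun do rewrite mulr0.
  move=> /(cvg_unique (@norm_hausdorff _ _) (cvg_cst (0 : C^o))) /esym /eqP.
  by apply/negP; exact: Laplace_K_neq0.
suff -> : zeta (2^-1 + s) = Laplace idfun K_arg s / Laplace idfun phat_arg s by rewrite divfK.
rewrite /zeta s1 /Dirichlet_zeta /Cseries; apply: (@cvg_lim C^o) => //.
have := CcvgZ (Laplace idfun phat_arg s)^-1 _ _ cvgD.
rewrite (mulrC _^-1) [X in X @ _](_ : _ = zeta_sum s)//.
by apply/funext => n; rewrite mulrC mulfK.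
Qed.

End ZetaTransform.

(** * The factors 2k - 1/4 and the identification of P *)

Section Antiderivative.
Context {R : realType}.
Local Notation C := R[i].
Local Notation mu := (@lebesgue_measure R).
Variable m : nat.
Local Notation P_coef := (@P_coef R m).
Local Notation phat := (@phat R m).
Local Notation phat_arg := (@phat_arg R m).

Definition Q_coef (k : nat) : R := P_coef k / ((2 * k)%:R - 1 / 4).

Lemma Q_denom_ge1 k : (1 <= k)%N -> 1 <= (2 * k)%:R - 1 / 4 :> R.
Proof. by move=> k1; have : 1 <= k%:R :> R by [rewrite ler1n]; rewrite natrM; lra. Qed.

Lemma Q_coef_le k : `|Q_coef k| <= 1 * ecoef k.
Proof.
rewrite /Q_coef; have [km|mk] := leqP k m.+1.
  by rewrite P_coef_eq0// mul0r normr0 mul1r ltW// ecoef_gt0.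
have d1 := Q_denom_ge1 k (ltn_trans (ltn0Sn _) mk).
have d0 : 0 < (2 * k)%:R - 1 / 4 :> R by exact: lt_le_trans d1.
apply: le_trans (P_coef_le m k); rewrite normrM ler_piMr// normfV ger0_norm ?(ltW d0)//.
by rewrite invf_le1.
Qed.

Definition Q_fun (z : R) : R := pser Q_coef z.

(** The nonzero coefficients start at k = m + 2 >= 2, so each term decays at least like e^(-4v).
    This outweighs the growing factor e^(v/4) of the next lemma and leaves the rate 15/4. *)
Lemma phat_scale_le (z v : R) n : 0 <= v ->
  `|series (fun k => P_coef k * expR (- v) ^+ (2 * k) * z ^+ (2 * k)) n| <= expR (- (4 * v)) * pser ecoef z.
Proof.
move=> v0; apply: pser_partial_le => k.
apply: norm_P_coefM_le; rewrite ?exprn_ge0 ?expR_ge0// => mk.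
apply: (@le_trans _ _ (expR (- (4 * v)))).
  rewrite -expRM_natl ler_expR mulrN lerN2 ler_wpM2r//.
  by rewrite ler_nat (@leq_mul 2 2)// (leq_trans _ mk).
by rewrite ler_peMr ?expR_ge0// zt_ge1// zeta_arg_ge4// (ltn_trans _ mk).
Qed.

(** 1 / (2k - 1/4) is the integral of e^(-(2k - 1/4) v) over v >= 0, and e^(-2kv) is absorbed into
    the argument of [phat]; dominated convergence allows the termwise integration. *)
Lemma Q_repr (z : R) :
  mu.-integrable setT (EFin \o (fun v => expR (1 / 4 * v) * phat (z * expR (- v)) * step v)) /\
  Q_fun z = \int[mu]_v (expR (1 / 4 * v) * phat (z * expR (- v)) * step v).
Proof.
have mp := measurable_pser _ _ (@P_coef_le R m).
pose f k v := P_coef k * z ^+ (2 * k) * (expR (((2 * k)%:R - 1 / 4) * - v) * step v).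
pose g v := pser ecoef z * (expR (15 / 4 * - v) * step v).
have mf k : measurable_fun setT (f k) by rewrite /f; meas.
have ig : mu.-integrable setT (EFin \o g).
  apply: (integrable_scaleR _ _ mu setT measurableT).
  by have q : 0 < 15 / 4 :> R by [lra]; have [] := step_dom _ q.
have iI k : (1 <= k)%N -> mu.-integrable setT (EFin \o (fun v => expR (((2 * k)%:R - 1 / 4) * - v) * step v)).
  by move=> /Q_denom_ge1 k1; have [] := step_dom _ (lt_le_trans ltr01 k1).
have fi k : mu.-integrable setT (EFin \o f k) /\ \int[mu]_v f k v = Q_coef k * z ^+ (2 * k).
  have [km|mk] := leqP k m.+1.
    have -> : f k = (fun=> 0) by apply/funext => v; rewrite /f P_coef_eq0// !mul0r.
    split; first by rewrite (_ : _ \o _ = cst 0%E)//; exact: integrable0.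
    by rewrite /Rintegral integral0 /Q_coef P_coef_eq0// !mul0r.
  have k1 : (1 <= k)%N by exact: ltn_trans mk.
  split; first by apply: (integrable_scaleR _ _ mu setT measurableT); exact: iI.
  rewrite /f RintegralZl//; last exact: iI.
  have -> : \int[mu]_v (expR (((2 * k)%:R - 1 / 4) * - v) * step v) = ((2 * k)%:R - 1 / 4)^-1.
    apply: EFin_inj; rewrite -integral_EFin_Rintegral; last exact: iI.
    by rewrite integral_step// (lt_le_trans ltr01)// Q_denom_ge1.
  by rewrite /Q_coef mulrAC.
have E v n : series (f ^~ v) n = expR (1 / 4 * v) * step v *
    series (fun k => P_coef k * expR (- v) ^+ (2 * k) * z ^+ (2 * k)) n.
  rewrite /series /= mulr_sumr; apply: eq_bigr => k _; rewrite /f -expRM_natl.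
  have -> : ((2 * k)%:R - 1 / 4) * - v = 1 / 4 * v + (2 * k)%:R * - v by ring.
  by rewrite expRD; ring.
have mF : measurable_fun setT (fun v : R => expR (1 / 4 * v) * phat (z * expR (- v)) * step v).
  by rewrite /phat; meas.
have [||] := cvg_integral_series f _ g mf mF (fun k => (fi k).1) _ ig.
- move=> v; rewrite (_ : series (f ^~ v) = fun n => expR (1 / 4 * v) * step v *
    series (fun k => P_coef k * expR (- v) ^+ (2 * k) * z ^+ (2 * k)) n); last exact/funext/E.
  rewrite [X in _ --> X]mulrAC stepE; have [v0|v0] := leP 0 v; last first.
    by rewrite mulr0 mul0r; under eq_fun do rewrite mul0r; exact: cvg_cst.
  rewrite /phat pser_scale; apply: cvgMr; apply: (pser_cvg _ _ 1) => k.
  apply: norm_P_coefM_le; rewrite ?exprn_ge0 ?expR_ge0// => mk.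
  rewrite mul1r (@le_trans _ _ 1)//; first by rewrite exprn_ile1 ?expR_ge0// expR_le1 oppr_le0.
  by rewrite zt_ge1// zeta_arg_ge4// (ltn_trans _ mk).
- move=> v n; rewrite E /g stepE; have [v0|v0] := leP 0 v; last by rewrite !(mulr0, mul0r) normr0.
  rewrite !mulr1 normrM ger0_norm ?expR_ge0//.
  apply: (@le_trans _ _ (expR (1 / 4 * v) * (expR (- (4 * v)) * pser ecoef z))).
    by apply: ler_wpM2l; rewrite ?expR_ge0//; exact: phat_scale_le.
  rewrite mulrA -expRD mulrC.
  by have -> : 1 / 4 * v - 4 * v = 15 / 4 * - v by lra.
move=> iF sF; split => //; apply: (@cvg_lim R) => //.
apply: cvg_trans sF; rewrite (_ : (fun k => \int[mu]_v f k v) = (fun k => Q_coef k * z ^+ (2 * k)))//.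
by apply/funext => k; rewrite (fi k).2.
Qed.

Lemma Q_gt0 (z : R) : 0 < z -> 0 < Q_fun z.
Proof.
move=> z0; have [iI ->] := Q_repr z; have mp := measurable_pser _ _ (@P_coef_le R m).
apply: integral_step_gt0 => //; first by rewrite /phat; meas.
by move=> v; rewrite mulr_gt0 ?expR_gt0// phat_gt0// mulr_gt0// expR_gt0.
Qed.

Definition Q_arg (y : R) : R := Q_fun (arg y).

Lemma Q_arg_gt0 y : 0 < Q_arg y.
Proof. by rewrite Q_gt0// arg_gt0. Qed.

Lemma measurable_Q_arg : measurable_fun setT Q_arg.
Proof.
have mq := measurable_pser _ _ Q_coef_le; have ma := @measurable_arg R.
exact: (measurableT_comp mq ma).
Qed.

Lemma Laplace_Q (s : C) : strip m.+1 s ->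
  Laplace_dom idfun Q_arg (Re s) /\
  Laplace idfun Q_arg s = (s * (1 / 2)%:C - (1 / 4)%:C)^-1 * Laplace idfun phat_arg s.
Proof.
move=> strs; have domp := phat_arg_dom _ _ strs.
have s4 : 4 < Re s.
  move: strs => /= /andP[h _]; apply: le_lt_trans h.
  by rewrite natrM ler_peMr// ler1n.
(* Translating y by t/2 multiplies [arg] by e^(-t), so the representation of Q is a convolution
   whose kernel has transform 1 / (s/2 - 1/4). *)
pose a (t : R) : R := - (1 / 2 * t).
pose k (t : R) : R := expR (1 / 4 * t) * step t.
have ma : measurable_fun setT a by rewrite /a; meas.
have mk : measurable_fun setT k by rewrite /k; meas.
have k0 t : 0 <= k t by rewrite mulr_ge0 ?expR_ge0 ?step_ge0.
pose c : C := s * (1 / 2)%:C - (1 / 4)%:C.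
have Rec : Re c = Re s * (1 / 2) - 1 / 4 by rewrite ReD ReN ReMr.
have c0 : 0 < Re c by rewrite Rec; lra.
have domk : Laplace_dom a k (Re s).
  have [ms mst st0 i1] := step_dom _ c0; split => //; rewrite Rec in i1.
  apply: eq_integrable i1 => //= t _; rewrite /k /a mulrA -expRD; congr (expR _ * _)%:E.
  by field.
have Lk : Laplace a k s = c^-1.
  rewrite -(Laplace_step _ c0); apply: eq_Laplace => t; rewrite /k.
  have -> : (expR (1 / 4 * t) * step t)%:C = Cexp (1 / 4 * t)%:C * (step t)%:C.
    by rewrite Cexp_real -rmorphM.
  rewrite mulrA -CexpD; congr (Cexp _ * _).
  by rewrite /a /c !rmorphN !(rmorphM _ _ t) /=; ring.
have conv y : (\int[mu]_t (k t * phat_arg (y - a t))%:E = (Q_arg y)%:E)%E.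
  have [iI E] := Q_repr (arg y); rewrite /Q_arg E -integral_EFin_Rintegral//.
  apply: eq_integral => t _; rewrite /k /phat_arg argB /a.
  have -> : 2 * - (1 / 2 * t) = - t by field.
  by rewrite mulrAC.
rewrite -Lk; apply: (Laplace_convolution _ _ _ _ ma mk (measurable_phat_arg m) measurable_Q_arg k0
  (fun y => ltW (phat_arg_gt0 m y)) (fun y => ltW (Q_arg_gt0 y)) conv _ domk domp).
Qed.

Definition P_const : R := (pi `^ (3 / 4))^-1.

Lemma P_const_gt0 : 0 < P_const.
Proof. by rewrite invr_gt0 powR_gt0 ?pi_gt0. Qed.

(** For these k the Gamma and zeta arguments are real and in the range of the real functions [gam]
    and [zt]; the sign (-1)^(m + 2) (-1)^k is the one built into [K_coef]. *)
Lemma P_term_coef (z : C) k : (m.+2 <= k)%N ->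
  (-1) ^+ m.+2 * P_term z k = (P_const * Q_coef k)%:C * z ^+ (2 * k).
Proof.
move=> mk; have k1 : (1 <= k)%N by exact: leq_trans mk.
have E1 : 5 / 4 + (2 * k)%:R = ((2 * k)%:R + 5 / 4 : R)%:C.
  by rewrite (rmorphD (real_complex R)) (rmorphM (real_complex R)) fmorphV !(rmorph_nat (real_complex R)) addrC.
have E2 : 2^-1 + (4 * k)%:R = (zeta_arg k : R)%:C.
  by rewrite /zeta_arg div1r (rmorphD (real_complex R)) fmorphV !(rmorph_nat (real_complex R)) addrC.
have E3 : (2 * k)%:R - 4^-1 = ((2 * k)%:R - 1 / 4 : R)%:C.
  by rewrite div1r (rmorphB (real_complex R)) fmorphV !(rmorph_nat (real_complex R)).
rewrite /P_term /ctilde4 E1 E2 E3 Gamma_real ?ecoef_arg_gt0// zeta_real ?zeta_arg_ge4//.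
rewrite -!rmorphM -fmorphV (exprNn (z ^+ 2)) -exprM mulrCA (mulrA (_ ^+ m.+2)) -exprD mulrA; congr (_ * _).
rewrite /P_const /Q_coef /P_coef /K_coef mk.
have -> : (-1) ^+ (m.+2 + k) = (-1) ^+ (m + k) :> C by rewrite !addSn !exprS; ring.
rewrite /ecoef -(rmorph1 (real_complex R)) -rmorphN -rmorphXn -rmorphM; congr _%:C.
move: (_ - _) (zt _) (gam _) (_ `^ _) => a b c d.
by rewrite !invfM -[true%:R]/(1 : R); ring.
Qed.

Definition P4_coef (k : nat) : R := P_const * Q_coef k.

Lemma P4_coef_le k : `|P4_coef k| <= P_const * ecoef k.
Proof.
rewrite normrM ger0_norm ?(ltW P_const_gt0)//; apply: ler_wpM2l; first exact: ltW P_const_gt0.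
by apply: le_trans (Q_coef_le k) _; rewrite mul1r.
Qed.

Lemma Cpsum_P_term (z : C) n : Cpsum m.+2 (P_term z) n =
  (-1) ^+ m.+2 * Cpsum 0 (fun k => (P4_coef k)%:C * z ^+ (2 * k)) n.
Proof.
rewrite /Cpsum (big_nat_widenl _ 0%N)// mulr_sumr [LHS]big_mkcond /=; apply: eq_bigr => k _.
case: ltnP => mk; last first.
  by rewrite /P4_coef /Q_coef P_coef_eq0// mul0r mulr0 mul0r mulr0.
by rewrite /P4_coef -P_term_coef// mulrA -expr2 sqrr_sign mul1r.
Qed.

(** Convergence is a premise because [P4] is defined by [limn]; the prefactor (-1)^(w + 1) then
    cancels against the sign of the terms. *)
Lemma P4_Cseries (z : C) (l : C) :
  Cpsum 0 (fun k => (P4_coef k)%:C * z ^+ (2 * k)) @ \oo --> (l : C^o) ->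
  Cpsum m.+2 (P_term z) @ \oo --> ((-1) ^+ m.+2 * l : C^o) /\ P4 m.+1 z = l.
Proof.
move=> cv; have cv' : Cpsum m.+2 (P_term z) @ \oo --> ((-1) ^+ m.+2 * l : C^o).
  rewrite (_ : Cpsum _ _ = fun n => (-1) ^+ m.+2 * Cpsum 0 (fun k => (P4_coef k)%:C * z ^+ (2 * k)) n).
    exact: CcvgZ.
  by apply/funext => n; exact: Cpsum_P_term.
split => //; rewrite /P4 /Cseries (@cvg_lim C^o _ _ _ _ _ _ cv')//.
by rewrite mulrA -expr2 sqrr_sign mul1r.
Qed.

Lemma P4E (z : R) : P4 m.+1 z%:C = (P_const * Q_fun z)%:C.
Proof.
apply: (P4_Cseries _ _ _).2.
rewrite (_ : Cpsum _ _ = fun n => (P_const * series (fun k => Q_coef k * z ^+ (2 * k)) n)%:C).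
  by apply: Ccvg_real; apply: cvgMr; exact: (pser_cvg _ _ 1 Q_coef_le).
apply/funext => n; rewrite /Cpsum /series /= mulr_sumr rmorph_sum /=.
by apply: eq_bigr => k _; rewrite -rmorphXn -rmorphM mulrA.
Qed.

End Antiderivative.

(** * Assembling the product n(s) L_P(s) *)

Section Identity.
Context {R : realType}.
Local Notation C := R[i].
Local Notation mu := (@lebesgue_measure R).
Variable m : nat.

Definition P_arg (y : R) : R := P_const * Q_arg m y.

Lemma P4_arg (y : R) : P4 m.+1 (arg y)%:C = (P_arg y)%:C.
Proof. by rewrite P4E. Qed.

Lemma P_arg_gt0 y : 0 < P_arg y.
Proof. by rewrite mulr_gt0 ?P_const_gt0 ?Q_arg_gt0. Qed.

Lemma P_arg_dom (s : C) : strip m.+1 s -> Laplace_dom idfun P_arg (Re s).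
Proof. by move=> /Laplace_Q[dom _]; apply: Laplace_domZ => //; exact/ltW/P_const_gt0. Qed.

(** Exponents of pi: -(s/2 + 1/4) from xi, s/2 from theta, -3/4 from the coefficients. The remaining
    1 / pi cancels the pi of the reflection formula. *)
Lemma Cpowr_pi_mul (s : C) :
  Cpowr pi (- (s * (1 / 2)%:C + (1 / 4)%:C)) * Cexp (s * (ln pi / 2)%:C) * P_const%:C = (pi^-1)%:C :> C.
Proof.
rewrite /Cpowr -CexpD.
have -> : - (s * (1 / 2)%:C + (1 / 4)%:C) * (ln pi)%:C + s * (ln pi / 2)%:C = (- (1 / 4) * ln pi)%:C.
  have -> : ln pi / 2 = 1 / 2 * ln pi :> R by ring.
  by rewrite !(rmorphM _ _ (ln pi)) rmorphN /=; ring.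
rewrite Cexp_real -rmorphM; congr _%:C.
rewrite /P_const /powR gt_eqF ?pi_gt0// -expRN -expRD.
have -> : - (1 / 4) * ln pi - 3 / 4 * ln pi = - ln pi :> R by field.
by rewrite expRN expR_ln ?pi_gt0.
Qed.

(** In xi(1/2 + s) the polynomial factors are 2 (s/2 + 1/4) and 2 (s/2 - 1/4): the first lifts
    Gamma(s/2 + 1/4) to the Gamma(s/2 + 5/4) of the kernel, the second cancels the factor brought in
    by Q. The numerical 4 that is left meets the 1/4 of the substitution in theta. *)
Lemma n_fun_Laplace (s : C) : strip m.+1 s ->
  n_fun s * Laplace idfun P_arg s = (-1) ^+ m.+1.
Proof.
move=> strs.
have s4 : 4 < Re s.
  move: strs => /= /andP[h _]; apply: le_lt_trans h.
  by rewrite natrM ler_peMr// ler1n.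
have h2 : (1 / 2 : R)%:C = 2^-1 by rewrite div1r fmorphV (rmorph_nat (real_complex R)).
have h4 : (1 / 4 : R)%:C = 4^-1 by rewrite div1r fmorphV (rmorph_nat (real_complex R)).
have h54 : (5 / 4 : R)%:C = 4^-1 + 1.
  by rewrite -h4 -(rmorph1 (real_complex R)) -rmorphD; congr _%:C; field.
have [dQ EQ] := Laplace_Q m _ strs.
have EL : Laplace idfun P_arg s = P_const%:C * Laplace idfun (Q_arg m) s.
  rewrite /Laplace -(CintegralZ _ _ mu setT measurableT); last exact: (Laplace_integrable _ _ _ dQ).
  by apply: eq_Cintegral => y _; rewrite /P_arg rmorphM /= mulrCA.
have [_ EK] := Laplace_K m _ strs; have [_ ET] := Laplace_theta m _ strs.
have EZ := zeta_Laplace m _ strs.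
have R0 := logistic_reflection _ (strip_coord m _ strs).
have Ep := Cpowr_pi_mul s.
have G1 : Gamma (s * (1 / 2)%:C + (5 / 4)%:C) =
    (s * (1 / 2)%:C + (1 / 4)%:C) * Gamma (s * (1 / 2)%:C + (1 / 4)%:C).
  have q0 : 0 < Re (s * (1 / 2)%:C + (1 / 4)%:C) by rewrite ReD ReMr /=; clear -s4; lra.
  by rewrite -GammaD1// h54 h4 addrA.
have sig : (2^-1 + s) / 2 = s * (1 / 2)%:C + (1 / 4)%:C by rewrite h2 h4; field.
have c0 : s * (1 / 2)%:C - (1 / 4)%:C != 0.
  by apply/eqP => /(congr1 Re); rewrite ReD ReN ReMr /= => h; clear -s4 h; lra.
(* The shift by m + 2 half-periods of the sine is the source of the sign (-1)^w. *)
have sn : Csin (pi%:C * s / 4) = (-1) ^+ m.+1 * sinpiz (m.+2%:R%:C - s * (1 / 4)%:C).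
  rewrite rmorph_nat addrC sinpizDn sinpizN mulrA -exprD.
  have -> : (-1) ^+ (m.+1 + m.+2) = -1 :> C by rewrite addnS exprS addnn -mul2n exprM sqrrN expr1n expr1n mulr1.
  by rewrite mulN1r opprK /sinpiz h4 mulrA.
rewrite /n_fun /xi sn sig EL EQ.
have p0 : (pi%:C : C) != 0 by rewrite fmorph_eq0 gt_eqF ?pi_gt0.
suff main : 4 * Cpowr pi (- (s * (1 / 2)%:C + (1 / 4)%:C)) * P_const%:C *
    (Gamma (s * (1 / 2)%:C + (5 / 4)%:C) *
      (zeta (2^-1 + s) * Laplace idfun (phat_arg m) s)) * sinpiz (m.+2%:R%:C - s * (1 / 4)%:C) = 1.
  have {}main := congr1 ( *%R ((-1) ^+ m.+1)) main.
  rewrite -[RHS]mulr1 -{}main G1.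
  have -> : 2^-1 + s = 2 * (s * (1 / 2)%:C + (1 / 4)%:C) by rewrite h2 h4; field.
  have -> : 2 * (s * (1 / 2)%:C + (1 / 4)%:C) - 1 = 2 * (s * (1 / 2)%:C - (1 / 4)%:C) by rewrite h4; field.
  move: c0; move: (_ - (1 / 4)%:C) => g g0.
  move: (sinpiz _) (Cpowr _ _) (Gamma _) (Laplace _ _ _) => c d e b.
  move: (zeta _) => a; move: (_ + _) => f.
  by field.
rewrite EZ EK ET h4.
apply: (mulfI p0); rewrite mulr1 -[RHS]R0.
have -> : 4 * Cpowr pi (- (s * (1 / 2)%:C + 4^-1)) * P_const%:C *
   (Cexp (s * (ln pi / 2)%:C) * 4^-1 * logistic_transform (m.+2%:R%:C - s * 4^-1)) * sinpiz (m.+2%:R%:C - s * 4^-1) =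
   Cpowr pi (- (s * (1 / 2)%:C + 4^-1)) * Cexp (s * (ln pi / 2)%:C) * P_const%:C *
   (sinpiz (m.+2%:R%:C - s * 4^-1) * logistic_transform (m.+2%:R%:C - s * 4^-1)) by field.
by rewrite -h4 Ep fmorphV mulVKf.
Qed.

Lemma f_fun_Laplace (s : C) : strip m.+1 s -> f_fun s = (-1) ^+ m.+1 * Laplace idfun P_arg s.
Proof.
move=> /n_fun_Laplace E; have n0 : n_fun s != 0.
  by apply/eqP => n0; move/eqP: E; rewrite n0 mul0r eq_sym signr_eq0.
by rewrite /f_fun; apply: (mulfI n0); rewrite mulfV// mulrCA E -expr2 sqrr_sign.
Qed.

End Identity.

(** * Analyticity *)

Section QuadraticRemainder.
Context {R : realType}.
Local Notation C := R[i].
Local Notation mu := (@lebesgue_measure R).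

Lemma derivable_of_quadratic (g : C -> C) (s D : C) (eps B : R) : 0 < eps -> 0 <= B ->
  (forall h : C, `|h| < eps%:C -> `|g (s + h) - g s - h * D| <= B%:C * `|h| ^+ 2) ->
  derivable (g : C^o -> C^o) s 1.
Proof.
move=> eps0 B0 H; apply/cvg_ex; exists D; apply/cvgrPdist_lt => e e0.
have B1 : 0 < (B + 1)%:C by rewrite ltcR ltr_wpDl.
have eB : 0 < e / (B + 1)%:C by rewrite divr_gt0.
have epsC : 0 < eps%:C by rewrite ltcR.
near=> h.
have h0 : h != 0 by near: h; exact: nbhs_dnbhs_neq.
have h1 : `|h| < eps%:C by near: h; exact: dnbhs0_lt.
have h2 : `|h| < e / (B + 1)%:C by near: h; exact: dnbhs0_lt.
have nh0 : 0 < `|h| by rewrite normr_gt0.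
have Hh := H h h1.
have -> : D - h^-1 *: (g (h *: 1 + s) - g s) = - (h^-1 * (g (s + h) - g s - h * D)).
  by rewrite /GRing.scale /= mulr1 (addrC h) [in RHS]mulrBr mulKf// opprB.
rewrite normrN normrM normfV mulrC ltr_pdivrMr//.
apply: le_lt_trans Hh _; rewrite expr2 mulrA ltr_pM2r//.
apply: (@le_lt_trans _ _ ((B + 1)%:C * `|h|)).
  by apply: ler_wpM2r => //; rewrite lecR lerDl.
by rewrite mulrC -ltr_pdivlMr.
Unshelve. all: by end_near. Qed.

Lemma sqr_le_expR (x : R) : 0 <= x -> x ^+ 2 <= 4 * expR x.
Proof.
move=> x0; have h := expR_ge1Dx (x / 2).
have -> : expR x = expR (x / 2) ^+ 2 by rewrite -expRM_natl; congr expR; field.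
by nra.
Qed.

Lemma expR_normr_le (x : R) : expR `|x| <= expR x + expR (- x).
Proof.
have a := expR_ge0 x; have b := expR_ge0 (- x).
by case: ger0P => _; rewrite ?lerDl ?lerDr.
Qed.

(** The derivative is the transform weighted by y. Half of the margin 2 eps pays for y^2, by (eps
    y)^2 <= 4 e^(eps |y|), and the other half for e^(|h| |y|); e^(2 eps |y|) is then bounded by the
    two exponentials at Re s + 2 eps and Re s - 2 eps. The constant 40 is 10 times 4. *)
Lemma Laplace_quadratic (F : R -> R) (s : C) (eps : R) : 0 < eps ->
  Laplace_dom idfun F (Re s) ->
  Laplace_dom idfun F (Re s + 2 * eps) -> Laplace_dom idfun F (Re s - 2 * eps) ->
  exists D B, 0 <= B /\ forall h : C, `|h| <= eps%:C -> Laplace_dom idfun F (Re (s + h)) ->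
    `|Laplace idfun F (s + h) - Laplace idfun F s - h * D| <= B%:C * `|h| ^+ 2.
Proof.
move=> e0 dom domp domm; have [_ mF F0 _] := dom; have [_ _ _ ip] := domp; have [_ _ _ im] := domm.
pose G y := expR ((Re s + 2 * eps) * y) * F y + expR ((Re s - 2 * eps) * y) * F y.
have iG : mu.-integrable setT (EFin \o G) by exact: (integrable_addR _ _ mu setT measurableT).
have G0 y : 0 <= G y by rewrite addr_ge0// mulr_ge0 ?expR_ge0.
have expG y : expR (Re s * y) * expR (2 * (eps * `|y|)) * F y <= G y.
  rewrite /G -mulrDl; apply: ler_wpM2r => //.
  have -> : expR ((Re s + 2 * eps) * y) + expR ((Re s - 2 * eps) * y) =
     expR (Re s * y) * (expR (2 * eps * y) + expR (- (2 * eps * y))).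
    by rewrite mulrDr -!expRD; congr (expR _ + expR _); ring.
  apply: ler_wpM2l; first exact: expR_ge0.
  apply: le_trans (expR_normr_le _); rewrite normrM ger0_norm ?mulrA//.
  by rewrite mulr_ge0// ltW.
pose dF y : C := y%:C * (Cexp (s * y%:C) * (F y)%:C).
have mRe : measurable_fun setT (fun y => Re (dF y)).
  rewrite (_ : (fun y => _) = fun y => y * (expR (Re s * y) * cos (Im s * y) * F y)).
    apply: measurable_funM => //; apply: measurable_funM => //; apply: measurable_funM; first by meas.
    by apply: measurable_cosR; meas.
  by apply/funext => y; rewrite /dF mulrC !ReMr ReCexp ReMr ImMr mulrC.
have mIm : measurable_fun setT (fun y => Im (dF y)).
  rewrite (_ : (fun y => _) = fun y => y * (expR (Re s * y) * sin (Im s * y) * F y)).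
    apply: measurable_funM => //; apply: measurable_funM => //; apply: measurable_funM; first by meas.
    by apply: measurable_sinR; meas.
  by apply/funext => y; rewrite /dF mulrC !ImMr ImCexp ReMr ImMr mulrC.
have nE (y : R) : `|Cexp (s * y%:C) * (F y)%:C| = (expR (Re s * y) * F y)%:C.
  by rewrite normrM normCexp ReMr norm_real ger0_norm// -rmorphM.
have idF : Cintegrable mu setT dF.
  refine (Cintegrable_dominated _ _ mu setT measurableT dF (fun y => eps^-1 * G y) mRe mIm _
    (integrable_scaleR _ _ mu setT measurableT _ _ iG)).
  move=> y _; rewrite normrM nE norm_real -rmorphM lecR ler_pdivlMl//.
  apply: le_trans (expG y).
  have -> : eps * (`|y| * (expR (Re s * y) * F y)) = expR (Re s * y) * (eps * `|y|) * F y by ring.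
  apply: ler_wpM2r => //.
  apply: ler_wpM2l; first exact: expR_ge0.
  have h := expR_ge1Dx (2 * (eps * `|y|)); have := mulr_ge0 (ltW e0) (normr_ge0 y); lra.
exists (Cintegral mu setT dF), (2 * (40 / eps ^+ 2 * \int[mu]_y G y)).
have IG0 : 0 <= \int[mu]_y G y by apply: Rintegral_ge0.
split; first by rewrite mulr_ge0// mulr_ge0// divr_ge0// sqr_ge0.
move=> h he domh.
have [rho rho0 [rhoE _]] := normCE h.
have re : rho <= eps by rewrite rhoE lecR in he.
have is_ := Laplace_integrable _ _ _ dom; have ish := Laplace_integrable _ _ _ domh.
pose E (y : R) : C := Cexp ((s + h) * y%:C) * (F y)%:C + (-1) * (Cexp (s * y%:C) * (F y)%:C) + (- h) * dF y.
have iE1 := CintegrableZ _ _ mu setT measurableT (-1) _ is_.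
have iE2 := CintegrableZ _ _ mu setT measurableT (- h) _ idF.
have iE12 := CintegrableD _ _ mu setT measurableT _ _ ish iE1.
have iE : Cintegrable mu setT E := CintegrableD _ _ mu setT measurableT _ _ iE12 iE2.
have -> : Laplace idfun F (s + h) - Laplace idfun F s - h * Cintegral mu setT dF = Cintegral mu setT E.
  rewrite (CintegralD _ _ mu setT measurableT _ _ iE12 iE2) (CintegralD _ _ mu setT measurableT _ _ ish iE1).
  by rewrite !(CintegralZ _ _ mu setT measurableT)// mulN1r mulNr.
have iG' : mu.-integrable setT (EFin \o (fun y => 40 * rho ^+ 2 / eps ^+ 2 * G y)).
  exact: (integrable_scaleR _ _ mu setT measurableT).
apply: le_trans (norm_Cintegral_le _ _ mu setT measurableT _ _ iE iG' _) _.
  move=> y _.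
  have -> : E y = Cexp (s * y%:C) * (F y)%:C * (Cexp (h * y%:C) - 1 - h * y%:C).
    by rewrite /E /dF mulrDl CexpD; ring.
  have hy : `|h * y%:C| <= (rho * `|y|)%:C by rewrite normrM norm_real rhoE -rmorphM.
  rewrite normrM nE; apply: le_trans (ler_wpM2l _ (CexpB1Bz_le _ _ hy)) _.
    by rewrite lecR mulr_ge0 ?expR_ge0.
  rewrite -rmorphM lecR.
  have y0 := normr_ge0 y; have ey0 : 0 <= eps * `|y| by rewrite mulr_ge0// ltW.
  have c0 (c : R) : 0 <= c -> 0 <= c * rho ^+ 2 / eps ^+ 2.
    by move=> ?; apply: divr_ge0; [apply: mulr_ge0 => //; exact: sqr_ge0|exact: sqr_ge0].
  have a1 : 10 * (rho * `|y|) ^+ 2 * expR (rho * `|y|) <= 40 * rho ^+ 2 / eps ^+ 2 * expR (2 * (eps * `|y|)).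
    have -> : 10 * (rho * `|y|) ^+ 2 = 10 * rho ^+ 2 / eps ^+ 2 * (eps * `|y|) ^+ 2.
      by rewrite !exprMn; field; rewrite gt_eqF.
    have -> : 40 * rho ^+ 2 / eps ^+ 2 * expR (2 * (eps * `|y|)) =
       10 * rho ^+ 2 / eps ^+ 2 * ((4 * expR (eps * `|y|)) * expR (eps * `|y|)).
      have -> : expR (2 * (eps * `|y|)) = expR (eps * `|y|) * expR (eps * `|y|).
        by rewrite -expRD; congr expR; ring.
      by ring.
    rewrite -mulrA; apply: ler_wpM2l; first exact: c0.
    apply: ler_pM; rewrite ?sqr_ge0 ?expR_ge0 ?sqr_le_expR//.
    by rewrite ler_expR ler_wpM2r.
  apply: le_trans (ler_wpM2l _ a1) _; first by rewrite mulr_ge0 ?expR_ge0.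
  rewrite mulrCA; apply: ler_wpM2l; first exact: c0.
  by rewrite mulrAC; exact: expG.
rewrite rhoE -rmorphXn -rmorphM lecR RintegralZl//.
by rewrite le_eqVlt; apply/orP; left; apply/eqP; ring.
Qed.

End QuadraticRemainder.

Lemma natr_predM (K : comNzRingType) (z : K) n : n%:R * z ^+ n.-1 * z = n%:R * z ^+ n.
Proof. by case: n => [|n]; [rewrite !mul0r|rewrite -mulrA -exprSr]. Qed.

(* The right-hand side is |h|^2 times the same remainder of (|z| + 1)^n, which is what
   makes the induction close. *)
Lemma norm_pow_quadratic (K : numDomainType) (z h : K) n : `|h| <= 1 ->
  `|(z + h) ^+ n - z ^+ n - h * (n%:R * z ^+ n.-1)| <=
  ((`|z| + 1) ^+ n - `|z| ^+ n - n%:R * `|z| ^+ n.-1) * `|h| ^+ 2.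
Proof.
move=> h1; elim: n => [|n IH]; first by rewrite !expr0 !mul0r !subrr mulr0 subr0 normr0 !mul0r.
have -> : (z + h) ^+ n.+1 - z ^+ n.+1 - h * (n.+1%:R * z ^+ n) =
    (z + h) * ((z + h) ^+ n - z ^+ n - h * (n%:R * z ^+ n.-1)) + n%:R * z ^+ n.-1 * h ^+ 2.
  by have e := natr_predM _ z n; rewrite !exprS -(natr1 n); ring: e.
have -> : (`|z| + 1) ^+ n.+1 - `|z| ^+ n.+1 - n.+1%:R * `|z| ^+ n =
    (`|z| + 1) * ((`|z| + 1) ^+ n - `|z| ^+ n - n%:R * `|z| ^+ n.-1) + n%:R * `|z| ^+ n.-1.
  by have e := natr_predM _ `|z| n; rewrite !exprS -(natr1 n); ring: e.
rewrite [leRHS]mulrDl; apply: le_trans (ler_normD _ _) _; apply: lerD.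
  rewrite normrM -mulrA; apply: ler_pM => //; apply: le_trans (ler_normD _ _) _.
  by rewrite lerD2l.
by rewrite !normrM normr_nat !normrX.
Qed.

(** The preceding remainder bound at h = 1 shows that its right-hand bracket is nonnegative, which
    is already the claim. *)
Lemma natr_pow_pred_le (K : numDomainType) (z : K) n :
  `|n%:R * z ^+ n.-1| <= (`|z| + 1) ^+ n.
Proof.
have := norm_pow_quadratic _ z 1 n; rewrite normr1 => /(_ (lexx _)).
move/(le_trans (normr_ge0 _)); rewrite expr1n mulr1 => h.
rewrite normrM normr_nat normrX -subr_ge0; apply: le_trans h _.
by rewrite addrAC gerBl exprn_ge0.
Qed.

(** * Termwise differentiation of complex power series *)

Section PowerSeriesDerivative.
Context {R : realType}.
Local Notation C := R[i].

(** Real and imaginary parts are summed separately, each below the majorant; this accounts for the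
    factor 2. *)
Lemma Cpsum_dominated (u : nat -> C) (d : nat -> R) :
  (forall k, `|u k| <= (d k)%:C) -> cvgn (series d) ->
  exists2 l : C, Cpsum 0 u @ \oo --> (l : C^o) & `|l| <= (2 * limn (series d))%:C.
Proof.
move=> ud cd.
have d0 k : 0 <= d k by rewrite -lecR; exact: le_trans (normr_ge0 _) (ud k).
have dom (v : nat -> R) : (forall k, `|v k| <= d k) ->
    cvgn (series v) /\ `|limn (series v)| <= limn (series d).
  move=> vd; have cn : cvgn [normed series v].
    by apply: (@series_le_cvg _ _ d) => // k; exact: normr_ge0.
  have cv := normed_cvg cn; split=> //.
  have cv' : `|series v n| @[n --> \oo] --> `|limn (series v)| by exact: cvg_norm.
  apply: (ler_cvg_to cv' cd); apply: nearW => n.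
  by apply: le_trans (ler_norm_sum _ _ _) _; apply: ler_sum.
have [cr nr] := dom (fun k => Re (u k)) (fun k => normRe_le _ _ (ud k)).
have [ci ni] := dom (fun k => Im (u k)) (fun k => normIm_le _ _ (ud k)).
exists (limn (series (fun k => Re (u k))) +i* limn (series (fun k => Im (u k)))); last first.
  by rewrite mulr_natl mulr2n; apply: normc_le_ReIm.
have psumE n : Cpsum 0 u n = series (fun k => Re (u k)) n +i* series (fun k => Im (u k)) n.
  elim: n => [|n IH]; first by rewrite /Cpsum /series /= !big_geq.
  rewrite /Cpsum big_nat_recr//= -/(Cpsum 0 u n) IH !seriesSr.
  by case: (u n).
apply: (@Ccvg_of_norm _ _ _ (fun n => `|limn (series (fun k => Re (u k))) - series (fun k => Re (u k)) n| +
   `|limn (series (fun k => Im (u k))) - series (fun k => Im (u k)) n|)).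
  by apply: nearW => n; rewrite psumE; apply: normc_le_ReIm.
rewrite -(addr0 0); apply: cvgD.
  by have := cvg_norm (cvgB (cvg_cst (limn (series (fun k => Re (u k))))) cr); rewrite subrr normr0; exact.
by have := cvg_norm (cvgB (cvg_cst (limn (series (fun k => Im (u k))))) ci); rewrite subrr normr0; exact.
Qed.

Lemma CcvgD (u v : nat -> C) (a b : C) : (u : nat -> C^o) @ \oo --> (a : C^o) ->
  (v : nat -> C^o) @ \oo --> (b : C^o) -> ((fun n => u n + v n) : nat -> C^o) @ \oo --> (a + b : C^o).
Proof. by move=> ua vb; exact: (@cvgD _ C^o _ _ _ u v a b ua vb). Qed.

Lemma CpsumD (u v : nat -> C) n : Cpsum 0 (fun k => u k + v k) n = Cpsum 0 u n + Cpsum 0 v n.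
Proof. exact: big_split. Qed.

Lemma CpsumZ (a : C) (u : nat -> C) n : Cpsum 0 (fun k => a * u k) n = a * Cpsum 0 u n.
Proof. by rewrite /Cpsum mulr_sumr. Qed.

Definition cpterm (al : nat -> R) (z : C) (k : nat) : C := (al k)%:C * z ^+ (2 * k).

Section MajorizedSeries.
Variables (al : nat -> R) (eta : R).
Hypothesis al_le : forall k, `|al k| <= eta * ecoef k.

Lemma majorant_cvg (r : R) : cvgn (series (fun k => eta * ecoef k * r ^+ (2 * k))).
Proof.
apply: (pser_cvg _ _ `|eta|) => k.
by rewrite normrM [`|ecoef k|]ger0_norm// ltW// ecoef_gt0.
Qed.

Lemma cpterm_cvg (z : C) : exists l : C, Cpsum 0 (cpterm al z) @ \oo --> (l : C^o).
Proof.
have [r r0 [rE _]] := normCE z.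
have [|l cl _] := Cpsum_dominated (cpterm al z) _ _ (majorant_cvg r); last by exists l.
move=> k; rewrite normrM norm_real normrX rE -rmorphXn -rmorphM lecR.
by apply: ler_wpM2r => //; exact: even_pow_ge0.
Qed.

(** D is the sum of the termwise derivatives, and |h| <= 1 lets the majorant at |z| + 1 control all
    remainders at once. The sums enter as arbitrary limits [l] and [l'], the form in which
    [P4_Cseries] delivers the values of [P4]. *)
Lemma cpterm_quadratic (z : C) : exists D B, 0 <= B /\ forall (h l l' : C), `|h| <= 1 ->
  Cpsum 0 (cpterm al z) @ \oo --> (l : C^o) -> Cpsum 0 (cpterm al (z + h)) @ \oo --> (l' : C^o) ->
  `|l' - l - h * D| <= B%:C * `|h| ^+ 2.
Proof.
have [r0 r00 [rE _]] := normCE z; pose r := r0 + 1.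
have zr : `|z| + 1 = r%:C by rewrite rE -(rmorph1 (real_complex R)) -rmorphD.
have maj := majorant_cvg r.
pose dt k : C := (al k)%:C * ((2 * k)%:R * z ^+ (2 * k).-1).
have [|D cD _] := Cpsum_dominated dt _ _ maj.
  move=> k; rewrite normrM norm_real; apply: le_trans (ler_wpM2l _ (natr_pow_pred_le _ _ _)) _ => //.
    by rewrite lecR.
  rewrite zr -rmorphXn -rmorphM lecR; apply: ler_wpM2r => //; exact: even_pow_ge0.
have L0 : 0 <= limn (series (fun k => eta * ecoef k * r ^+ (2 * k))).
  apply: limr_ge => //; apply: nearW => n; apply: sumr_ge0 => k _.
  by rewrite mulr_ge0 ?even_pow_ge0//; exact: le_trans (al_le k).
exists D, (2 * limn (series (fun k => eta * ecoef k * r ^+ (2 * k)))); split; first exact: mulr_ge0.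
move=> h l l' h1 cl cl'.
have [rho rho0 [rhoE _]] := normCE h.
pose e k := cpterm al (z + h) k + (-1) * cpterm al z k + (- h) * dt k.
have ce : Cpsum 0 e @ \oo --> (l' + (-1) * l + (- h) * D : C^o).
  rewrite (_ : Cpsum 0 e = fun n => Cpsum 0 (cpterm al (z + h)) n + (-1) * Cpsum 0 (cpterm al z) n + (- h) * Cpsum 0 dt n).
    exact: (CcvgD _ _ _ _ (CcvgD _ _ _ _ cl' (CcvgZ (-1) _ _ cl)) (CcvgZ (- h) _ _ cD)).
  by apply/funext => n; rewrite /e !CpsumD !CpsumZ.
have cm : cvgn (series (fun k => rho ^+ 2 * (eta * ecoef k * r ^+ (2 * k)))).
  by have := @is_cvg_seriesZ R _ (rho ^+ 2) maj.
have [|l0 cl0 bl0] := Cpsum_dominated e _ _ cm.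
  move=> k; have -> : e k = (al k)%:C * ((z + h) ^+ (2 * k) - z ^+ (2 * k) - h * ((2 * k)%:R * z ^+ (2 * k).-1)).
    by rewrite /e /cpterm /dt; ring.
  rewrite normrM norm_real; apply: le_trans (ler_wpM2l _ (norm_pow_quadratic _ z h (2 * k) h1)) _.
    by rewrite lecR.
  apply: (@le_trans _ _ (`|al k|%:C * ((`|z| + 1) ^+ (2 * k) * `|h| ^+ 2))).
    apply: ler_wpM2l; first by rewrite lecR.
    apply: ler_wpM2r; first exact: exprn_ge0.
    by rewrite -addrA -opprD gerBl addr_ge0 ?exprn_ge0// mulr_ge0 ?exprn_ge0.
  rewrite zr rhoE -!rmorphXn -!rmorphM lecR.
  rewrite (mulrA `|al k|) [leLHS]mulrC; apply: ler_wpM2l; first exact: sqr_ge0.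
  by apply: ler_wpM2r => //; exact: even_pow_ge0.
have := cvg_unique (@norm_hausdorff _ _) cl0 ce.
have -> : l' + (-1) * l + (- h) * D = l' - l - h * D by ring.
move=> <-; apply: le_trans bl0 _; rewrite rhoE -rmorphXn -rmorphM lecR.
rewrite (lim_seriesZ _ maj) le_eqVlt; apply/orP; left; apply/eqP.
by rewrite /GRing.scale /=; ring.
Qed.

End MajorizedSeries.
End PowerSeriesDerivative.

(** * Both analyticity claims and the theorem *)

Section Conclusion.
Context {R : realType}.
Local Notation C := R[i].
Variable m : nat.

Lemma P4_cvg (z : C) : cvgn (Cpsum m.+2 (P_term z)).
Proof.
have [l cl] := cpterm_cvg _ _ (@P4_coef_le R m) z.
by have [cv _] := P4_Cseries _ _ _ cl; apply/cvg_ex; exists ((-1) ^+ m.+2 * l).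
Qed.

Lemma P4_analytic : analytic_on setT (@P4 R m.+1).
Proof.
move=> z _; have [D [B [B0 H]]] := cpterm_quadratic _ _ (@P4_coef_le R m) z.
apply: (derivable_of_quadratic _ _ D 1 B) => // h h1.
have [l cl] := cpterm_cvg _ _ (@P4_coef_le R m) z.
have [l' cl'] := cpterm_cvg _ _ (@P4_coef_le R m) (z + h).
by rewrite (P4_Cseries _ _ _ cl).2 (P4_Cseries _ _ _ cl').2; apply: H => //; exact: ltW.
Qed.

Lemma f_fun_analytic : analytic_on (strip m.+1) (@f_fun R).
Proof.
move=> s strs; have /andP[s1 s2] : (4 * m.+1)%:R < Re s < (4 * m.+1)%:R + 4 by exact: strs.
pose a : R := (4 * m.+1)%:R.
(* A quarter of the distance to the boundary keeps Re s + 2 eps and Re s - 2 eps inside the strip,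
   where the transform converges. *)
pose eps := Num.min (Re s - a) (a + 4 - Re s) / 4.
have e0 : 0 < eps by rewrite divr_gt0// lt_min !subr_gt0 s1 s2.
have e1 : 4 * eps <= Re s - a by rewrite /eps mulrC divfK// ge_min lexx.
have e2 : 4 * eps <= a + 4 - Re s by rewrite /eps mulrC divfK// ge_min lexx orbT.
have dom x : a < x < a + 4 -> Laplace_dom idfun (P_arg m) x.
  by move=> hx; exact: (P_arg_dom m x%:C hx).
have [|||D [B [B0 H]]] := Laplace_quadratic (P_arg m) s eps e0.
- by apply: dom; apply/andP; split.
- by apply: dom; apply/andP; split; lra.
- by apply: dom; apply/andP; split; lra.
apply: (derivable_of_quadratic _ _ ((-1) ^+ m.+1 * D) eps B) => // h he.
have strh : strip m.+1 (s + h).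
  rewrite /strip /= ReD -/a; have := normRe_le _ _ (ltW he); rewrite ler_norml => /andP[??].
  by apply/andP; split; lra.
rewrite (f_fun_Laplace m _ strh) (f_fun_Laplace m _ strs) -mulrBr (mulrCA h) -mulrBr normrM.
rewrite normrX normrN1 expr1n mul1r; apply: H; first exact: ltW.
exact: P_arg_dom.
Qed.

End Conclusion.

(** The integrability and convergence clauses ensure that the integral and the sum are genuine
    values, not the defaults of [Cintegral] and [limn]; the order on R[i] makes the last clause say
    that the value is real and positive. *)
Theorem mainTheorem2 (R : realType) (w : nat) (hw : (1 <= w)%N) :
  [/\ analytic_on (strip w) (@f_fun R),
      (forall s : R[i], strip w s ->
         let integrand := fun y : R =>
           Cexp (s * y%:C) * P4 w (pi * expR (- (2 * y)))%:C in
         Cintegrable (@lebesgue_measure R) setT integrand /\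
         (-1) ^+ w * f_fun s
           = Cintegral (@lebesgue_measure R) setT integrand),
      (forall z : R[i], cvgn (Cpsum w.+1 (P_term z))) /\ analytic_on setT (@P4 R w)
    & forall y : R, 0 < P4 w (pi * expR (- (2 * y)))%:C].
Proof.
(* From here w = m + 1, the form in which all earlier results are stated. *)
case: w hw => [//|m] _; split.
- exact: f_fun_analytic.
- move=> s strs integrand.
  have E : integrand = fun y => Cexp (s * y%:C) * (P_arg m y)%:C.
    by apply/funext => y; rewrite /integrand -P4_arg.
  rewrite E; split; first exact: (Laplace_integrable _ _ _ (P_arg_dom m _ strs)).
  by rewrite (f_fun_Laplace m _ strs) mulrA -expr2 sqrr_sign mul1r.
- by split; [exact: P4_cvg|exact: P4_analytic].
- by move=> y; rewrite -/(arg y) P4_arg ltcR P_arg_gt0.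
Qed.
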